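(* Let $K$ be a real quadratic field, let $\mathfrak f$ be a nonzero integral ideal of $K$, and let $\mathfrak C\in Cl_K(\mathfrak f)$ be a narrow ray class. Writing $\mathfrak C^*=\mathfrak C\mathfrak C_2$, we have $$X_1(\mathfrak C)=X_1(\mathfrak C^* )^{-1},\qquad X_2(\mathfrak C)=X_2(\mathfrak C^* ).$$
   Context: $K$ is a real quadratic field with ring of integers $O_K$, with a fixed embedding $K\subset\mathbb R$; $x'$ denotes the conjugate of $x\in K$. $\langle a,b\rangle$ denotes the $\mathbb Z$-linear span of $a,b$. $Cl_K(\mathfrak f)$ is the narrow ray class group of modulus $\mathfrak f$ (fractional ideals coprime to $\mathfrak f$ modulo principal ideals $(\alpha)$ with $\alpha$ totally positive and $\alpha\equiv1$ multiplicatively mod $\mathfrak f$). $\mathfrak C_2\in Cl_K(\mathfrak f)$ is the class $[(\mu_2)]$ with $\mu_2\in1+\mathfrak f$, $\mu_2>0$, $\mu_2'<0$. $\varepsilon_{\mathfrak f}>1$ is the generator of the group of totally positive units in $O_K^\times\cap(1+\mathfrak f)$; $\varepsilon=\varepsilon_{O_K}$ is the totally positive fundamental unit $>1$; $r=\log\varepsilon_{\mathfrak f}/\log\varepsilon$ (a positive integer). Decomposition datum of a class $\mathfrak C\in Cl_K(\mathfrak f)$: choose an integral ideal $\mathfrak a\in\mathfrak C$, a number $\omega\in K$ with $0<\omega'<1<\omega$ such that $\mathfrak b=\langle1,\omega\rangle$ is a fractional ideal of $K$, and a totally positive $z\in K^\times$ with $\mathfrak b=(z)\mathfrak a^{-1}\mathfrak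 f$ (such choices exist). Then $\omega$ has a purely periodic ''minus'' continued fraction expansion $$\omega=[[b_0,\dots,b_{m-1}]]:=b_0-\cfrac{1}{b_1-\cfrac{1}{\ddots-\cfrac{1}{b_{m-1}-\cfrac{1}{b_0-\cdots}}}}\qquad(b_k\ge2\text{ integers}),$$ with smallest period $m$; extend by $b_{k+m}=b_k$ for all $k\in\mathbb Z$ and put $\omega_k=[[b_k,\dots,b_{k+m-1}]]$ (so $\omega_0=\omega$, $\omega_k=b_k-1/\omega_{k+1}$, $0<\omega_k'<1<\omega_k$). Define $A_0=1$, $A_{k+1}=A_k/\omega_{k+1}$ for $k\in\mathbb Z$; then $\langle A_{k-1},A_k\rangle=\mathfrak b$ for all $k$. For each $k\in\mathbb Z$, $(x_k,y_k)$ is the unique pair of rational numbers with $0<x_k\le1$, $0\le y_k<1$ and $x_kA_{k-1}+y_kA_k\in z+\mathfrak b$. Put $z_k=x_k\omega_k+y_k$ and $z_k'=x_k\omega_k'+y_k$. The sequence $\{(\omega_k,x_k,y_k)\}$ is determined by $\mathfrak C$ up to a shift of the index $k$ and is periodic with period $rm$. Double sine function: for $\omega,z>0$ let $\zeta_2(s,\omega,z)=\sum_{p,q=0}^\infty(z+p\omega+q)^{-s}$ ($\mathrm{Re}(s)>2$), which continues meromorphically in $s$ and is holomorphic at $s=0$; let $G(\omega,z)=\frac{\partial}{\partial s}\zeta_2(s,\omega,z)|_{s=0}$ and $\mathcal S(\omega,z)=\exp\bigl(G(\omega,1+\omega-z)-G(\omega,z)\bigr)$. (The function $\exp(-G(\omega,z))$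 continues to an entire function of $z$, so $\mathcal S(\omega,z)$ is meromorphic in $z$.) The invariants are $$X_1(\mathfrak C)=\prod_{k=1}^{rm}\mathcal S(\omega_k,z_k),\qquad X_2(\mathfrak C)=\prod_{k=1}^{rm}\mathcal S(\omega_k',z_k'),$$ which do not depend on the choices of $\mathfrak a,\omega,z$; $X_i(\mathfrak C^* )$ is defined in the same way from a decomposition datum (with its own period) of $\mathfrak C^*$.
   Formalization: The first identity is proved only for 𝔣 ≠ O_K: for 𝔣 = O_K every class has X_1 = ε^{-1/2}, so X_1(C)X_1(C* ) = ε^{-1} ≠ 1 and the identity is false; the second identity is proved for all 𝔣. *)

(* Defs.v *)
From HB Require Import structures.
From mathcomp Require Import all_boot all_order all_algebra all_field.
From mathcomp Require Import complex.
From mathcomp Require Import boolp classical_sets functions reals topology.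
From mathcomp Require Import normedtype sequences derive exp trigo.

Set Implicit Arguments.
Unset Strict Implicit.
Unset Printing Implicit Defensive.

Import Order.TTheory GRing.Theory Num.Theory numFieldNormedType.Exports.

Local Open Scope classical_set_scope.
Local Open Scope ring_scope.

Section DoubleSine.
Variable R : realType.

(* [R[i]^o] is the field of complex numbers seen as a normed space over
   itself, which is how it receives its topology. *)
Notation C := (R[i]^o).
Implicit Types (f F : C -> C) (a s : C) (w z t : R).

Definition power_series_sum (c : nat -> C) (u l : C) : Prop :=
  (\sum_(k < N) c k * u ^+ k : C) @[N --> \oo] --> l.

(* Holomorphic = given by a convergent power series on a neighbourhood. *)
Definition holomorphic_at f a : Prop :=
  exists c : nat -> C, \forall s \near a, power_series_sum c (s - a) (f s).

(* Laurent expansion with finite principal part on a punctured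
   neighbourhood; the value of [f] at [a] itself is irrelevant. *)
Definition meromorphic_at f a : Prop :=
  exists (n : nat) (c : nat -> C),
    \forall s \near a^', power_series_sum c (s - a) ((s - a) ^+ n * f s).

(* t ^ s = exp (s * ln t), for t > 0. *)
Definition cpower t s : C :=
  (expR (complex.Re s * ln t))%:C%C
  * (cos (complex.Im s * ln t) +i* sin (complex.Im s * ln t))%C.

(* The double series is absolutely convergent for Re s > 2, so that the order
   of summation is immaterial; it is summed here over growing squares. *)
Definition zeta2_continuation w z F : Prop :=
  [/\ forall a, meromorphic_at F a,
      holomorphic_at F 0
    & forall s, 2 < complex.Re s ->
        (\sum_(p < N) \sum_(q < N) cpower (z + p%:R * w + q%:R) (- s) : C)
          @[N --> \oo] --> F s].

(* The continuation is unique away from its poles. *)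
Definition zeta2 w z : C -> C := xget (fun=> 0) [set F | zeta2_continuation w z F].

(* zeta2 is real on the real axis, hence so is its derivative at 0; [Re] only
   serves to land in [R]. *)
Definition dzeta2_at0 w z : R := complex.Re (derive1 (zeta2 w z) (0 : C)).

(* Only the range 0 < z < 1 + w is needed, where both arguments of the
   exponent are positive and no continuation in z is involved. *)
Definition double_sine w z : R :=
  expR (dzeta2_at0 w (1 + w - z) - dzeta2_at0 w z).

End DoubleSine.

(* [qconj], being a nontrivial automorphism, is the conjugation. *)
Record realQuadratic (R : realType) := RealQuadratic {
  qfield :> fieldExtType rat;
  qfield_dim : \dim {:qfield} = 2;
  qemb : {rmorphism qfield -> R};
  qconj : {rmorphism qfield -> qfield};
  qconj_nontrivial : exists x, qconj x != x
}.

Section RayClasses.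
Variables (R : realType) (K : realQuadratic R).
Implicit Types (x y u alpha : K) (I J f : set K).

Definition emb1 x : R := qemb K x.
Definition emb2 x : R := qemb K (qconj K x).

Definition totally_positive x : Prop := 0 < emb1 x /\ 0 < emb2 x.

Definition OK : set K := [set x | integralOver (intr : int -> K) x].

Definition zspan x y : set K :=
  [set u | exists m n : int, u = m%:~R * x + n%:~R * y].

Definition fractional_ideal I : Prop :=
  [/\ forall x y, I x -> I y -> I (x - y),
      forall x y, OK x -> I y -> I (x * y),
      exists2 x, I x & x != 0
    & exists2 d, OK d & d != 0 /\ forall x, I x -> OK (d * x)].

Definition integral_ideal I : Prop := fractional_ideal I /\ I `<=` OK.

Definition principal x : set K := [set x * y | y in OK].

Definition ideal_mul I J : set K :=
  [set x | exists (n : nat) (u v : 'I_n -> K),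
    [/\ forall i, I (u i), forall i, J (v i) & x = \sum_(i < n) u i * v i]].

Definition ideal_inv I : set K := [set x | forall y, I y -> OK (x * y)].

Definition coprime_ideal I J : Prop := exists x y, [/\ I x, J y & x + y = 1].

Definition coprime_fractional f I : Prop :=
  exists J1 J2 : set K,
    [/\ integral_ideal J1 /\ coprime_ideal J1 f,
        integral_ideal J2 /\ coprime_ideal J2 f
      & I = ideal_mul J1 (ideal_inv J2)].

(* alpha = 1 multiplicatively modulo f: the quotient of two integers prime to f
   that are congruent modulo f. *)
Definition mult_cong1 f alpha : Prop :=
  exists x y,
    [/\ [/\ OK x, x != 0 & coprime_ideal (principal x) f],
        [/\ OK y, y != 0 & coprime_ideal (principal y) f],
        f (x - y)
      & alpha = x / y].

Definition ray_equiv f I J : Prop :=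
  exists alpha, [/\ totally_positive alpha, mult_cong1 f alpha
                  & J = ideal_mul (principal alpha) I].

Definition ray_class f I : set (set K) :=
  [set J | coprime_fractional f J /\ ray_equiv f I J].

Definition ray_class_group f : set (set (set K)) :=
  [set ray_class f I | I in coprime_fractional f].

(* The elementwise product of two cosets is a full coset. *)
Definition ray_class_mul (A B : set (set K)) : set (set K) :=
  [set ideal_mul I J | I in A & J in B].

Definition ray_units f : set K :=
  [set u | [/\ OK u, OK u^-1, totally_positive u & f (u - 1)]].

Definition ray_unit_generator f e : Prop :=
  [/\ ray_units f e, 1 < emb1 e
    & forall u, ray_units f u -> exists n : int, u = e ^ n].

End RayClasses.

(* b 0 - 1/(b 1 - 1/( ... - 1/(b n))) *)
Fixpoint minus_cf_trunc (R : realType) (b : nat -> int) (n : nat) : R :=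
  if n is n'.+1 then (b 0)%:~R - (minus_cf_trunc R (fun j => b j.+1) n')^-1
  else (b 0)%:~R.

Definition minus_cf (R : realType) (b : nat -> int) (x : R) : Prop :=
  minus_cf_trunc R b n @[n --> \oo] --> x.

(* The index k ranges over Z. [dec_wE k] says w_k = [[b_k, b_{k+1}, ...]], and
   [dec_xyP k] says x_k A_{k-1} + y_k A_k lies in z + b. *)
Record decomposition (R : realType) (K : realQuadratic R)
    (f : set K) (cl : set (set K)) := Decomposition {
  dec_a : set K;
  dec_a_integral : integral_ideal dec_a;
  dec_a_class : cl dec_a;

  dec_omega : K;
  dec_omega_reduced :
    [/\ 0 < emb2 dec_omega, emb2 dec_omega < 1 & 1 < emb1 dec_omega];
  dec_b := zspan 1 dec_omega;
  dec_b_fractional : fractional_ideal dec_b;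

  dec_z : K;
  dec_z_pos : totally_positive dec_z;
  dec_bE :
    dec_b = ideal_mul (principal dec_z) (ideal_mul (ideal_inv dec_a) f);

  dec_cf : int -> int;
  dec_cf_ge2 : forall k, 2 <= dec_cf k;
  dec_period : nat;
  dec_period_gt0 : (0 < dec_period)%N;
  dec_cf_periodic : forall k, dec_cf (k + dec_period%:Z) = dec_cf k;
  dec_period_min : forall n : nat, (0 < n)%N ->
    (forall k, dec_cf (k + n%:Z) = dec_cf k) -> (dec_period <= n)%N;

  dec_w : int -> K;
  dec_w0 : dec_w 0 = dec_omega;
  dec_wE : forall k,
    minus_cf (fun j : nat => dec_cf (k + j%:Z)) (emb1 (dec_w k));

  dec_A : int -> K;
  dec_A0 : dec_A 0 = 1;
  dec_AS : forall k, dec_A (k + 1) = dec_A k / dec_w (k + 1);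

  dec_x : int -> rat;
  dec_y : int -> rat;
  dec_x_range : forall k, 0 < dec_x k <= 1;
  dec_y_range : forall k, 0 <= dec_y k < 1;
  dec_xyP : forall k,
    dec_b (dec_x k *: dec_A (k - 1) + dec_y k *: dec_A k - dec_z)
}.

Section Invariants.
Variables (R : realType) (K : realQuadratic R) (f : set K) (cl : set (set K)).

(* Product over the full period r * m; [sg] is one of the two embeddings. *)
Definition invariant_at (sg : K -> R) (r : nat) (D : decomposition f cl) : R :=
  \prod_(1 <= k < (r * dec_period D).+1)
    double_sine (sg (dec_w D k%:Z))
      (ratr (dec_x D k%:Z) * sg (dec_w D k%:Z) + ratr (dec_y D k%:Z)).

Definition invariant1 := invariant_at (@emb1 R K).
Definition invariant2 := invariant_at (@emb2 R K).

End Invariants.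

(* Main.v *)
(** The rays spanned by A_(k-1) and A_k bound a half-open cone in which the coset
    z + b consists of the points (x_k + p) A_(k-1) + (y_k + q) A_k, p, q >= 0.  Hence
    log S(w_k, z_k) is the zeta-regularized sum of log over z + b in this cone, minus
    the same sum over - z + b with the other boundary ray included.  Such a
    difference is additive in the cone.  As A_0 = 1 and A_(rm) = 1 / eps_f, log X_i(C)
    is attached to the cone of (1, e), e = 1 / eps_f, and everything is invariant under
    multiplication by e.  The lattice data of C* are those of C multiplied by a number of
    signature (+, -), so log X_i(C* ) is attached, up to sign, to a cone (m, e m) with m
    in another quadrant.  Both identities result from cutting one cone, bounded by
    rays through 1 or e and through m or e m, in two ways. *)

(* A regularized sum is not scale invariant: multiplying its terms by t shifts the derivative at 0
   by -ln t times the value at 0. Double sines are, because their two sums have equal values at 0,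
   z^2 - (1 + w) z being symmetric under z -> 1 + w - z; so values at 0 are carried along with
   derivatives. [zeta2] merely selects a continuation, hence one must be built first.
   Two-dimensional Euler-Maclaurin summation provides it together with its value at 0, and
   uniqueness then lets every later identity be checked on convergent sums of positive terms, for
   real s > 2.

   The signs arise as follows. In the first embedding m is positive and the coset z + b is kept. In
   the second m is negative and -m is used instead; this gives the coset -z + b and exchanges the
   two sums. In the first identity the cone adjacent to (1, m) is (e, 1), which is (1, e) with the
   other boundary ray included. Changing that ray costs multiples of the Hurwitz values zeta(0, t)
   and zeta(0, 1 - t), which cancel unless z lies in b, that is, unless f = O_K. *)
Require Import Defs.
From mathcomp Require Import all_boot all_order all_algebra all_field.
From mathcomp Require Import complex.
From mathcomp Require Import boolp classical_sets functions cardinality fsbigop reals.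
From mathcomp Require Import topology.
From mathcomp Require Import normedtype sequences derive realfun exp trigo ereal esum.
From mathcomp Require Import ring lra zify.

Set Implicit Arguments.
Unset Strict Implicit.
Unset Printing Implicit Defensive.

Import Order.TTheory GRing.Theory Num.Theory numFieldNormedType.Exports.

Local Open Scope classical_set_scope.
Local Open Scope ring_scope.

(** * Convergent power series *)

Section ComplexAnalysis.
Variable R : realType.
Local Notation C := R[i].
Local Notation Re := (@complex.Re R).
Local Notation Im := (@complex.Im R).
Implicit Types (f g F G : C -> C) (a s x y : C) (u v : nat -> C) (r M : R).

(** The norm on [R[i]] is itself complex-valued; a modulus in [R] permits ordinary real
    estimates. *)
Definition cn x : R := ComplexField.Normc.normc x.

Arguments cn : simpl never.

Lemma cnE x : `|x| = (cn x)%:C%C.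
Proof. by case: x. Qed.

Lemma cn_ge0 x : 0 <= cn x.
Proof. by case: x => a b; rewrite /cn /= sqrtr_ge0. Qed.

Lemma cn0 : cn 0 = 0. Proof. exact: ComplexField.Normc.normc0. Qed.
Lemma cn1 : cn 1 = 1. Proof. exact: ComplexField.Normc.normc1. Qed.

Lemma cn_eq0 x : (cn x == 0) = (x == 0).
Proof.
apply/eqP/eqP => [/ComplexField.Normc.eq0_normc//|->]; exact: cn0.
Qed.

Lemma cn_gt0 x : (0 < cn x) = (x != 0).
Proof. by rewrite lt_def cn_eq0 cn_ge0 andbT. Qed.

Lemma cnM x y : cn (x * y) = cn x * cn y.
Proof. exact: ComplexField.Normc.normcM. Qed.

Lemma cnV x : cn x^-1 = (cn x)^-1.
Proof. exact: ComplexField.Normc.normcV. Qed.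

Lemma cnD x y : cn (x + y) <= cn x + cn y.
Proof. by rewrite -lecR rmorphD /= -!cnE ler_normD. Qed.

Lemma cnN x : cn (- x) = cn x.
Proof. by apply: complexI; rewrite -!cnE normrN. Qed.

Lemma cnB x y : cn (x - y) = cn (y - x).
Proof. by rewrite -cnN opprB. Qed.

Lemma cnX x n : cn (x ^+ n) = cn x ^+ n.
Proof. by elim: n => [|n IH]; rewrite ?expr0 ?cn1// !exprS cnM IH. Qed.

Lemma cn_sum I (t : seq I) (P : pred I) (F : I -> C) :
  cn (\sum_(i <- t | P i) F i) <= \sum_(i <- t | P i) cn (F i).
Proof.
elim/big_rec2: _ => [|i y x _ IH]; first by rewrite cn0.
by apply: le_trans (cnD _ _) _; rewrite lerD2l.
Qed.

Lemma realcD (t t' : R) : (t + t')%:C%C = t%:C%C + t'%:C%C :> C.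
Proof. exact: rmorphD. Qed.
Lemma realcN (t : R) : (- t)%:C%C = - t%:C%C :> C.
Proof. exact: rmorphN. Qed.
Lemma realcB (t t' : R) : (t - t')%:C%C = t%:C%C - t'%:C%C :> C.
Proof. exact: rmorphB. Qed.
Lemma realcM (t t' : R) : (t * t')%:C%C = t%:C%C * t'%:C%C :> C.
Proof. exact: rmorphM. Qed.
Lemma realcV (t : R) : (t^-1)%:C%C = (t%:C%C)^-1 :> C.
Proof. exact: fmorphV. Qed.
Lemma realcX (t : R) n : (t ^+ n)%:C%C = t%:C%C ^+ n :> C.
Proof. exact: rmorphXn. Qed.
Lemma realc_nat n : (n%:R : R)%:C%C = n%:R :> C.
Proof. exact: rmorph_nat. Qed.
Lemma realc_sum I (t : seq I) (P : pred I) (F : I -> R) :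
  (\sum_(i <- t | P i) F i)%:C%C = \sum_(i <- t | P i) (F i)%:C%C :> C.
Proof. exact: raddf_sum. Qed.

Lemma cn_real (t : R) : cn t%:C%C = `|t|.
Proof. by rewrite /cn /= expr0n /= addr0 sqrtr_sqr. Qed.

Lemma cn_nat n : cn n%:R = n%:R.
Proof. by rewrite -(rmorph_nat (real_complex R)) cn_real normr_nat. Qed.

Lemma cn_Re x : `|Re x| <= cn x.
Proof.
case: x => p q; rewrite /cn /= -sqrtr_sqr ler_wsqrtr//.
by rewrite lerDl sqr_ge0.
Qed.

Lemma cn_Im x : `|Im x| <= cn x.
Proof.
case: x => p q; rewrite /cn /= -sqrtr_sqr ler_wsqrtr//.
by rewrite lerDr sqr_ge0.
Qed.

Lemma cn_ReIm x : cn x <= `|Re x| + `|Im x|.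
Proof.
rewrite {1}[x]complexE; apply: le_trans (cnD _ _) _.
rewrite cnM !cn_real.
suff -> : cn 'i%C = 1 by rewrite mul1r.
by rewrite /cn /= expr0n expr1n add0r sqrtr1.
Qed.

Lemma cn_le_dist x y : cn x <= cn y + cn (x - y).
Proof. by have := cnD y (x - y); rewrite addrC subrK. Qed.

Lemma cn_triangle x y z : cn (x - z) <= cn (x - y) + cn (y - z).
Proof. by have := cnD (x - y) (y - z); rewrite addrA subrK. Qed.

(** Epsilon form of convergence for [cn]; [cvg_ctoP] identifies it with filter convergence in
    [R[i]^o]. *)
Definition cto u (l : C) :=
  forall e : R, 0 < e -> exists N, forall n, (N <= n)%N -> cn (u n - l) < e.

Lemma cto_squeeze u l (e : nat -> R) N :
  (forall n, (N <= n)%N -> cn (u n - l) <= e n) -> e @ \oo --> (0 : R) ->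
  cto u l.
Proof.
move=> ue /cvgrPdist_lt e0 d d0.
have [N1 _ H] := e0 _ d0.
exists (maxn N N1) => n; rewrite geq_max => /andP[h1 h2].
apply: le_lt_trans (ue _ h1) _.
by have := H n h2; rewrite /= sub0r normrN; apply: le_lt_trans (ler_norm _).
Qed.

Lemma cto_cst x : cto (fun=> x) x.
Proof. by move=> e e0; exists 0%N => n _; rewrite subrr cn0. Qed.

Lemma eq_cto u v l N : (forall n, (N <= n)%N -> u n = v n) -> cto u l -> cto v l.
Proof.
move=> uv ul e e0; have [N1 H] := ul _ e0.
exists (maxn N N1) => n; rewrite geq_max => /andP[h1 h2].
by rewrite -uv// H.
Qed.

Lemma ctoD u v l m : cto u l -> cto v m -> cto (fun n => u n + v n) (l + m).
Proof.
move=> ul vm e e0; have e2 : 0 < e / 2 by rewrite divr_gt0.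
have [N1 H1] := ul _ e2; have [N2 H2] := vm _ e2.
exists (maxn N1 N2) => n; rewrite geq_max => /andP[h1 h2].
rewrite opprD addrACA; apply: le_lt_trans (cnD _ _) _.
by rewrite [ltRHS](splitr e) ltrD ?H1 ?H2.
Qed.

Lemma ctoMl u l x : cto u l -> cto (fun n => x * u n) (x * l).
Proof.
move=> ul e e0.
have d0 : 0 < e / (cn x + 1) by rewrite divr_gt0// ltr_wpDl ?cn_ge0.
have [N H] := ul _ d0; exists N => n /H h.
rewrite -mulrBr cnM; apply: le_lt_trans (_ : (cn x + 1) * cn (u n - l) < _).
  by rewrite ler_wpM2r ?cn_ge0// lerDl.
by rewrite mulrC -ltr_pdivlMr// ltr_wpDl ?cn_ge0.
Qed.

Lemma ctoN u l : cto u l -> cto (fun n => - u n) (- l).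
Proof.
move=> ul e e0; have [N H] := ul _ e0; exists N => n /H.
by rewrite -opprD cnN.
Qed.

Lemma ctoB u v l m : cto u l -> cto v m -> cto (fun n => u n - v n) (l - m).
Proof. by move=> ul vm; apply: ctoD => //; exact: ctoN. Qed.

Lemma cto_sum (I : Type) (t : seq I) (F : I -> nat -> C) (L : I -> C) :
  (forall i, cto (F i) (L i)) ->
  cto (fun n => \sum_(i <- t) F i n) (\sum_(i <- t) L i).
Proof.
move=> FL; elim: t => [|i t IH].
  by apply: (@eq_cto (fun=> 0) _ _ 0%N) => [n|]; rewrite !big_nil//; exact: cto_cst.
rewrite big_cons; apply: (@eq_cto (fun n => F i n + \sum_(i <- t) F i n) _ _ 0%N).
  by move=> n _; rewrite big_cons.
exact: ctoD.
Qed.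

Lemma cto_le u l x M N :
  (forall n, (N <= n)%N -> cn (u n - x) <= M) -> cto u l -> cn (l - x) <= M.
Proof.
move=> uM ul; apply/ler_addgt0Pr => e e0.
have [N1 H] := ul _ e0; have hN := leq_maxl N N1; have hN1 := leq_maxr N N1.
apply: le_trans (cn_triangle _ (u (maxn N N1)) _) _; rewrite addrC lerD ?uM//.
by rewrite cnB ltW// H.
Qed.

Lemma cto_unique u l m : cto u l -> cto u m -> l = m.
Proof.
move=> ul um; apply/eqP; rewrite -subr_eq0 -cn_eq0 eq_le cn_ge0 andbT.
apply/ler_addgt0Pr => e e0; rewrite add0r.
have [N H] := um _ e0; apply: (cto_le (N := N)) ul => n hn; exact/ltW/H.
Qed.

Lemma cto_shift u l k : cto u l -> cto (fun n => u (n + k)%N) l.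
Proof.
move=> ul e e0; have [N H] := ul _ e0; exists N => n hn; apply: H.
exact: leq_trans hn (leq_addr _ _).
Qed.

Lemma cto_unshift u l k : cto (fun n => u (n + k)%N) l -> cto u l.
Proof.
move=> ul e e0; have [N H] := ul _ e0; exists (N + k)%N => n hn.
have hk : (k <= n)%N by apply: leq_trans hn; exact: leq_addl.
rewrite -(subnK hk); apply: H; lia.
Qed.

(* The tail bound is expressed through [S - \sum_(i < n) m i], S the full sum. *)
Lemma bounded_psum (m : nat -> R) M :
  (forall n, 0 <= m n) -> (forall n, \sum_(i < n) m i <= M) ->
  exists S, [/\ S <= M, forall n, \sum_(i < n) m i <= S
    & (fun n => S - \sum_(i < n) m i) @ \oo --> (0 : R)].
Proof.
move=> m0 mM; pose v n := \sum_(i < n) m i.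
have nd : nondecreasing_seq v.
  apply/nondecreasing_seqP => n; rewrite /v big_ord_recr /= lerDl; exact: m0.
have cv : cvgn v by apply: nondecreasing_is_cvgn => //; exists M => _ [n _ <-]; exact: mM.
exists (limn v); split.
- by apply: limr_le => //; apply: nearW.
- by move=> n; exact: nondecreasing_cvgn_le.
- rewrite -[X in _ --> X](subrr (limn v)); apply: cvgB => //; exact: cvg_cst.
Qed.

Lemma csum_tail u (m : nat -> R) S n N :
  (forall n, cn (u n) <= m n) -> (forall n, \sum_(i < n) m i <= S) ->
  (n <= N)%N ->
  cn (\sum_(i < N) u i - \sum_(i < n) u i) <= S - \sum_(i < n) m i.
Proof.
move=> um mS nN.
have E (V : zmodType) (w : nat -> V) :
  \sum_(i < N) w i - \sum_(i < n) w i = \sum_(n <= i < N) w i.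
  by rewrite -[X in X - _](big_mkord predT w) -[X in _ - X](big_mkord predT w)
    (@big_cat_nat _ _ _ n 0 N)//= addrAC subrr add0r.
rewrite E; apply: le_trans (cn_sum _ _ _) _.
apply: le_trans (_ : \sum_(n <= i < N) m i <= _); first by apply: ler_sum.
by rewrite -E lerD2r.
Qed.

(** Completeness is taken from [R]: the real and imaginary parts are dominated by the same real
    series. *)
Lemma csum u (m : nat -> R) M :
  (forall n, cn (u n) <= m n) -> (forall n, \sum_(i < n) m i <= M) ->
  exists l, cto (fun n => \sum_(i < n) u i) l.
Proof.
move=> um mM; have m0 n : 0 <= m n by exact: le_trans (cn_ge0 _) (um n).
have [S [SM mS S0]] := bounded_psum m0 mM.
have cvg (w : nat -> R) : (forall n, `|w n| <= m n) -> cvgn (series w).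
  move=> wm; apply: normed_cvg; apply: nondecreasing_is_cvgn.
    by apply: nondecreasing_series => n _ _; exact: normr_ge0.
  exists S => _ [n _ <-]; rewrite /= seriesEnat /= big_mkord.
  by apply: le_trans (mS n); apply: ler_sum.
have /cvgrPdist_lt cR := cvg _ (fun n => le_trans (cn_Re _) (um n)).
have /cvgrPdist_lt cI := cvg _ (fun n => le_trans (cn_Im _) (um n)).
exists (limn (series (fun n => Re (u n))) +i* limn (series (fun n => Im (u n))))%C.
move=> e e0; have e2 : 0 < e / 2 by rewrite divr_gt0.
have [N1 _ H1] := cR _ e2; have [N2 _ H2] := cI _ e2.
exists (maxn N1 N2) => n; rewrite geq_max => /andP[h1 h2].
apply: le_lt_trans (cn_ReIm _) _; rewrite [ltRHS](splitr e).
have ReE (k : nat) : Re (\sum_(i < k) u i) = series (fun n => Re (u n)) k.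
  rewrite /series /= big_mkord.
  by elim: k => [|k IH]; rewrite ?big_ord0// !big_ord_recr /= -IH; case: (\sum_(i < k) _) (u k) => ? ? [].
have ImE (k : nat) : Im (\sum_(i < k) u i) = series (fun n => Im (u n)) k.
  rewrite /series /= big_mkord.
  by elim: k => [|k IH]; rewrite ?big_ord0// !big_ord_recr /= -IH; case: (\sum_(i < k) _) (u k) => ? ? [].
apply: ltrD.
  have := H1 n h1; rewrite /= distrC -ReE.
  by case: (\sum_(i < n) u i).
have := H2 n h2; rewrite /= distrC -ImE.
by case: (\sum_(i < n) u i).
Qed.

(** * Analytic functions normed by their coefficients *)

Definition coef_bound u r M := forall n, \sum_(k < n) cn (u k) * r ^+ k <= M.

Definition expansion u a r M f :=
  coef_bound u r M /\ forall s, cn (s - a) <= r ->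
    cto (fun n => \sum_(k < n) u k * (s - a) ^+ k) (f s).

(* [f] is the sum on the closed disc of radius [r] around [a] of a power series
   whose weighted l1-norm is at most [M]; this norm is submultiplicative. *)
Definition an a r M f := exists u, expansion u a r M f.

Lemma eq_an a r M f g : (forall s, cn (s - a) <= r -> f s = g s) ->
  an a r M f -> an a r M g.
Proof.
move=> fg [u [ub uf]]; exists u; split=> // s sa; rewrite -fg//; exact: uf.
Qed.

Lemma an_le a r M N f : M <= N -> an a r M f -> an a r N f.
Proof.
by move=> MN [u [ub uf]]; exists u; split=> // n; exact: le_trans (ub n) MN.
Qed.

Lemma an_radius a r r' M f : 0 <= r' <= r -> an a r M f -> an a r' M f.
Proof.
move=> /andP[r0 rr] [u [ub uf]]; exists u; split=> [n|s sa].
  apply: le_trans (ub n); apply: ler_sum => k _.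
  by rewrite ler_wpM2l ?cn_ge0// lerXn2r// nnegrE// (le_trans r0).
by apply: uf; exact: le_trans sa rr.
Qed.

Lemma an_ge0 a r M f : an a r M f -> 0 <= M.
Proof. by move=> [u [/(_ 0%N)]]; rewrite big_ord0. Qed.

Lemma expansion_tail u a r M f s n S : 0 <= r ->
  expansion u a r M f -> (forall n, \sum_(k < n) cn (u k) * r ^+ k <= S) ->
  cn (s - a) <= r ->
  cn (f s - \sum_(k < n) u k * (s - a) ^+ k) <=
    S - \sum_(k < n) cn (u k) * r ^+ k.
Proof.
move=> r0 [_ uf] uS sa; apply: (cto_le (N := n)) (uf s sa) => N nN.
apply: (csum_tail (u := fun k => u k * (s - a) ^+ k)
  (m := fun k => cn (u k) * r ^+ k)) nN => // k; rewrite cnM cnX ler_wpM2l ?cn_ge0//.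
by rewrite lerXn2r// nnegrE ?cn_ge0.
Qed.

Lemma an_cn_le a r M f s : 0 <= r -> an a r M f -> cn (s - a) <= r -> cn (f s) <= M.
Proof.
move=> r0 [u uf] sa; have := expansion_tail 0 r0 uf (proj1 uf) sa.
by rewrite !big_ord0 !subr0.
Qed.

Lemma an_cst a r x : 0 <= r -> an a r (cn x) (fun=> x).
Proof.
move=> r0; exists (fun k => if k is 0%N then x else 0); split=> [n|s _].
  case: n => [|n]; first by rewrite big_ord0 cn_ge0.
  rewrite big_ord_recl /= expr0 mulr1 big1 ?addr0// => i _.
  by rewrite cn0 mul0r.
apply: (@eq_cto (fun=> x) _ _ 1%N); last exact: cto_cst.
case=> // n _; rewrite big_ord_recl /= expr0 mulr1 big1 ?addr0// => i _.
by rewrite mul0r.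
Qed.

Lemma anD a r M N f g : 0 <= r -> an a r M f -> an a r N g ->
  an a r (M + N) (fun s => f s + g s).
Proof.
move=> r0 [u [ub uf]] [v [vb vg]]; exists (fun k => u k + v k); split=> [n|s sa].
  apply: le_trans (lerD (ub n) (vb n)).
  rewrite -big_split /=; apply: ler_sum => k _; rewrite -mulrDl.
  by rewrite ler_wpM2r ?exprn_ge0// cnD.
apply: (eq_cto (N := 0%N) _ (ctoD (uf s sa) (vg s sa))) => n _.
by rewrite -big_split; apply: eq_bigr => k _; rewrite mulrDl.
Qed.

Lemma anMl a r M f x : an a r M f -> an a r (cn x * M) (fun s => x * f s).
Proof.
move=> [u [ub uf]]; exists (fun k => x * u k); split=> [n|s sa].
  apply: le_trans (ler_wpM2l (cn_ge0 x) (ub n)).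
  by rewrite mulr_sumr; apply: ler_sum => k _; rewrite cnM mulrA.
apply: (eq_cto (N := 0%N) _ (ctoMl x (uf s sa))) => n _.
by rewrite mulr_sumr; apply: eq_bigr => k _; rewrite mulrA.
Qed.

Lemma anN a r M f : an a r M f -> an a r M (fun s => - f s).
Proof.
move=> af; apply: (eq_an (f := fun s => -1 * f s)) => [s _|]; first by rewrite mulN1r.
by have := anMl (-1) af; rewrite cnN cn1 mul1r.
Qed.

Lemma anB a r M N f g : 0 <= r -> an a r M f -> an a r N g ->
  an a r (M + N) (fun s => f s - g s).
Proof. by move=> r0 af ag; apply: anD => //; exact: anN. Qed.

Lemma an_sum a r (I : Type) (t : seq I) (P : pred I) (M : I -> R) (F : I -> C -> C) :
  0 <= r -> (forall i, P i -> an a r (M i) (F i)) ->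
  an a r (\sum_(i <- t | P i) M i) (fun s => \sum_(i <- t | P i) F i s).
Proof.
move=> r0 FM; elim: t => [|i t IH].
  rewrite big_nil; apply: (eq_an (f := fun=> 0)) => [s _|]; first by rewrite big_nil.
  by rewrite -cn0; exact: an_cst.
rewrite big_cons; case: ifPn => [Pi|nPi].
  apply: (eq_an (f := fun s => F i s + \sum_(i <- t | P i) F i s)) => [s _|].
    by rewrite big_cons Pi.
  by apply: anD => //; exact: FM.
by apply: eq_an IH => s _; rewrite big_cons (negbTE nPi).
Qed.

Lemma an_shift a r M f : 0 <= r -> an a r M f -> an a r (r * M) (fun s => (s - a) * f s).
Proof.
move=> r0 [u [ub uf]]; exists (fun k => if k is k'.+1 then u k' else 0).
split=> [n|s sa].
  case: n => [|n]; first by rewrite big_ord0 mulr_ge0//; have := ub 0%N; rewrite big_ord0.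
  rewrite big_ord_recl /= cn0 mul0r add0r.
  apply: le_trans (ler_wpM2l r0 (ub n)); rewrite mulr_sumr; apply: ler_sum => k _.
  by rewrite /bump /= add1n exprS mulrCA.
apply: (cto_unshift (k := 1)).
apply: (eq_cto (N := 0%N) _ (ctoMl (s - a) (uf s sa))) => n _.
rewrite addn1 big_ord_recl /= mul0r add0r mulr_sumr; apply: eq_bigr => k _.
by rewrite /bump /= add1n exprS mulrCA.
Qed.

(** A bound on finitely many weighted coefficient distances survives a coefficientwise limit. It
    serves to compare the limit coefficients in [an_lim] with those of the approximants. *)
Lemma cn_sum_lim (U : nat -> nat -> C) (w v : nat -> C) (c : nat -> R) K T N :
  (forall k, 0 <= c k) -> (forall k, cto (U^~ k) (w k)) ->
  (forall n, (N <= n)%N -> \sum_(k < K) cn (U n k - v k) * c k <= T) ->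
  \sum_(k < K) cn (w k - v k) * c k <= T.
Proof.
move=> c0 Uw UT; apply/ler_addgt0Pr => e e0.
have Z : cto (fun n => \sum_(k < K) (cn (w k - U n k) * c k)%:C%C) 0.
  rewrite -[X in cto _ X](@big1 _ 0 +%R _ (index_enum 'I_K) predT (fun=> 0))//.
  apply: (@cto_sum 'I_K _ (fun k n => (cn (w k - U n k) * c k)%:C%C) (fun=> 0)).
  move=> k d d0.
  have d0' : 0 < d / (c k + 1) by rewrite divr_gt0// ltr_wpDl.
  have [N' H] := Uw k _ d0'; exists N' => n /H h.
  rewrite subr0 cn_real ger0_norm ?mulr_ge0 ?cn_ge0// cnB.
  apply: le_lt_trans (_ : cn (U n k - w k) * (c k + 1) < _).
    by rewrite ler_wpM2l ?cn_ge0// lerDl.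
  by rewrite -ltr_pdivlMr// ltr_wpDl.
have [N' H] := Z _ e0; pose n := maxn N N'.
have := H n (leq_maxr _ _); rewrite subr0 -raddf_sum cn_real => h.
have {}h := le_lt_trans (ler_norm _) h.
apply: le_trans (lerD (UT n (leq_maxl _ _)) (ltW h)).
rewrite -big_split; apply: ler_sum => k _ /=; rewrite -mulrDl.
by rewrite ler_wpM2r// [leRHS]addrC cn_triangle.
Qed.

(** Completeness of the weighted l1 space. It plays the part of Weierstrass' theorem on uniform
    limits for products, inverses, binomial series and the zeta sums. *)
Lemma an_lim a r M0 B (F : nat -> C -> C) (m : nat -> R) : 0 < r ->
  an a r M0 (F 0%N) ->
  (forall n, an a r (m n) (fun s => F n.+1 s - F n s)) ->
  (forall n, \sum_(i < n) m i <= B) ->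
  exists g, an a r (M0 + B) g /\
    forall s, cn (s - a) <= r -> cto (fun n => F n s) (g s).
Proof.
move=> r0 [u0 u0F] /(_ _)/cid-/all_sig [d dF] mB.
have r0' := ltW r0; have m0 n : 0 <= m n by apply: (@an_ge0 a r); exists (d n).
have [S [SB mS S0]] := bounded_psum m0 mB.
pose u n k := u0 k + \sum_(i < n) d i k.
have dm i k : cn (d i k) * r ^+ k <= m i.
  apply: le_trans (proj1 (dF i) k.+1); rewrite big_ord_recr /= lerDr.
  by apply: sumr_ge0 => j _; rewrite mulr_ge0 ?cn_ge0 ?exprn_ge0.
have cu k : exists l, cto (u^~ k) l.
  have [|n|l dl] := @csum (d^~ k) (fun i => m i / r ^+ k) (B / r ^+ k).
  - by move=> i; rewrite ler_pdivlMr ?exprn_gt0.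
  - by rewrite -mulr_suml ler_wpM2r// invr_ge0 exprn_ge0.
  by exists (u0 k + l); apply: ctoD => //; exact: cto_cst.
have {cu} /all_sig [w uw] : forall k, {l | cto (u^~ k) l} by move=> k; exact/cid.
have udist K n N : (n <= N)%N ->
    \sum_(k < K) cn (u N k - u n k) * r ^+ k <= S - \sum_(i < n) m i.
  move=> nN; rewrite lerBrDr; apply: le_trans (mS N); rewrite -lerBrDr.
  have E (V : zmodType) (w' : nat -> V) :
    \sum_(i < N) w' i - \sum_(i < n) w' i = \sum_(n <= i < N) w' i.
    rewrite -[X in X - _](big_mkord predT w') -[X in _ - X](big_mkord predT w').
    by rewrite (@big_cat_nat _ _ _ n 0 N)//= addrAC subrr add0r.
  rewrite E; apply: le_trans (_ : \sum_(k < K) \sum_(n <= i < N) cn (d i k) * r ^+ k <= _).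
    apply: ler_sum => k _; rewrite /u opprD addrACA subrr add0r.
    by rewrite (E _ (d^~ k)) -mulr_suml ler_wpM2r ?exprn_ge0// cn_sum.
  rewrite exchange_big; apply: ler_sum => i _; exact: (proj1 (dF i)).
have wdist K n : \sum_(k < K) cn (w k - u n k) * r ^+ k <= S - \sum_(i < n) m i.
  apply: (@cn_sum_lim u w (u n) (fun k => r ^+ k) K _ n) => // [k|N nN].
    exact: exprn_ge0.
  exact: udist.
have uF n s : cn (s - a) <= r ->
    cto (fun K => \sum_(k < K) u n k * (s - a) ^+ k) (F n s).
  move=> sa; elim: n => [|n IH].
    apply: (eq_cto (N := 0%N) _ (proj2 u0F s sa)) => K _.
    by apply: eq_bigr => k _; rewrite /u big_ord0 addr0.
  rewrite -[F n.+1 s](subrK (F n s)) [X in cto _ X]addrC.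
  apply: (eq_cto (N := 0%N) _ (ctoD IH (proj2 (dF n) s sa))) => K _.
  rewrite -big_split; apply: eq_bigr => k _ /=.
  by rewrite -mulrDl /u big_ord_recr /= addrA.
have cF s : cn (s - a) <= r -> exists l, cto (F^~ s) l.
  move=> sa; have [|//|l Fl] := @csum (fun n => F n.+1 s - F n s) m B.
    by move=> n; apply: (an_cn_le (f := fun s => F n.+1 s - F n s) r0' _ sa);
      exists (d n).
  exists (F 0%N s + l); apply: (eq_cto (N := 0%N) _ (ctoD (cto_cst _) Fl)) => n _.
  elim: n => [|n IH]; first by rewrite big_ord0 addr0.
  by rewrite big_ord_recr addrA IH addrC subrK.
pose g s := if pselect (cn (s - a) <= r) is left h then projT1 (cid (cF s h)) else 0.
have Fg s : cn (s - a) <= r -> cto (F^~ s) (g s).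
  by rewrite /g; case: pselect => // h _; exact: projT2 (cid (cF s h)).
exists g; split=> //; exists w; split=> [n|s sa].
  have := wdist n 0%N; rewrite big_ord0 subr0 => h.
  apply: le_trans (lerD (proj1 u0F n) (le_trans h SB)).
  rewrite -big_split; apply: ler_sum => k _ /=; rewrite -mulrDl.
  rewrite ler_wpM2r ?exprn_ge0//; apply: le_trans (cn_le_dist _ (u 0%N k)) _.
  by rewrite {1}/u big_ord0 addr0.
(* Three errors below e / 4: limit coefficients against those of [F n1], truncation of the series of
   [F n1], and [F n1 s] against [g s]. *)
move=> e e0; have e3 : 0 < e / 4%:R by rewrite divr_gt0.
have /cvgrPdist_lt/(_ _ e3) [n1 _ /(_ n1 (leqnn _))] := S0.
rewrite /= sub0r normrN => /(le_lt_trans (ler_norm _)) hT.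
have [K1 H1] := uF n1 s sa _ e3.
exists K1 => K /H1 hK.
apply: le_lt_trans (cn_triangle _ (\sum_(k < K) u n1 k * (s - a) ^+ k) _) _.
have h1 : cn (\sum_(k < K) w k * (s - a) ^+ k - \sum_(k < K) u n1 k * (s - a) ^+ k)
    < e / 4%:R.
  apply: le_lt_trans hT; apply: le_trans (wdist K n1).
  rewrite -sumrB; apply: le_trans (cn_sum _ _ _) _; apply: ler_sum => k _.
  rewrite -mulrBl cnM cnX ler_wpM2l ?cn_ge0// lerXn2r// nnegrE ?cn_ge0//.
have h2 : cn (F n1 s - g s) < e / 4%:R.
  apply: le_lt_trans hT; rewrite cnB.
  apply: (cto_le (N := n1)) (Fg s sa) => N nN.
  have E n : F n s = F 0%N s + \sum_(i < n) (F i.+1 s - F i s).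
    elim: n => [|n IH]; first by rewrite big_ord0 addr0.
    by rewrite big_ord_recr addrA -IH addrC subrK.
  rewrite (E N) (E n1) opprD addrACA subrr add0r.
  apply: (csum_tail (u := fun i => F i.+1 s - F i s) (m := m)) nN => // i.
  by apply: (an_cn_le (f := fun s => F i.+1 s - F i s) r0' _ sa); exists (d i).
have h3 := cn_triangle (\sum_(k < K) u n1 k * (s - a) ^+ k) (F n1 s) (g s).
lra.
Qed.

(** Multiplying the partial sums of [f] by [g] gives a sequence with increments of norm
    [cn (u k) * r ^+ k * N], to which [an_lim] applies; this takes the place of rearranging a double
    series. *)
Lemma anM a r M N f g : 0 < r -> an a r M f -> an a r N g ->
  an a r (M * N) (fun s => f s * g s).
Proof.
move=> r0 [u [ub uf]] ag; have r0' := ltW r0.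
have N0 := an_ge0 ag.
have anX k : an a r (r ^+ k * N) (fun s => (s - a) ^+ k * g s).
  elim: k => [|k IH]; first by rewrite mul1r; apply: eq_an ag => s _; rewrite mul1r.
  rewrite exprS -mulrA; apply: eq_an (an_shift r0' IH) => s _.
  by rewrite exprS mulrA.
pose F n s := (\sum_(k < n) u k * (s - a) ^+ k) * g s.
have [||n|h [ah Fh]] := @an_lim a r 0 (M * N) F (fun k => cn (u k) * r ^+ k * N) r0.
- apply: (eq_an (f := fun=> 0)) => [s _|]; first by rewrite /F big_ord0 mul0r.
  by rewrite -cn0; exact: an_cst.
- move=> n; rewrite -mulrA; apply: eq_an (anMl (u n) (anX n)) => s _.
  by rewrite /F big_ord_recr /= mulrDl addrAC subrr add0r mulrA.
- by rewrite -mulr_suml ler_wpM2r.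
rewrite add0r in ah; apply: eq_an ah => s sa.
apply: (cto_unique (Fh s sa)); rewrite mulrC.
apply: (eq_cto (N := 0%N) _ (ctoMl (g s) (uf s sa))) => n _.
by rewrite mulrC.
Qed.

(** * Complex powers *)

Lemma an_lin a r x y : 0 <= r -> an a r (cn (x + y * a) + cn y * r) (fun s => x + y * s).
Proof.
move=> r0; have := anD r0 (an_cst a (x + y * a) r0) (anMl y (an_shift r0 (an_cst a 1 r0))).
rewrite cn1 mulr1; apply: eq_an => s _; ring.
Qed.

Lemma an_prod a r (I : Type) (t : seq I) (M : I -> R) (F : I -> C -> C) : 0 < r ->
  (forall i, an a r (M i) (F i)) ->
  an a r (\prod_(i <- t) M i) (fun s => \prod_(i <- t) F i s).
Proof.
move=> r0 FM; elim: t => [|i t IH].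
  rewrite big_nil; apply: (eq_an (f := fun=> 1)) => [s _|]; first by rewrite big_nil.
  by rewrite -cn1; apply: an_cst; exact: ltW.
rewrite big_cons; apply: eq_an (anM r0 (FM i) IH) => s _.
by rewrite big_cons.
Qed.

(** If the coefficients before the k-th vanish, then at a zero at distance h the k-th term is minus
    the tail, of modulus at most h^(k+1) M / r^(k+1). Divide by h^k and let h tend to 0. *)
Lemma expansion_eq0 u a r M f : 0 < r -> expansion u a r M f ->
  (forall d, 0 < d -> exists s, 0 < cn (s - a) < d /\ f s = 0) ->
  forall k, u k = 0.
Proof.
move=> r0 uf fz; have r0' := ltW r0.
have M0 : 0 <= M by apply: (an_ge0 (a := a) (r := r) (f := f)); exists u.
elim/ltn_ind => k IH; apply/eqP; rewrite -cn_eq0 eq_le cn_ge0 andbT.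
apply/ler_addgt0Pr => e e0; rewrite add0r.
pose N := M / r ^+ k.+1 + 1; have N0 : 0 < N.
  by rewrite ltr_wpDl// divr_ge0// exprn_ge0.
pose d := Num.min r (e / N); have d0 : 0 < d by rewrite lt_min r0 divr_gt0.
have [s [/andP[s0 sd] fs]] := fz d d0.
have sr : cn (s - a) < r by apply: lt_le_trans sd _; rewrite ge_min lexx.
have se : cn (s - a) < e / N by apply: lt_le_trans sd _; rewrite ge_min lexx orbT.
pose h := cn (s - a).
suff H : cn (u k) * h ^+ k <= h ^+ k.+1 * (M / r ^+ k.+1).
  rewrite exprSr -mulrA mulrC ler_pM2l ?exprn_gt0// in H.
  apply: le_trans H _; apply: le_trans (_ : h * N <= _).
    by rewrite ler_wpM2l ?(ltW s0)// lerDl.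
  by rewrite -ler_pdivlMr// ltW.
have := proj2 uf s (ltW sr); rewrite fs => cf.
have : cto (fun n => - \sum_(k.+1 <= j < n) u j * (s - a) ^+ j) (u k * (s - a) ^+ k).
  rewrite -[X in cto _ X]subr0.
  apply: (eq_cto (N := k.+1) _ (ctoB (cto_cst (u k * (s - a) ^+ k)) cf)) => n kn.
  rewrite -(big_mkord predT (fun j => u j * (s - a) ^+ j)) (@big_cat_nat _ _ _ k.+1)//=.
  rewrite big_nat_recr//= big_nat_cond big1 ?add0r ?opprD ?addNKr ?addrA ?subrr ?add0r//.
  by move=> i /andP[/andP[_ ik] _]; rewrite IH// mul0r.
move=> cf2; have : cn (u k * (s - a) ^+ k - 0) <= h ^+ k.+1 * (M / r ^+ k.+1).
  apply: (cto_le (N := k.+1)) cf2 => n kn.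
  rewrite subr0 cnN; apply: le_trans (cn_sum _ _ _) _.
  apply: le_trans (_ : h ^+ k.+1 * (\sum_(k.+1 <= j < n) (cn (u j) * r ^+ j / r ^+ k.+1)) <= _).
    rewrite mulr_sumr big_nat_cond [leRHS]big_nat_cond.
    apply: ler_sum => j /andP[/andP[kj _] _]; rewrite cnM cnX -/h.
    have -> : cn (u j) * r ^+ j / r ^+ k.+1 = cn (u j) * r ^+ (j - k.+1).
      by rewrite -[in r ^+ j](subnK kj) exprD mulrA mulfK// gt_eqF// exprn_gt0.
    rewrite -[in h ^+ j](subnK kj) exprD.
    rewrite [leLHS](_ : _ = h ^+ k.+1 * (cn (u j) * h ^+ (j - k.+1))); last by ring.
    do 2 rewrite ler_wpM2l ?exprn_ge0 ?cn_ge0//.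
    by rewrite lerXn2r ?nnegrE ?cn_ge0// ltW.
  rewrite ler_wpM2l ?exprn_ge0 ?cn_ge0// -mulr_suml ler_wpM2r ?invr_ge0 ?exprn_ge0//.
  apply: le_trans (proj1 uf n).
  rewrite -(big_mkord predT (fun j => cn (u j) * r ^+ j)).
  rewrite [leRHS](@big_cat_nat _ _ _ k.+1)//= lerDr.
  by apply: sumr_ge0 => j _; rewrite mulr_ge0 ?cn_ge0// exprn_ge0.
by rewrite subr0 cnM cnX.
Qed.

Lemma an_eq0 a r M f : 0 < r -> an a r M f ->
  (forall d, 0 < d -> exists s, 0 < cn (s - a) < d /\ f s = 0) ->
  forall s, cn (s - a) <= r -> f s = 0.
Proof.
move=> r0 [u uf] fz s sa; have u0 := expansion_eq0 r0 uf fz.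
apply: (cto_unique (proj2 uf s sa)); apply: (eq_cto (N := 0%N) _ (cto_cst 0)) => n _.
by rewrite big1// => i _; rewrite u0 mul0r.
Qed.

Lemma an_eq_real (t0 r M N : R) f g : 0 < r ->
  an t0%:C%C r M f -> an t0%:C%C r N g ->
  (forall t : R, t0 < t -> t - t0 <= r -> f t%:C%C = g t%:C%C) ->
  forall s, cn (s - t0%:C%C) <= r -> f s = g s.
Proof.
move=> r0 af ag fg s sa; apply/eqP; rewrite -subr_eq0; apply/eqP.
apply: (an_eq0 r0 (anB (ltW r0) af ag) _ sa) => d d0.
pose m := Num.min r (d / 2); have m0 : 0 < m by rewrite lt_min r0 divr_gt0.
have mE : (t0 + m)%:C%C - t0%:C%C = m%:C%C :> C.
  by rewrite -rmorphB /= addrAC subrr add0r.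
exists (t0 + m)%:C%C; rewrite mE cn_real gtr0_norm//.
split; last by rewrite fg ?subrr// ?ltrDl// addrAC subrr add0r ge_min lexx.
rewrite m0 /=; apply: le_lt_trans (_ : d / 2 < _); first by rewrite ge_min lexx orbT.
lra.
Qed.

Lemma sum_half n : \sum_(i < n) (1 / 2 : R) ^+ i = 2 - 2 * (1 / 2) ^+ n.
Proof.
elim: n => [|n IH]; rewrite ?big_ord0 ?expr0 ?mulr1 ?subrr//.
by rewrite big_ord_recr /= IH exprS; field.
Qed.

(** Geometric series in q (s - a) with q = 1 / (x - a); the condition on r keeps the ratio at most
    1/2. *)
Lemma an_inv a r x : 0 < r -> 2 * r <= cn (x - a) -> exists M, an a r M (fun s => (s - x)^-1).
Proof.
move=> r0 rx; have r0' := ltW r0; have x0 : 0 < cn (x - a) by lra.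
have xa : x - a != 0 by rewrite -cn_gt0.
pose q := (x - a)^-1.
pose F n s := - q * \sum_(k < n) (q * (s - a)) ^+ k.
have aX n : an a r ((1 / 2) ^+ n) (fun s => (q * (s - a)) ^+ n).
  elim: n => [|n IH]; first by rewrite expr0 -cn1; apply: an_cst.
  rewrite exprS; apply: an_le (eq_an _ (anM r0 (anMl q (an_shift r0' (an_cst a 1 r0'))) IH)).
    rewrite cn1 mulr1 ler_wpM2r ?exprn_ge0 ?divr_ge0// /q cnV mulrC ler_pdivrMr//; lra.
  by move=> s _; rewrite mulr1 exprS.
have [||n|g [ag Fg]] := @an_lim a r 0 (cn q * 2) F (fun k => cn q * (1 / 2) ^+ k) r0.
- apply: (eq_an (f := fun=> 0)) => [s _|]; first by rewrite /F big_ord0 mulr0.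
  by rewrite -cn0; exact: an_cst.
- move=> n; rewrite -(cnN q); apply: eq_an (anMl (- q) (aX n)) => s _.
  by rewrite /F big_ord_recr /=; ring.
- rewrite -mulr_sumr ler_wpM2l ?cn_ge0//.
  by rewrite sum_half gerBl mulr_ge0// exprn_ge0// divr_ge0.
exists (0 + cn q * 2); apply: eq_an ag => s sa; apply: cto_unique (Fg s sa) _.
have sx : s - x != 0.
  apply/eqP => E; have : cn (x - a) <= r.
    by rewrite (_ : x - a = s - a)//; move/eqP: E; rewrite subr_eq0 => /eqP->.
  lra.
have h : cn (q * (s - a)) <= 1 / 2.
  rewrite cnM cnV mulrC ler_pdivrMr//; lra.
apply: (@cto_squeeze _ _ (fun n => cn (s - x)^-1 * (1 / 2) ^+ n) 0%N) => [n _|]; last first.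
  rewrite -[X in _ --> X](mulr0 (cn (s - x)^-1)); apply: cvgM; first exact: cvg_cst.
  by apply: cvg_expr; rewrite ger0_norm ?divr_ge0//; lra.
have -> : F n s - (s - x)^-1 = - (s - x)^-1 * (q * (s - a)) ^+ n.
  have E : (1 - q * (s - a)) * \sum_(k < n) (q * (s - a)) ^+ k = 1 - (q * (s - a)) ^+ n.
    by rewrite -opprB mulNr -subrX1 opprB.
  have qE : 1 - q * (s - a) = - q * (s - x) by rewrite /q; field.
  rewrite qE in E.
  have -> : F n s = (1 - (q * (s - a)) ^+ n) / (s - x).
    by apply: (mulIf sx); rewrite mulfVK// -E /F; ring.
  by ring.
rewrite cnM cnN; rewrite ler_wpM2l ?cn_ge0// cnX lerXn2r// nnegrE ?cn_ge0//.
Qed.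

(** * The exponential series *)

Definition exp_psum (F : numFieldType) (n : nat) (x : F) : F :=
  \sum_(k < n) x ^+ k / k`!%:R.

(** The truncation keeps exactly the terms of total degree below n, hence the cut at n - i in the
    second factor. It is used over [R[i]] and, for the majorants, over [R]. *)
Lemma exp_psumD (F : numFieldType) n (x y : F) :
  exp_psum n (x + y) = \sum_(i < n) x ^+ i / i`!%:R * exp_psum (n - i) y.
Proof.
elim: n => [|n IH]; first by rewrite /exp_psum !big_ord0.
rewrite /exp_psum big_ord_recr /= -/(exp_psum n (x + y)) IH.
rewrite [in RHS](eq_bigr (fun i : 'I_n.+1 => x ^+ i / i`!%:R * exp_psum (n - i) y +
   x ^+ i * y ^+ (n - i) / (i`! * (n - i)`!)%:R)); last first.
  move=> i _; have le_in : (i <= n)%N by rewrite -ltnS.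
  rewrite subSn// /exp_psum big_ord_recr /= mulrDr; congr (_ + _).
  by rewrite natrM; field; rewrite !pnatr_eq0 -!lt0n !fact_gt0.
rewrite [in RHS]big_split /= [X in _ = X + _]big_ord_recr /= subnn.
have -> : exp_psum 0 y = 0 by rewrite /exp_psum big_ord0.
rewrite mulr0 addr0.
congr (_ + _); rewrite addrC exprDn mulr_suml; apply: eq_bigr => i _.
have le_in : (i <= n)%N by rewrite -ltnS.
rewrite -(bin_fact le_in) natrM -mulr_natr [y ^+ _ * _]mulrC; field.
by rewrite !pnatr_eq0 -!lt0n !fact_gt0 bin_gt0.
Qed.

Lemma exp_psumE (t : R) n : exp_psum n t = series (exp_coeff t) n.
Proof. by rewrite /exp_psum /series /= big_mkord; apply: eq_bigr. Qed.

Lemma cvg_exp_psum (t : R) : exp_psum n t @[n --> \oo] --> expR t.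
Proof.
have := is_cvg_series_exp_coeff t; rewrite /expR.
by rewrite (_ : series (exp_coeff t) = fun n => exp_psum n t)//; apply/funext => n; rewrite exp_psumE.
Qed.

Lemma exp_psum_le (t : R) n : 0 <= t -> exp_psum n t <= expR t.
Proof.
move=> t0; have := @nondecreasing_cvgn_le _ (fun n => exp_psum n t).
move=> /(_ _ _ n); rewrite (cvg_lim _ (@cvg_exp_psum t))//; apply.
  apply/nondecreasing_seqP => m; rewrite /exp_psum big_ord_recr /= lerDl.
  by rewrite divr_ge0// exprn_ge0.
exact: cvg_exp_psum.
Qed.

(** The error is dominated term by term by the corresponding error [e n] for the moduli, which tends
    to 0 by the functional equation of the real exponential. *)
Lemma exp_psum_mul x y X Y : cto (fun n => exp_psum n x) X ->
  cto (fun n => exp_psum n y) Y -> cto (fun n => exp_psum n (x + y)) (X * Y).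
Proof.
move=> xX yY.
pose e n : R := exp_psum n (cn x) * expR (cn y) - exp_psum n (cn x + cn y).
have e0 : e @ \oo --> (0 : R).
  rewrite -[X in _ --> X](subrr (expR (cn x) * expR (cn y))).
  apply: cvgB; last by rewrite -expRD; exact: cvg_exp_psum.
  by apply: cvgM; [exact: cvg_exp_psum|exact: cvg_cst].
have yT m : cn (Y - exp_psum m y) <= expR (cn y) - exp_psum m (cn y).
  apply: (cto_le (N := m)) yY => n mn; rewrite /exp_psum.
  apply: (csum_tail (u := fun k => y ^+ k / k`!%:R) (m := fun k => cn y ^+ k / k`!%:R)) mn.
    by move=> k; rewrite cnM cnX cnV cn_nat.
  by move=> k; apply: exp_psum_le; exact: cn_ge0.
have h : cto (fun n => exp_psum n (x + y) - exp_psum n x * Y) 0.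
  apply: (cto_squeeze (N := 0%N)) e0 => n _; rewrite subr0.
  rewrite exp_psumD mulr_suml -sumrB.
  rewrite (_ : e n = \sum_(i < n) cn x ^+ i / i`!%:R *
     (expR (cn y) - exp_psum (n - i) (cn y))); last first.
    rewrite /e exp_psumD {1}/exp_psum mulr_suml -sumrB.
    by apply: eq_bigr => i _; rewrite mulrBr.
  apply: le_trans (cn_sum _ _ _) _; apply: ler_sum => i _.
  rewrite -mulrBr cnM cnM cnX cnV cn_nat cnB ler_wpM2l//.
  by rewrite divr_ge0// exprn_ge0// cn_ge0.
have := ctoD h (ctoMl Y xX); rewrite add0r mulrC.
by apply: (eq_cto (N := 0%N)) => n _; rewrite mulrC subrK.
Qed.

Lemma exp_psum_real (t : R) : cto (fun n => exp_psum n t%:C%C) (expR t)%:C%C.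
Proof.
have := @cvg_exp_psum t => h e e0.
have /cvgrPdist_lt/(_ _ e0) [N _ H] := h; exists N => n /H /=.
rewrite (_ : exp_psum n t%:C%C = (exp_psum n t)%:C%C).
  by rewrite -realcB cn_real distrC.
by rewrite /exp_psum realc_sum; apply: eq_bigr => k _; rewrite realcM realcV realcX realc_nat.
Qed.

Lemma exp_psum_imag (t : R) :
  cto (fun n => exp_psum n ('i%C * t%:C%C)) (cos t +i* sin t)%C.
Proof.
have E k : ('i%C * t%:C%C) ^+ k / k`!%:R = (cos_coeff t k +i* sin_coeff t k)%C :> C.
  rewrite exprMn -mulrA.
  have -> : t%:C%C ^+ k / k`!%:R = (t ^+ k / k`!%:R)%:C%C :> C.
    by rewrite realcM realcV realcX realc_nat.
  rewrite /cos_coeff /sin_coeff /= -!mulrA; set c := t ^+ k / _.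
  have -> : 'i%C ^+ k = ((~~ odd k)%:R * (-1) ^+ k./2 +i* ((odd k)%:R * (-1) ^+ k.-1./2))%C :> C.
    rewrite -{1}(odd_double_half k) exprD -muln2 mulnC exprM sqr_i.
    have -> : (-1) ^+ k./2 = ((-1) ^+ k./2 : R)%:C%C :> C by rewrite realcX realcN.
    have ok2 : odd k -> k.-1./2 = k./2.
      by case: (k) => // k' /= /negbTE ok'; rewrite uphalf_half ok'.
    case ok: (odd k) => /=; last by rewrite expr0 mul1r mul1r mul0r.
    by rewrite ok2// expr1; simpc.
  by rewrite -exprnP; simpc; rewrite !mulrA.
have hc : series (cos_coeff t) @ \oo --> cos t.
  by rewrite cos.unlock; exact: is_cvg_series_cos_coeff.
have hs : series (sin_coeff t) @ \oo --> sin t.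
  by rewrite sin.unlock; exact: is_cvg_series_sin_coeff.
have sumE n : exp_psum n ('i%C * t%:C%C) =
   (series (cos_coeff t) n +i* series (sin_coeff t) n)%C.
  rewrite /exp_psum /series /= !big_mkord.
  elim: n => [|n IH]; first by rewrite !big_ord0.
  by rewrite !big_ord_recr /= IH E.
move=> e e0; have e2 : 0 < e / 2 by rewrite divr_gt0.
have /cvgrPdist_lt/(_ _ e2) [N1 _ H1] := hc.
have /cvgrPdist_lt/(_ _ e2) [N2 _ H2] := hs.
exists (maxn N1 N2) => n; rewrite geq_max => /andP[/H1 /= h1 /H2 /= h2].
rewrite sumE; apply: le_lt_trans (cn_ReIm _) _; rewrite [ltRHS](splitr e) /=.
by apply: ltrD; rewrite distrC.
Qed.

Definition cexp s : C := (expR (Re s))%:C%C * (cos (Im s) +i* sin (Im s))%C.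

Lemma cto_cexp s : cto (fun n => exp_psum n s) (cexp s).
Proof.
rewrite {1}[s]complexE; apply: exp_psum_mul; first exact: exp_psum_real.
exact: exp_psum_imag.
Qed.

Lemma cexpD x y : cexp (x + y) = cexp x * cexp y.
Proof.
exact: cto_unique (cto_cexp (x + y)) (exp_psum_mul (cto_cexp x) (cto_cexp y)).
Qed.

Lemma cexp_real (t : R) : cexp t%:C%C = (expR t)%:C%C.
Proof. by rewrite /cexp /= cos0 sin0; simpc. Qed.

Lemma cexp0 : cexp 0 = 1.
Proof. by rewrite (cexp_real 0) expR0. Qed.

Lemma cn_cexp s : cn (cexp s) = expR (Re s).
Proof.
rewrite /cexp cnM cn_real ger0_norm ?expR_ge0//.
by rewrite /cn /= cos2Dsin2 sqrtr1 mulr1.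
Qed.

Lemma expansion_cexp (L : R) r : 0 <= r ->
  expansion (fun k => L%:C%C ^+ k / k`!%:R) 0 r (expR (`|L| * r))
    (fun s => cexp (L%:C%C * s)).
Proof.
move=> r0; split=> [n|s _].
  apply: le_trans (exp_psum_le n (t := `|L| * r) _); last by rewrite mulr_ge0.
  apply: ler_sum => k _.
  by rewrite cnM cnV cn_nat cnX cn_real exprMn mulrAC.
apply: (eq_cto (N := 0%N) _ (cto_cexp (L%:C%C * s))) => n _.
by apply: eq_bigr => k _; rewrite subr0 exprMn mulrAC.
Qed.

Lemma an_cexp (L : R) a r : 0 <= r ->
  an a r (expR (L * Re a) * expR (`|L| * r)) (fun s => cexp (L%:C%C * s)).
Proof.
move=> r0; have -> : expR (L * Re a) = cn (cexp (L%:C%C * a)).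
  by rewrite cn_cexp; case: (a) => p q /=; simpc.
apply: (eq_an (f := fun s => cexp (L%:C%C * a) * cexp (L%:C%C * (s - a)))).
  by move=> s _; rewrite -cexpD mulrBr addrC subrK.
apply: anMl; have [ub uF] := expansion_cexp L r0.
exists (fun k => L%:C%C ^+ k / k`!%:R); split=> // s sa.
by have := uF (s - a); rewrite subr0; apply.
Qed.

Definition cpow (t : R) s := cexp ((ln t)%:C%C * s).

Lemma cpowerE (t : R) s : cpower t s = cpow t s.
Proof.
rewrite /cpow /cexp /cpower; case: s => p q /=.
by rewrite !mul0r addr0 subr0 ![ln t * _]mulrC.
Qed.

Lemma cpowD t x y : cpow t (x + y) = cpow t x * cpow t y.
Proof. by rewrite /cpow mulrDr cexpD. Qed.

Lemma cpow0 t : cpow t 0 = 1.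
Proof. by rewrite /cpow mulr0 cexp0. Qed.

Lemma cpow_real t (q : R) : cpow t q%:C%C = (expR (q * ln t))%:C%C.
Proof. by rewrite /cpow -realcM cexp_real mulrC. Qed.

Lemma cpow_nat t n : 0 < t -> cpow t n%:R = (t ^+ n)%:C%C.
Proof. by move=> t0; rewrite -realc_nat cpow_real expRM_natl lnK. Qed.

Lemma cpowM (t t' : R) s : 0 < t -> 0 < t' -> cpow (t * t') s = cpow t s * cpow t' s.
Proof. by move=> t0 t0'; rewrite /cpow lnM ?posrE// realcD mulrDl cexpD. Qed.

Lemma cn_cpow (t : R) s : cn (cpow t s) = expR (Re s * ln t).
Proof. by rewrite /cpow cn_cexp; case: s => p q /=; rewrite mul0r subr0 mulrC. Qed.

Lemma cpow_neq0 t s : cpow t s != 0.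
Proof. by rewrite -cn_gt0 cn_cpow expR_gt0. Qed.

Lemma an_cpow (t : R) x a r : 0 < r ->
  an a r (expR (Re (x - a) * ln t) * expR (`|ln t| * r)) (fun s => cpow t (x - s)).
Proof.
move=> r0; have r0' := ltW r0.
apply: an_le (_ : cn (cpow t x) * (expR (- ln t * Re a) * expR (`|- ln t| * r)) <= _) _.
  rewrite normrN cn_cpow mulrA -expRD; case: (x) (a) => p q [p' q'] /=.
  by rewrite (_ : p * ln t + - ln t * p' = (p - p') * ln t); [|ring].
apply: eq_an (anMl (cpow t x) (an_cexp (- ln t) a r0')) => s _.
by rewrite cpowD /cpow realcN mulrN mulNr.
Qed.

(** * Meromorphic functions *)

(** Quantitative form of [meromorphic_at], to which it is equivalent by [meromorphic_mer] and
    [mer_meromorphic]; the value of [F] at [a] is free in both. *)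
Definition mer F a := exists n r M g,
  [/\ 0 < r, an a r M g & forall s, cn (s - a) <= r -> s != a -> (s - a) ^+ n * F s = g s].

Lemma an_mer a r M f : 0 < r -> an a r M f -> mer f a.
Proof.
by move=> r0 af; exists 0%N, r, M, f; split=> // s _ _; rewrite expr0 mul1r.
Qed.

Lemma merM F G a : mer F a -> mer G a -> mer (fun s => F s * G s) a.
Proof.
move=> [n [r [M [f [r0 af fE]]]]] [m [r' [M' [g [r'0 ag gE]]]]].
pose q := Num.min r r'; have q0 : 0 < q by rewrite lt_min r0.
exists (n + m)%N, q, (M * M'), (fun s => f s * g s); split=> //.
  apply: anM => //; first by apply: an_radius af; rewrite ltW//= ge_min lexx.
  by apply: an_radius ag; rewrite ltW//= ge_min lexx orbT.
move=> s; rewrite le_min => /andP[h1 h2] sa.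
by rewrite exprD mulrACA fE// gE.
Qed.

Lemma an_pow a r n : 0 < r -> an a r (r ^+ n) (fun s => (s - a) ^+ n).
Proof.
move=> r0; elim: n => [|n IH]; first by rewrite expr0 -cn1; apply: an_cst; exact: ltW.
by rewrite exprS; apply: eq_an (an_shift (ltW r0) IH) => s _; rewrite exprS.
Qed.

Lemma merD F G a : mer F a -> mer G a -> mer (fun s => F s + G s) a.
Proof.
move=> [n [r [M [f [r0 af fE]]]]] [m [r' [M' [g [r'0 ag gE]]]]].
pose q := Num.min r r'; have q0 : 0 < q by rewrite lt_min r0.
exists (n + m)%N, q, (q ^+ m * M + q ^+ n * M'),
  (fun s => (s - a) ^+ m * f s + (s - a) ^+ n * g s); split=> //.
  apply: anD; first exact: ltW.
    apply: anM => //; first exact: an_pow.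
    by apply: an_radius af; rewrite ltW//= ge_min lexx.
  apply: anM => //; first exact: an_pow.
  by apply: an_radius ag; rewrite ltW//= ge_min lexx orbT.
move=> s; rewrite le_min => /andP[h1 h2] sa.
by rewrite -fE// -gE// exprD; ring.
Qed.

Lemma mer_cst a x : mer (fun=> x) a.
Proof. exact: (an_mer ltr01 (an_cst a x ler01)). Qed.

Lemma merMl F a x : mer F a -> mer (fun s => x * F s) a.
Proof. exact: merM (mer_cst a x). Qed.

Lemma merN F a : mer F a -> mer (fun s => - F s) a.
Proof.
move=> /(merMl (-1)) h; rewrite (_ : (fun s => - F s) = (fun s => -1 * F s))//.
by apply/funext => s; rewrite mulN1r.
Qed.

Lemma merB F G a : mer F a -> mer G a -> mer (fun s => F s - G s) a.
Proof. by move=> mF mG; apply: merD => //; exact: merN. Qed.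

Lemma mer_inv x a : mer (fun s => (s - x)^-1) a.
Proof.
have [->|ax] := eqVneq a x.
  exists 1%N, 1, (cn 1), (fun=> 1); split=> //; first by apply: an_cst.
  by move=> s _ sx; rewrite expr1 divff// subr_eq0.
have h : 0 < cn (x - a) / 2 by rewrite divr_gt0// cn_gt0 subr_eq0 eq_sym.
have h2 : 2 * (cn (x - a) / 2) <= cn (x - a) by lra.
by have [M aM] := an_inv h h2; exact: an_mer h aM.
Qed.

Lemma mer_cpow t a : mer (fun s => cpow t (- s)) a.
Proof.
apply: an_mer ltr01 _; rewrite (_ : (fun s => _) = (fun s => cpow t (0 - s))).
  exact: an_cpow.
by apply/funext => s; rewrite sub0r.
Qed.

Lemma mer_eq0 D a : mer D a ->
  (forall d, 0 < d -> exists s, 0 < cn (s - a) < d /\ D s = 0) ->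
  exists2 d, 0 < d & forall s, 0 < cn (s - a) < d -> D s = 0.
Proof.
move=> [n [r [M [g [r0 ag gE]]]]] Dz; exists r => // s /andP[s0 sr].
have g0 : forall s, cn (s - a) <= r -> g s = 0.
  apply: an_eq0 ag _ => // d d0.
  have [|s' [/andP[s'0]]] := Dz (Num.min d r); first by rewrite lt_min d0.
  rewrite lt_min => /andP[s'd s'r] D0; exists s'; split; first by rewrite s'0.
  by rewrite -gE ?(ltW s'r)//; [rewrite D0 mulr0|rewrite -subr_eq0 -cn_gt0].
have sa : s - a != 0 by rewrite -cn_gt0.
apply: (mulfI (expf_neq0 n sa)).
by rewrite mulr0 gE ?ltW// ?g0 ?ltW// -subr_eq0.
Qed.

(* The zero set is propagated along the real segment from 3 down to 0. *)
Lemma mer_identity D : (forall a, mer D a) ->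
  (forall t : R, 2 < t -> D t%:C%C = 0) ->
  exists2 d, 0 < d & forall s, 0 < cn s < d -> D s = 0.
Proof.
move=> mD D2.
pose Z (t : R) := exists2 d, 0 < d & forall s, 0 < cn (s - t%:C%C) < d -> D s = 0.
have Zlim (t : R) : (forall d, 0 < d -> exists q, 0 < `|q - t| < d /\ D q%:C%C = 0) -> Z t.
  move=> H; apply: mer_eq0 (mD _) _ => d /H [q [h Dq]].
  by exists q%:C%C; rewrite -realcB cn_real.
pose S := [set t : R | 0 <= t <= 3 /\ forall q, t <= q <= 3 -> Z q].
have S3 : S 3.
  split=> [|q /andP[q1 q2]]; first by rewrite lexx ler0n.
  have -> : q = 3 by apply/le_anti; rewrite q1 q2.
  apply: Zlim => d d0; exists (3 + d / 2); rewrite addrC addKr; split.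
    rewrite gtr0_norm ?divr_gt0//=; lra.
  by apply: D2; have := divr_gt0 d0 (ltr0n R 2); lra.
have lS : has_lbound S by exists 0 => t [/andP[]].
have hS : has_inf S by split=> //; exists 3.
pose t := inf S.
have t0 : 0 <= t by apply: lb_le_inf; [exists 3|move=> q [/andP[]]].
have t3 : t <= 3 by exact: ge_inf.
have Zgt q : t < q <= 3 -> Z q.
  move=> /andP[tq q3].
  have [p [_ Sp] pq] : exists2 p, S p & p < q.
    by apply: inf_lt tq; exists 3.
  by apply: Sp; rewrite ltW.
(* Closedness: zeros to the right of the infimum accumulate at it. *)
have Zt : Z t.
  have [t3'|t3'] := ltrP t 3; last first.
    by have -> : t = 3 by [apply/le_anti; rewrite t3]; apply: (proj2 S3); rewrite lexx.
  apply: Zlim => d d0; pose m := Num.min (d / 2) ((3 - t) / 2).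
  have m0 : 0 < m by rewrite lt_min !divr_gt0// subr_gt0.
  have [|e e0 He] := Zgt (t + m).
    rewrite ltrDl m0 /=; have : m <= (3 - t) / 2 by rewrite ge_min lexx orbT.
    lra.
  (* The value at [t + m] itself is not controlled, so a zero is taken slightly to its left. *)
  pose e' := Num.min (e / 2) (m / 2).
  have e'0 : 0 < e' by rewrite lt_min !divr_gt0.
  have he1 : e' <= e / 2 by rewrite ge_min lexx.
  have he2 : e' <= m / 2 by rewrite ge_min lexx orbT.
  have hm : m <= d / 2 by rewrite ge_min lexx.
  exists (t + m - e'); split.
    rewrite gtr0_norm; lra.
  apply: He; rewrite -realcB cn_real ltr0_norm; lra.
have [d d0 Hd] := Zt.
(* Openness: the punctured disc around a positive infimum would allow it to be lowered. *)
have tz : t = 0.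
  apply/le_anti; rewrite t0 andbT leNgt; apply/negP => t0'.
  pose m := Num.min (d / 2) (t / 2).
  have m0 : 0 < m by rewrite lt_min !divr_gt0.
  have hm1 : m <= d / 2 by rewrite ge_min lexx.
  have hm2 : m <= t / 2 by rewrite ge_min lexx orbT.
  suff /ge_inf : S (t - m) by move=> /(_ lS); rewrite -/t; lra.
  split=> [|q /andP[q1 q2]]; first lra.
  have [tq|qt] := ltrP t q; first by apply: Zgt; rewrite tq.
  have [<-//|tq] := eqVneq t q; have {}qt : q < t by rewrite lt_def tq.
  apply: Zlim => e e0; pose e' := Num.min (e / 2) ((t - q) / 2).
  have e'0 : 0 < e' by rewrite lt_min !divr_gt0// subr_gt0.
  have he1 : e' <= e / 2 by rewrite ge_min lexx.
  have he2 : e' <= (t - q) / 2 by rewrite ge_min lexx orbT.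
  exists (q + e'); split; first by rewrite addrC addKr gtr0_norm//; lra.
  apply: Hd; rewrite -realcB cn_real ltr0_norm; lra.
by exists d => // s h; apply: Hd; rewrite tz subr0.
Qed.

(** Value and derivative at 0 with a quadratic remainder, a form that passes directly to sums and
    products. Since s = 0 is allowed, it forces [F 0 = x]. *)
Definition lin F x y := exists K d, 0 < d /\
  forall s, cn s <= d -> cn (F s - x - y * s) <= K * cn s ^+ 2.

Lemma lin_expansion u r M F : 0 < r -> expansion u 0 r M F -> lin F (u 0%N) (u 1%N).
Proof.
move=> r0 uF; exists (M / r ^+ 2), r; split=> // s sr.
have r0' := ltW r0.
have := proj2 uF s; rewrite subr0 => /(_ sr) cF.
rewrite -addrA -opprD; apply: (cto_le (N := 2)) cF; case=> [|[|n]] // _.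
rewrite !big_ord_recl /= expr0 mulr1 expr1 addrA.
set A := u 0%N + _; set B := \sum_(i < n) _; rewrite (_ : A + B - A = B); last by ring.
apply: le_trans (cn_sum _ _ _) _.
have := proj1 uF n.+2; rewrite !big_ord_recl /= addrA => hM.
have {}hM : \sum_(i < n) cn (u (lift ord0 (lift ord0 i))) * r ^+ (lift ord0 (lift ord0 i)) <= M.
  apply: le_trans hM; rewrite lerDr addr_ge0// mulr_ge0 ?cn_ge0// exprn_ge0//.
rewrite -mulrA [_^-1 * _]mulrC; apply: le_trans (ler_wpM2r _ hM).
  rewrite mulr_suml; apply: ler_sum => k _; rewrite /bump /= !add1n cnM cnX.
  have -> : cn (u k.+2) * r ^+ k.+2 * (cn s ^+ 2 / r ^+ 2) = cn (u k.+2) * (r ^+ k * cn s ^+ 2).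
    by rewrite -[k.+2]addn2 exprD; field; rewrite gt_eqF.
  rewrite ler_wpM2l ?cn_ge0// -[k.+2]addn2 exprD ler_wpM2r ?exprn_ge0 ?cn_ge0//.
  by rewrite lerXn2r ?nnegrE ?cn_ge0.
by rewrite divr_ge0 ?exprn_ge0 ?cn_ge0.
Qed.

Lemma linD F G x y x' y' : lin F x y -> lin G x' y' ->
  lin (fun s => F s + G s) (x + x') (y + y').
Proof.
move=> [K [d [d0 H]]] [K' [d' [d'0 H']]].
exists (K + K'), (Num.min d d'); split; first by rewrite lt_min d0.
move=> s; rewrite le_min => /andP[/H h /H' h'].
rewrite [leRHS]mulrDl; apply: le_trans (lerD h h'); apply: le_trans (cnD _ _).
by rewrite le_eqVlt; apply/orP; left; apply/eqP; congr cn; ring.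
Qed.

Lemma lin_bound F x y : lin F x y -> exists K d, 0 < d /\
  forall s, cn s <= d -> cn (F s - x) <= K * cn s.
Proof.
move=> [K [d [d0 H]]]; exists (`|K| * d + cn y), d; split=> // s sd.
have := cnD (F s - x - y * s) (y * s); rewrite subrK cnM => h.
apply: le_trans h _; rewrite mulrDl lerD2r; apply: le_trans (H s sd) _.
rewrite expr2 mulrA ler_wpM2r ?cn_ge0//.
apply: le_trans (_ : `|K| * cn s <= _); last by rewrite ler_wpM2l.
by rewrite ler_wpM2r ?cn_ge0// ler_norm.
Qed.

Lemma linM F G x y x' y' : lin F x y -> lin G x' y' ->
  lin (fun s => F s * G s) (x * x') (x * y' + y * x').
Proof.
move=> lF lG; have [K [d [d0 H]]] := lF; have [K' [d' [d'0 H']]] := lG.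
have [L [e [e0 HL]]] := lin_bound lF; have [L' [e' [e'0 HL']]] := lin_bound lG.
exists (K * cn x' + cn x * K' + L * L'), (Num.min (Num.min d d') (Num.min e e')).
split; first by rewrite !lt_min d0 d'0 e0.
move=> s; rewrite !le_min => /andP[/andP[/H h /H' h'] /andP[/HL l /HL' l']].
have -> : F s * G s - x * x' - (x * y' + y * x') * s =
  (F s - x - y * s) * x' + x * (G s - x' - y' * s) + (F s - x) * (G s - x') by ring.
rewrite [leRHS]mulrDl [X in _ <= X + _]mulrDl.
apply: le_trans (cnD _ _) _; apply: lerD.
  apply: le_trans (cnD _ _) _; rewrite !cnM; apply: lerD.
    by rewrite mulrAC ler_wpM2r ?cn_ge0.
  by rewrite -mulrA ler_wpM2l ?cn_ge0.
rewrite cnM expr2 mulrACA; apply: ler_pM; rewrite ?cn_ge0//.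
Qed.

(** Two continuations are only known to agree off 0. Small real s give x = x', and then, after
    division by s, y = y'. *)
Lemma lin_unique F G x y x' y' (e : R) : lin F x y -> lin G x' y' -> 0 < e ->
  (forall s, 0 < cn s < e -> F s = G s) -> x = x' /\ y = y'.
Proof.
move=> lF lG e0 FG; have [K [d [d0 H]]] := lF; have [K' [d' [d'0 H']]] := lG.
have aux (p q : C) (B b : R) : 0 < b ->
    (forall t : R, 0 < t <= b -> cn (p - q) <= B * t) -> p = q.
  move=> b0 h; apply/eqP; rewrite -subr_eq0 -cn_eq0 eq_le cn_ge0 andbT.
  apply/ler_addgt0Pr => z z0; rewrite add0r.
  pose t := Num.min b (z / (`|B| + 1)).
  have z0' : 0 < z / (`|B| + 1) by rewrite divr_gt0// ltr_wpDl.
  have t0 : 0 < t by rewrite lt_min b0.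
  have /h h' : 0 < t <= b by rewrite t0 ge_min lexx.
  apply: le_trans h' _; apply: le_trans (_ : (`|B| + 1) * t <= _).
    by rewrite ler_wpM2r ?(ltW t0)//; have := ler_norm B; lra.
  by rewrite mulrC -ler_pdivlMr ?ltr_wpDl// ge_min lexx orbT.
pose b := Num.min (e / 2) (Num.min d d').
have b0 : 0 < b by rewrite !lt_min divr_gt0// d0.
have hb t : 0 < t <= b -> [/\ 0 < cn t%:C%C < e, cn t%:C%C <= d, cn t%:C%C <= d' & cn t%:C%C = t].
  rewrite !le_min => /andP[t0 /and3P[h1 h2 h3]]; rewrite cn_real gtr0_norm// t0; split=> //=.
  lra.
have E t : 0 < t <= b -> cn ((x - x') + (y - y') * t%:C%C) <= (K + K') * t ^+ 2.
  move=> /hb [h1 h2 h3 h4]; have := H _ h2; have := H' _ h3.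
  rewrite FG// h4 => k1 k2.
  have -> : x - x' + (y - y') * t%:C%C =
    (G t%:C%C - x' - y' * t%:C%C) - (G t%:C%C - x - y * t%:C%C) by ring.
  apply: le_trans (cnD _ _) _; rewrite cnN mulrDl addrC; exact: lerD.
have xx : x = x'.
  apply: (aux _ _ (`|K + K'| * b + cn (y - y')) b) => // t tb.
  have := E t tb; have [_ _ _ h4] := hb _ tb; have /andP[t0 tb'] := tb => h.
  have := cnB (x - x' + (y - y') * t%:C%C) ((y - y') * t%:C%C).
  have := cnD (x - x' + (y - y') * t%:C%C) (- ((y - y') * t%:C%C)).
  rewrite addrK cnN [cn ((y - y') * _)]cnM h4 => h5 _.
  apply: le_trans h5 _; rewrite [leRHS]mulrDl lerD2r; apply: le_trans h _.
  rewrite expr2 mulrA ler_wpM2r ?(ltW t0)//.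
  apply: le_trans (_ : `|K + K'| * t <= _); last by rewrite ler_wpM2l.
  by rewrite ler_wpM2r ?ler_norm// ltW.
split=> //; apply: (aux _ _ (K + K') b) => // t tb.
have := E t tb; have [_ _ _ h4] := hb _ tb; have /andP[t0 _] := tb.
by rewrite xx subrr add0r cnM h4 expr2 mulrA ler_pM2r.
Qed.

Lemma lin_cpow t : lin (fun s => cpow t (- s)) 1 (- (ln t)%:C%C).
Proof.
have := lin_expansion ltr01 (expansion_cexp (- ln t) (@ler01 R)).
rewrite expr0 expr1 !divr1 realcN.
by rewrite (_ : (fun s => _) = fun s => cpow t (- s))//; apply/funext => s; rewrite /cpow mulrN mulNr.
Qed.

(** * Comparison with the topological definitions *)

Lemma normc_lt x (p : R) : `|x| < p%:C%C -> cn x < p.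
Proof. by rewrite cnE ltcE => /andP[]. Qed.

Lemma lt_normc x (p : R) : cn x < p -> `|x| < p%:C%C.
Proof. by move=> xp; rewrite cnE ltcE; apply/andP; split=> /=. Qed.

Lemma near_cnP a (P : C -> Prop) :
  (\forall s \near (a : C^o), P s) <-> exists2 d, 0 < d & forall s, cn (s - a) < d -> P s.
Proof.
split.
  move=> /nbhs_ballP[[p q] /= e0 H]; have := e0; rewrite ltcE /= => /andP[/eqP qE p0].
  exists p => // s sa; apply: H; rewrite /ball /= qE.
  by apply: lt_normc; rewrite cnB.
move=> [d d0 H]; apply/nbhs_ballP; exists d%:C%C => /=; first by rewrite ltcR.
by move=> s; rewrite /ball /= => /normc_lt; rewrite cnB; exact: H.
Qed.

Lemma dnear_cnP a (P : C -> Prop) :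
  (\forall s \near (a : C^o)^', P s) <->
  exists2 d, 0 < d & forall s, 0 < cn (s - a) < d -> P s.
Proof.
split.
  move=> /near_cnP [d d0 H]; exists d => // s /andP[s0 sd].
  by apply: H => //; rewrite -subr_eq0 -cn_gt0.
move=> [d d0 H]; apply/near_cnP; exists d => // s sd sa; apply: H.
by rewrite sd cn_gt0 subr_eq0 sa.
Qed.

Lemma cvg_ctoP u (l : C) : ((u n : C^o) @[n --> \oo] --> (l : C^o)) <-> cto u l.
Proof.
split.
  move=> /cvgrPdist_lt H e e0; have /H [N _ HN] : 0 < e%:C%C :> C by rewrite ltcR.
  by exists N => n /HN /= /normc_lt; rewrite cnB.
move=> H; apply/cvgrPdist_lt => -[p q] /=; rewrite ltcE /= => /andP[/eqP -> p0].
have [N HN] := H _ p0; exists N => // n /HN h /=.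
by apply: lt_normc; rewrite cnB.
Qed.

Lemma cto_bounded u l : cto u l -> exists B, forall n, cn (u n) <= B.
Proof.
move=> /(_ 1 ltr01) [N H].
exists (\sum_(n < N) cn (u n) + (cn l + 1)) => n.
have [Nn|nN] := leqP N n.
  apply: le_trans (cn_le_dist _ l) _; rewrite -[leLHS]add0r lerD//.
    by apply: sumr_ge0 => i _; exact: cn_ge0.
  by rewrite lerD2l ltW// H.
rewrite (bigD1 (Ordinal nN)) //= -addrA lerDl addr_ge0//.
  by apply: sumr_ge0 => i _; exact: cn_ge0.
by rewrite addr_ge0 ?cn_ge0.
Qed.

(** Abel's lemma: convergence at distance d / 2 bounds the terms there, and radius d / 4 yields a
    geometric majorant of ratio 1/2. The value [x] at the centre is a parameter because the
    hypothesis concerns the punctured disc, as needed for Laurent expansions. *)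
Lemma power_series_expansion u a d f : 0 < d ->
  (forall s, 0 < cn (s - a) < d -> power_series_sum u (s - a) (f s)) ->
  exists r M, [/\ 0 < r, r < d & forall x, (power_series_sum u 0 x ->
    expansion u a r M (fun s => if s == a then x else f s))].
Proof.
move=> d0 uf; pose q := d / 2; pose r := d / 4%:R.
have r0 : 0 < r by rewrite divr_gt0.
have [B HB] : exists B, forall n, cn (u n) * q ^+ n <= B.
  have := uf (a + q%:C%C); rewrite addrAC subrr add0r cn_real gtr0_norm ?divr_gt0//.
  rewrite /q => /(_ _)/cvg_ctoP/cto_bounded[|B H]; first by apply/andP; split => //; lra.
  exists (B + B) => n; have := lerD (H n.+1) (H n); apply: le_trans.
  rewrite big_ord_recr /=; set A := \sum_(i < n) _.
  have := cnD (A + u n * (d / 2)%:C%C ^+ n) (- A); rewrite cnN addrAC subrr add0r.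
  by rewrite cnM cnX cn_real gtr0_norm ?divr_gt0.
have B0 : 0 <= B by apply: le_trans (HB 0%N); rewrite expr0 mulr1 cn_ge0.
exists r, (B * 2); split=> //; first by rewrite /r; lra.
move=> x ux; split=> [n|s sr].
  apply: le_trans (_ : \sum_(k < n) B * (1 / 2) ^+ k <= _).
    apply: ler_sum => k _; have -> : r = q * (1 / 2) by rewrite /r /q; field.
    by rewrite exprMn mulrA ler_wpM2r// exprn_ge0// divr_ge0.
  rewrite -mulr_sumr ler_wpM2l//.
  by rewrite sum_half gerBl mulr_ge0// exprn_ge0// divr_ge0.
have [->|sa] := eqVneq s a; first by rewrite subrr; exact/cvg_ctoP.
apply/cvg_ctoP; apply: uf; rewrite cn_gt0 subr_eq0 sa /=.
by apply: le_lt_trans sr _; rewrite /r; lra.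
Qed.

Lemma power_series_sum00 u : power_series_sum u (0 : C) (u 0%N).
Proof.
apply/cvg_ctoP; apply: (eq_cto (N := 1%N) _ (cto_cst (u 0%N))); case=> // n _.
rewrite big_ord_recl expr0 mulr1 big1 ?addr0// => i _.
by rewrite expr0n mulr0.
Qed.

Lemma holomorphic_an F a : holomorphic_at F a -> exists u r M, 0 < r /\ expansion u a r M F.
Proof.
move=> [u /near_cnP[d d0 H]].
have [|r [M [r0 rd]]] := @power_series_expansion u a d F d0.
  by move=> s /andP[_ sd]; exact: H.
have H0 := H a; rewrite subrr cn0 in H0; move=> /(_ _ (H0 d0)) E.
exists u, r, M; split=> //; move: E.
rewrite (_ : (fun s => _) = F)//; apply/funext => s.
by case: eqP => [->|//].
Qed.

Lemma an_holomorphic F a r M : 0 < r -> an a r M F -> holomorphic_at F a.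
Proof.
move=> r0 [u [_ uF]]; exists u; apply/near_cnP; exists r => // s sr.
exact/cvg_ctoP/uF/ltW.
Qed.

Lemma meromorphic_mer F a : meromorphic_at F a -> mer F a.
Proof.
move=> [n [u /dnear_cnP[d d0 H]]].
have [r [M [r0 rd]]] := @power_series_expansion u a d _ d0 H.
move=> /(_ _ (@power_series_sum00 u)) E.
exists n, r, M, (fun s => if s == a then u 0%N else (s - a) ^+ n * F s).
split=> //; first by exists u.
by move=> s _ /negbTE ->.
Qed.

Lemma mer_meromorphic F a : mer F a -> meromorphic_at F a.
Proof.
move=> [n [r [M [g [r0 [u [_ ug]] gE]]]]]; exists n, u.
apply/dnear_cnP; exists r => // s /andP[s0 sr].
have sa : s != a by rewrite -subr_eq0 -cn_gt0.
by rewrite (gE s (ltW sr) sa); exact/cvg_ctoP/ug/ltW.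
Qed.

Lemma lin_at0 F x y : lin F x y -> F 0 = x.
Proof.
move=> [K [d [d0 H]]]; have := H 0; rewrite cn0 expr0n mulr0 mulr0 subr0.
move=> /(_ (ltW d0)) h; apply/eqP; rewrite -subr_eq0 -cn_eq0.
by rewrite eq_le h cn_ge0.
Qed.

Lemma lin_derive1 F x y : lin F x y -> derive1 (F : C^o -> C^o) 0 = y.
Proof.
move=> lF; rewrite /derive1; apply: cvg_lim; first exact: norm_hausdorff.
apply/cvgrPdist_lt => -[e ?] /=; rewrite ltcE /= => /andP[/eqP -> e0].
have [K [d [d0 H]]] := lF.
apply/dnear_cnP; exists (Num.min d (e / (`|K| + 1))).
  by rewrite lt_min d0 divr_gt0// ltr_wpDl.
move=> s; rewrite subr0 lt_min => /andP[s0 /andP[sd se]].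
have sn0 : s != 0 by rewrite -cn_gt0.
rewrite addr0 (lin_at0 lF); apply: lt_normc.
rewrite [s^-1 *: _](_ : _ = s^-1 * (F s - x))//.
have -> : y - s^-1 * (F s - x) = - (s^-1 * (F s - x - y * s)) by field.
rewrite cnN cnM cnV mulrC ltr_pdivrMr//; apply: le_lt_trans (H s (ltW sd)) _.
rewrite expr2 mulrA ltr_pM2r//; rewrite ltr_pdivlMr ?ltr_wpDl// in se.
apply: le_lt_trans se; rewrite mulrC ler_wpM2l ?cn_ge0//.
by have := ler_norm K; lra.
Qed.

End ComplexAnalysis.

(** * The binomial series *)

Section Binomial.
Variable R : realType.
Local Notation C := R[i].
Implicit Types (a s x : C) (r M : R).

Definition gbin (F : numFieldType) (t : F) k : F := (\prod_(i < k) (t - i%:R)) / k`!%:R.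

Lemma gbin0 (F : numFieldType) (t : F) : gbin t 0 = 1.
Proof. by rewrite /gbin big_ord0 divr1. Qed.

Lemma gbinS (F : numFieldType) (t : F) k : k.+1%:R * gbin t k.+1 = (t - k%:R) * gbin t k.
Proof.
rewrite /gbin big_ord_recr /= factS natrM; field.
by rewrite nat1r !pnatr_eq0 -!lt0n fact_gt0.
Qed.

Lemma gbin_diff (F : numFieldType) (t : F) k : k.+1%:R * gbin t k.+1 = t * gbin (t - 1) k.
Proof.
rewrite /gbin big_ord_recl /= subr0 factS natrM.
have -> : \prod_(i < k) (t - (bump 0 i)%:R) = \prod_(i < k) (t - 1 - i%:R).
  by apply: eq_bigr => i _; rewrite /bump /= add1n -addrA -opprD -natr1 addrC [1 + _]addrC addrC.
by field; rewrite nat1r !pnatr_eq0 -!lt0n fact_gt0.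
Qed.

Lemma gbin_pascal (F : numFieldType) (t : F) k :
  gbin t k.+1 = gbin (t - 1) k.+1 + gbin (t - 1) k.
Proof.
have k0 : k.+1%:R != 0 :> F by rewrite pnatr_eq0.
apply: (mulfI k0); rewrite gbin_diff mulrDr gbinS -mulrDl.
by congr (_ * _); rewrite -natr1; ring.
Qed.

Lemma bin_le_exp2 n k : ('C(n, k) <= 2 ^ n)%N.
Proof.
elim: n k => [|n IH] [|k] //; first by rewrite bin0 expn_gt0.
by rewrite binS expnS mul2n -addnn leq_add.
Qed.

Lemma prod_rising (F : numFieldType) A k :
  (\prod_(l < k) (A.+1 + l)%:R) / k`!%:R = 'C(A + k, k)%:R :> F.
Proof.
elim: k => [|k IH]; first by rewrite big_ord0 addn0 bin0 divr1.
have k0 : k.+1%:R != 0 :> F by rewrite pnatr_eq0.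
rewrite big_ord_recr /= factS natrM; apply: (mulfI k0).
have -> : k.+1%:R * 'C(A + k.+1, k.+1)%:R = (A.+1 + k)%:R * 'C(A + k, k)%:R :> F.
  by rewrite -!natrM addnS -mul_bin_diag addSn.
rewrite -IH.
by field; rewrite nat1r !pnatr_eq0 -!lt0n fact_gt0.
Qed.

(** Comparison with a binomial coefficient, itself at most 2^(A+k). With this bound the binomial
    series at x is controlled for 2 |x| < 1, whence the ranges 3/8 and 1/4 below. *)
Lemma rising_le (m : nat -> R) A k : (forall l, 0 <= m l <= (A.+1 + l)%:R) ->
  (\prod_(l < k) m l) / k`!%:R <= 2 ^+ (A + k).
Proof.
move=> mA; apply: le_trans (_ : 'C(A + k, k)%:R <= _); last first.
  by rewrite -natrX ler_nat bin_le_exp2.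
rewrite -prod_rising ler_wpM2r ?invr_ge0//; apply: ler_prod => l _; exact: mA.
Qed.

Lemma gbin_le (t : R) A k : `|t| <= A%:R -> `|gbin t k| <= 2 ^+ (A + k).
Proof.
move=> tA; rewrite /gbin normrM normfV normr_nat normr_prod.
apply: (rising_le (m := fun l => `|t - l%:R|)) => l; rewrite normr_ge0/=.
apply: le_trans (ler_normB _ _) _; rewrite normr_nat natrD -natr1; lra.
Qed.

Lemma geo_le (q : R) n : 0 <= q < 1 -> \sum_(k < n) q ^+ k <= (1 - q)^-1.
Proof.
move=> /andP[q0 q1]; have h : 0 < 1 - q by rewrite subr_gt0.
rewrite -[leRHS]mul1r ler_pdivlMr// mulrC.
have -> : (1 - q) * \sum_(k < n) q ^+ k = 1 - q ^+ n.
  by rewrite -opprB mulNr -subrX1 opprB.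
by rewrite gerBl exprn_ge0.
Qed.

Lemma cvg_gbin (t x : R) : `|x| <= 3%:R / 8%:R -> cvgn (pseries (gbin t) x).
Proof.
move=> x38; apply: normed_cvg; apply: nondecreasing_is_cvgn.
  by apply: nondecreasing_series => n _ _; exact: normr_ge0.
have [A tA] : exists A : nat, `|t| <= A%:R.
  by exists (Num.bound `|t|); apply/ltW/archi_boundP.
exists (2 ^+ A * 4%:R) => _ [n _ <-]; rewrite /= seriesEnat /= big_mkord.
apply: le_trans (_ : \sum_(k < n) 2 ^+ A * (3%:R / 4%:R) ^+ k <= _).
  apply: ler_sum => k _; rewrite normrM normrX.
  apply: le_trans (_ : 2 ^+ (A + k) * (3%:R / 8%:R) ^+ k <= _).
    apply: ler_pM; rewrite ?exprn_ge0//; first exact: gbin_le.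
    by apply: lerXn2r; rewrite ?nnegrE// divr_ge0.
  have E : 2 * (3%:R / 8%:R) = 3%:R / 4%:R :> R by field.
  by rewrite exprD -mulrA -exprMn E.
rewrite -mulr_sumr ler_wpM2l ?exprn_ge0//; apply: le_trans (geo_le _ _) _; last first.
  by rewrite (_ : 1 - 3%:R / 4%:R = 4%:R^-1) ?invrK//; field.
by apply/andP; split; lra.
Qed.

Lemma pseries_diffs_gbin (t : R) : pseries_diffs (gbin t) = (fun k => t * gbin (t - 1) k).
Proof. by apply/funext => k; rewrite /pseries_diffs gbin_diff. Qed.

Lemma pseriesZ (t : R) (u : nat -> R) (x : R) : pseries (fun k => t * u k) x = t \*: pseries u x.
Proof.
apply/funext => n; rewrite /pseries /= /series /= scaler_sumr; apply: eq_bigr => k _.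
by rewrite -mulrA.
Qed.

Let f (t x : R) := limn (pseries (gbin t) x).

Lemma cvg_gbinZ (c t x : R) : `|x| <= 3%:R / 8%:R ->
  pseries (fun k => c * gbin t k) x @ \oo --> c * f t x.
Proof.
move=> hx; rewrite pseriesZ; apply: cvgZl_tmp; exact: cvg_gbin.
Qed.

Lemma binom_derive (t x : R) : `|x| < 3%:R / 8%:R ->
  is_derive x (1 : R) (f t) (t * f (t - 1) x).
Proof.
move=> hx; have K0 : `|3%:R / 8%:R : R| = 3%:R / 8%:R by rewrite ger0_norm// divr_ge0.
have := @pseries_snd_diffs R (gbin t) (3%:R / 8%:R) x.
rewrite K0 pseries_diffs_gbin.
have -> : limn (pseries (fun k => t * gbin (t - 1) k) x) = t * f (t - 1) x.
  by apply: cvg_lim => //; apply: cvg_gbinZ; exact: ltW.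
apply=> //.
- by apply: cvg_gbin; rewrite K0.
- by apply: cvgP; apply: cvg_gbinZ; rewrite K0.
- rewrite /pseries_diffs (_ : (fun i => _) = (fun k => (t * (t - 1)) * gbin (t - 1 - 1) k)).
    by apply: cvgP; apply: cvg_gbinZ; rewrite K0.
  by apply/funext => k; rewrite mulrCA gbin_diff mulrA.
Qed.

Lemma binom_pascal (t x : R) : `|x| < 3%:R / 8%:R -> f t x = (1 + x) * f (t - 1) x.
Proof.
move=> hx; apply: cvg_lim => //; rewrite mulrDl mul1r.
have c1 : pseries (gbin (t - 1)) x @ \oo --> f (t - 1) x by apply: cvg_gbin; exact: ltW.
rewrite -(cvg_shiftS (pseries (gbin t) x)).
have -> : [sequence pseries (gbin t) x n.+1]_n =
    (fun n => pseries (gbin (t - 1)) x n.+1 + x * pseries (gbin (t - 1)) x n).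
  apply/funext => n; rewrite /= /pseries /series /= big_nat_recl//= [in RHS]big_nat_recl//=.
  rewrite !gbin0 mulr_sumr -addrA -big_split /=; congr (_ + _); apply: eq_bigr => k _.
  by rewrite gbin_pascal exprS; ring.
apply: cvgD; first by rewrite (cvg_shiftS (pseries (gbin (t - 1)) x)).
by apply: cvgMl_tmp.
Qed.

(** The product of the series and (1 + y)^(-t) has derivative zero: the series satisfies f_t' = t
    f_(t-1), and Pascal's rule gives f_t = (1 + y) f_(t-1). *)
Lemma binom_real (t x : R) : 0 <= x <= 1 / 4%:R -> f t x = expR (t * ln (1 + x)).
Proof.
move=> /andP[x0 x4].
pose g y := f t y * expR (- t * ln (1 + y)).
have dg (y : R) : 0 <= y <= 1 / 4%:R -> is_derive y (1 : R) g 0.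
  move=> /andP[y0 y4].
  have hy : `|y| < 3%:R / 8%:R by rewrite ger0_norm//; lra.
  have D := binom_derive t hy.
  have y1 : 0 < 1 + y by lra.
  have I : is_derive y (1 : R) (cst 1 + id : R -> R) 1.
    by apply: is_derive_eq; rewrite add0r.
  have L : is_derive y (1 : R) (@ln R \o (cst 1 + id)) ((1 + y)^-1 * 1).
    by apply: is_derive1_comp; exact: is_derive1_ln.
  have E : is_derive y (1 : R) (expR \o ((- t) \*: (@ln R \o (cst 1 + id))))
    (expR (- t * ln (1 + y)) * (- t *: ((1 + y)^-1 * 1))).
    by apply: is_derive1_comp.
  apply: (is_derive_eq (is_deriveM D E)).
  rewrite /GRing.scale /= (binom_pascal t hy) mulr1; field.
  by rewrite gt_eqF.
have x4' : 0 <= x <= 1 / 4%:R by rewrite x0.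
have [c _] : exists2 c, c \in `[0, x]%R & g x - g 0 = (fun=> 0) c * (x - 0).
  apply: MVT_segment => // [y|].
    by rewrite in_itv /= => /andP[y0 yx]; apply: dg; rewrite (ltW y0)/=; lra.
  apply: derivable_within_continuous => y; rewrite in_itv /= => /andP[y0 yx].
  by apply: ex_derive; apply: dg; rewrite y0/=; lra.
rewrite mul0r => /eqP; rewrite subr_eq0 => /eqP gx.
have g0 : g 0 = 1.
  rewrite /g addr0 ln1 mulr0 expR0 mulr1 /f; apply: cvg_lim => //.
  rewrite -cvg_shiftS; apply: cvg_near_cst; apply: nearW => n.
  rewrite /pseries seriesEnat /= big_nat_recl//= gbin0 mul1r expr0 big1 ?addr0// => i _.
  by rewrite expr0n mulr0.
have : g x * expR (t * ln (1 + x)) = expR (t * ln (1 + x)) by rewrite gx g0 mul1r.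
by rewrite /g -mulrA -expRD mulNr addNr expR0 mulr1.
Qed.

Lemma cto_binom_real (t y : R) : 0 <= y <= 1 / 4%:R ->
  cto (fun n => \sum_(k < n) gbin t%:C%C k * y%:C%C ^+ k) (cpow (1 + y) t%:C%C).
Proof.
move=> y4; rewrite cpow_real -binom_real//.
have /cvgrPdist_lt H : pseries (gbin t) y @ \oo --> f t y.
  by apply: cvg_gbin; case/andP: y4 => y0 y4; rewrite ger0_norm//; lra.
move=> e /H [N _ HN]; exists N => n /HN /=.
rewrite (_ : \sum_(k < n) _ = (pseries (gbin t) y n)%:C%C).
  by rewrite -realcB cn_real distrC.
rewrite /pseries /series /= big_mkord realc_sum; apply: eq_bigr => k _.
rewrite realcM realcX /gbin realcM realcV realc_nat (rmorph_prod (real_complex R)).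
by congr (_ / _ * _); apply: eq_bigr => i _; rewrite -realc_nat -realcB.
Qed.

Lemma an_gbin a r x A k : 0 < r -> cn (x - a) + r <= A%:R ->
  an a r (2 ^+ (A + k)) (fun s => gbin (x - s) k).
Proof.
move=> r0 hA; have r0' := ltW r0.
apply: an_le (rising_le (m := fun l => cn (x - a) + r + l%:R) _ _) _ => [l|].
  rewrite !addr_ge0 ?cn_ge0//= natrD lerD2r; apply: le_trans hA _.
  by rewrite ler_nat.
apply: an_le (_ : cn (k`!%:R^-1 : C) * \prod_(l < k) (cn (x - a) + r + l%:R) <= _) _.
  by rewrite cnV cn_nat mulrC.
apply: eq_an (anMl k`!%:R^-1 (an_prod (index_enum 'I_k)
  (M := fun l : 'I_k => cn (x - a) + r + l%:R) (F := fun (l : 'I_k) s => x - s - l%:R) r0 _)).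
  by move=> s _; rewrite /gbin mulrC.
move=> l; apply: an_le (eq_an _ (an_lin a (x - l%:R) (-1) r0')).
  rewrite cnN cn1 mul1r mulN1r addrAC; apply: le_trans (_ : cn (x - a) + l%:R + r <= _).
    by rewrite lerD2r; apply: le_trans (cnD _ _) _; rewrite cnN cn_nat.
  by rewrite addrAC.
by move=> s _; ring.
Qed.

(* Both sides are analytic in the exponent and agree on reals. *)
Lemma cto_binom x (y : R) : 0 <= y <= 1 / 4%:R ->
  cto (fun n => \sum_(k < n) gbin x k * y%:C%C ^+ k) (cpow (1 + y) x).
Proof.
move=> /andP[y0 y4].
pose r := cn x + 1; have r0 : 0 < r by rewrite ltr_wpDl ?cn_ge0.
have [A hA] : exists A : nat, cn (0 - 0 : C) + r <= A%:R.
  exists (Num.bound r); rewrite subr0 cn0 add0r; apply/ltW/archi_boundP/ltW/r0.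
pose F n s := \sum_(k < n) gbin (0 - s) k * y%:C%C ^+ k.
have [||n|g [ag Fg]] := @an_lim _ 0 r 0 (2 ^+ A * 2) F (fun k => 2 ^+ A * (1 / 2) ^+ k) r0.
- apply: (eq_an (f := fun=> 0)) => [s _|]; first by rewrite /F big_ord0.
  by rewrite -(cn0 R); apply: an_cst; exact: ltW.
- move=> n; apply: an_le (eq_an _ (anMl (y%:C%C ^+ n) (an_gbin n r0 hA))).
    rewrite cnX cn_real ger0_norm// exprD mulrCA -exprMn ler_wpM2l ?exprn_ge0//.
    by rewrite lerXn2r ?nnegrE ?mulr_ge0 ?divr_ge0//; lra.
  by move=> s _; rewrite /F big_ord_recr /=; ring.
- rewrite -mulr_sumr ler_wpM2l ?exprn_ge0//; apply: le_trans (geo_le _ _) _.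
    by apply/andP; split; lra.
  by rewrite (_ : 1 - 1 / 2 = 2^-1) ?invrK//; field.
have [M aM] : exists M, an 0 r M (fun s => cpow (1 + y) (0 - s)).
  by eexists; exact: an_cpow.
have gE : forall s, cn (s - 0%:C%C) <= r -> g s = cpow (1 + y) (0 - s).
  apply: an_eq_real r0 ag aM _ => t t0; rewrite subr0 => tr.
  have tr' : cn (t%:C%C - 0) <= r by rewrite subr0 cn_real gtr0_norm.
  apply: cto_unique (Fg _ tr') _; rewrite sub0r -realcN.
  have := @cto_binom_real (- t) y; rewrite y0 y4 => /(_ isT).
  by apply: (eq_cto (N := 0%N)) => n _; rewrite /F sub0r realcN.
have xr : cn (- x - 0) <= r by rewrite subr0 cnN lerDl.
have := Fg _ xr; rewrite gE// sub0r opprK.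
by apply: (eq_cto (N := 0%N)) => n _; rewrite /F sub0r opprK.
Qed.

(** A remainder estimate uniform in the exponent: the k-th term has norm at most 2^A (2 y)^k, and 2
    y <= 1/2 sums the tail to twice its first bound. *)
Lemma an_binom a r x A (y : R) n : 0 < r -> cn (x - a) + r <= A%:R ->
  0 <= y <= 1 / 4%:R ->
  an a r (2 ^+ A.+1 * (2 * y) ^+ n)
    (fun s => cpow (1 + y) (x - s) - \sum_(k < n) gbin (x - s) k * y%:C%C ^+ k).
Proof.
move=> r0 hA y4; have /andP[y0 y1] := y4.
pose F m s := \sum_(k < m) gbin (x - s) (n + k) * y%:C%C ^+ (n + k).
have [||m|g [ag Fg]] := @an_lim _ a r 0 (2 ^+ A.+1 * (2 * y) ^+ n) F
    (fun k => 2 ^+ A * (2 * y) ^+ n * (1 / 2) ^+ k) r0.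
- apply: (eq_an (f := fun=> 0)) => [s _|]; first by rewrite /F big_ord0.
  by rewrite -(cn0 R); apply: an_cst; exact: ltW.
- move=> m; apply: an_le (eq_an _ (anMl (y%:C%C ^+ (n + m)) (an_gbin (n + m) r0 hA))).
    rewrite cnX cn_real ger0_norm//.
    rewrite [leLHS](_ : _ = 2 ^+ A * (2 * y) ^+ n * (2 * y) ^+ m); last first.
      by rewrite !exprD !exprMn; ring.
    rewrite ler_wpM2l ?mulr_ge0 ?exprn_ge0 ?mulr_ge0//.
    by rewrite lerXn2r ?nnegrE ?mulr_ge0 ?divr_ge0//; lra.
  by move=> s _; rewrite /F big_ord_recr /=; ring.
- rewrite -mulr_sumr exprSr -!mulrA ler_wpM2l ?exprn_ge0// mulrC.
  rewrite ler_wpM2r ?exprn_ge0 ?mulr_ge0//; apply: le_trans (geo_le _ _) _.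
    by apply/andP; split; lra.
  by rewrite (_ : 1 - 1 / 2 = 2^-1) ?invrK//; field.
rewrite add0r in ag; apply: eq_an ag => s sa; apply: cto_unique (Fg _ sa) _.
have := cto_shift n (cto_binom (x - s) y4).
move=> /ctoB /(_ (cto_cst (\sum_(k < n) gbin (x - s) k * y%:C%C ^+ k))).
apply: (eq_cto (N := 0%N)) => m _; rewrite /F addnC big_split_ord /=.
by rewrite addrAC subrr add0r.
Qed.

End Binomial.

(** * The double zeta function *)

Section DoubleZeta.
Variable R : realType.
Local Notation C := R[i].
Local Notation Re := (@complex.Re R).
Implicit Types (a s x : C) (r M u h : R).

(** Inverse of the formal power series [c]. The coefficients are built as a growing list since each
    depends on all earlier ones. *)
Lemma conv_inv (c : nat -> R) : c 0%N != 0 ->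
  exists b : nat -> R, forall m, \sum_(j < m.+1) b j * c (m - j)%N = (m == 0%N)%:R.
Proof.
move=> c0.
pose bs := fix bs n : seq R := if n is n'.+1 then
  rcons (bs n') (((n' == 0%N)%:R - \sum_(j < n') (bs n')`_j * c (n' - j)%N) / c 0%N) else [::].
have sz n : size (bs n) = n by elim: n => //= n IH; rewrite size_rcons IH.
have nthb n j : (j < n)%N -> (bs n)`_j = (bs j.+1)`_j.
  elim: n => // n IH; rewrite ltnS leq_eqVlt => /orP[/eqP->//|jn].
  by rewrite -IH //= nth_rcons sz jn.
exists (fun j => (bs j.+1)`_j) => m; rewrite big_ord_recr /= subnn nth_rcons sz ltnn eqxx.
rewrite mulfVK// (eq_bigr (fun j : 'I_m => (bs m)`_j * c (m - j)%N)); last first.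
  by move=> j _; rewrite -(nthb m).
by rewrite addrC subrK.
Qed.

Definition ffall j s : C := \prod_(i < j) (2 - s - i%:R).

(* [phi j] is the j-th derivative in [u] of u^(2 - s). *)
Definition phi j u s : C := ffall j s * cpow u (2 - j%:R - s).

Lemma phiD j i u s : 0 < u ->
  phi (j + i) u s = ffall j s * (i`!%:R * gbin (2 - j%:R - s) i) *
    (cpow u (2 - j%:R - s) * u^-1%:C%C ^+ i).
Proof.
move=> u0; rewrite /phi /gbin /ffall big_split_ord /=.
have -> : \prod_(l < i) (2 - s - (j + l)%:R) = i`!%:R *
    ((\prod_(l < i) (2 - j%:R - s - l%:R)) / i`!%:R) :> C.
  rewrite mulrCA divff ?mulr1 ?pnatr_eq0 -?lt0n ?fact_gt0//.
  by apply: eq_bigr => l _; rewrite natrD; ring.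
congr (_ * _); have -> : 2 - (j + i)%:R - s = 2 - j%:R - s + - i%:R :> C.
  by rewrite natrD; ring.
rewrite cpowD; congr (_ * _); apply: (mulIf (cpow_neq0 u i%:R)).
rewrite -cpowD addNr cpow0 cpow_nat// realcX -exprMn -realcM mulVf ?gt_eqF//.
by rewrite expr1n.
Qed.

Definition taylor_rem j n h u s : C :=
  phi j (u + h) s - \sum_(j <= k < n) (h ^+ (k - j) / (k - j)`!%:R)%:C%C * phi k u s.

(** By homogeneity this is the remainder of the binomial series in h / u, which [an_binom] bounds
    uniformly in s. *)
Lemma taylor_remE j n h u s : 0 < u -> 0 <= h ->
  taylor_rem j n h u s = ffall j s * (cpow u (2 - j%:R - s) *
    (cpow (1 + h / u) (2 - j%:R - s)
      - \sum_(i < n - j) gbin (2 - j%:R - s) i * (h / u)%:C%C ^+ i)).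
Proof.
move=> u0 h0; rewrite /taylor_rem mulrBr mulrBr; congr (_ - _).
  have -> : u + h = u * (1 + h / u) by field; rewrite gt_eqF.
  by rewrite /phi cpowM// ltr_wpDr ?divr_ge0 ?(ltW u0).
rewrite -[X in \sum_(X <= _ < _) _]add0n big_addn big_mkord !mulr_sumr.
apply: eq_bigr => i _; rewrite addnK (addnC i) (phiD j i s u0).
have f0 : i`!%:R != 0 :> C by rewrite pnatr_eq0 -lt0n fact_gt0.
by rewrite !realcM !realcV realcX realc_nat exprMn; set v := _^-1 ^+ i; field.
Qed.

Lemma an_ffall a j : exists M, an a 1 M (ffall j).
Proof.
eexists; apply: (an_prod (F := fun (i : 'I_j) s => 2 - s - i%:R) (M := fun i : 'I_j => _) _ ltr01) => i.
apply: (eq_an (f := fun s => (2 - i%:R) + -1 * s)) => [s _|]; first by ring.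
exact: an_lin.
Qed.

Lemma an_phi a j u : exists M, an a 1 M (phi j u).
Proof.
have [M aM] := an_ffall a j.
by eexists; apply: anM ltr01 aM (an_cpow _ _ _ ltr01).
Qed.

(** In the exponent of u, 2 - j - Re a comes from the power at the centre, 1 from the radius of the
    disc, and -(n - j) from (h / u)^(n-j). The condition on u places h / u in the range of the
    binomial series. *)
Lemma an_taylor_rem a j n h : 0 <= h -> exists2 M, 0 <= M &
  forall u, 1 <= u -> 4%:R * h <= u ->
    an a 1 (M * expR ((3%:R - j%:R - Re a - (n - j)%:R) * ln u)) (taylor_rem j n h u).
Proof.
move=> h0; have [L aL] := an_ffall a j; have L0 := an_ge0 aL.
pose x : C := 2 - j%:R.
pose A := Num.bound (cn (x - a) + 1).
have hA : cn (x - a) + 1 <= A%:R by apply/ltW/archi_boundP; rewrite addr_ge0 ?cn_ge0.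
exists (L * (2 ^+ A.+1 * (2 * h) ^+ (n - j))).
  by apply: mulr_ge0 => //; rewrite mulr_ge0 ?exprn_ge0 ?mulr_ge0.
move=> u u1 hu; have u0 : 0 < u by lra.
have y4 : 0 <= h / u <= 1 / 4%:R.
  rewrite divr_ge0 ?(ltW u0)//= ler_pdivrMr//; lra.
apply: an_le (eq_an _ (anM ltr01 aL (anM ltr01 (an_cpow u x a ltr01)
   (an_binom (n - j) ltr01 hA y4)))); last first.
  by move=> s _; rewrite taylor_remE.
rewrite -[leRHS]mulrA ler_wpM2l// [leLHS]mulrCA -[leRHS]mulrA ler_wpM2l ?exprn_ge0//.
have -> : (2 * (h / u)) ^+ (n - j) = (2 * h) ^+ (n - j) * expR (- (n - j)%:R * ln u).
  rewrite mulNr expRN expRM_natl lnK ?posrE//.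
  by rewrite mulrA exprMn exprVn.
rewrite mulrCA ler_wpM2l ?exprn_ge0 ?mulr_ge0// -!expRD ler_expR mulr1 ger0_norm ?ln_ge0//.
have -> : Re (x - a) = 2 - j%:R - Re a.
  rewrite /x -(realc_nat R 2) -(realc_nat R j) -realcB; case: (a) => p q /=.
  by [].
rewrite le_eqVlt; apply/orP; left; apply/eqP; ring.
Qed.

(** * Euler-Maclaurin summation with steps 1 and w *)

Variables (w z : R).
Hypotheses (w0 : 0 < w) (z0 : 0 < z).

(* [delta2] is (e^D - 1) (e^(w D) - 1), D = d/du, applied to [phi j]; its symbol has
   Taylor coefficients [ecoef]. *)
Definition delta2 j u s : C :=
  phi j (u + (1 + w)) s - phi j (u + w) s - phi j (u + 1) s + phi j (u + 0) s.

Definition ecoef i : R := ((1 + w) ^+ i - w ^+ i - 1 + 0 ^+ i) / i`!%:R.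

Lemma delta2E j n u s : delta2 j u s = \sum_(j <= k < n) (ecoef (k - j))%:C%C * phi k u s +
  (taylor_rem j n (1 + w) u s - taylor_rem j n w u s - taylor_rem j n 1 u s
    + taylor_rem j n 0 u s).
Proof.
pose q h := \sum_(j <= k < n) (h ^+ (k - j) / (k - j)`!%:R)%:C%C * phi k u s.
have -> : \sum_(j <= k < n) (ecoef (k - j))%:C%C * phi k u s = q (1 + w) - q w - q 1 + q 0.
  rewrite /q -!sumrB -big_split /=; apply: eq_bigr => k _.
  rewrite -!mulrBl -mulrDl -!realcB -realcD /ecoef expr1n; congr (_%:C%C * _); ring.
rewrite /delta2 /taylor_rem -!/(q _); ring.
Qed.

Lemma ecoef0 : ecoef 0 = 0. Proof. by rewrite /ecoef !expr0 divr1; ring. Qed.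
Lemma ecoef1 : ecoef 1 = 0. Proof. by rewrite /ecoef !expr1 divr1; ring. Qed.
Lemma ecoef2 : ecoef 2 = w. Proof. by rewrite /ecoef (_ : 2`! = 2)//; field. Qed.
Lemma ecoef3 : ecoef 3 = w * (1 + w) / 2.
Proof. by rewrite /ecoef (_ : 3`! = 6)//; field. Qed.

(* The generating series of [b] is t^2 / ((e^t - 1) (e^(w t) - 1)), so that
   \sum_j b_j delta2 j inverts to [phi 2] up to a small defect (Euler-Maclaurin). *)
Definition em_coef (b : nat -> R) :=
  forall m, \sum_(j < m.+1) b j * ecoef (m - j).+2 = (m == 0%N)%:R.

Lemma em_coef_exists : exists b, em_coef b.
Proof. by apply: (@conv_inv (fun i => ecoef i.+2)); rewrite ecoef2 gt_eqF. Qed.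

Variable b : nat -> R.
Hypothesis bP : em_coef b.

Lemma em_coef_conv N k : (k < N.+3)%N ->
  \sum_(j < N.+1 | (j <= k)%N) b j * ecoef (k - j) = (k == 2)%:R.
Proof.
have e01 i : (i < 2)%N -> ecoef i = 0.
  by case: i => [|[|]] // _; [exact: ecoef0|exact: ecoef1].
case: k => [|[|m]] kN.
- by rewrite big1// => j _; rewrite e01 ?mulr0.
- by rewrite big1// => j _; rewrite e01 ?mulr0//; lia.
rewrite !eqSS -bP (big_ord_widen_cond N.+1 predT (fun j => b j * ecoef (m - j).+2))//.
rewrite [LHS]big_mkcond [RHS]big_mkcond; apply: eq_bigr => j _ /=.
have [jm|mj] := ltnP j m.+1.
  have -> : (j <= m.+2)%N by lia.
  by congr (_ * ecoef _); lia.
by case: ifP => // _; rewrite e01 ?mulr0//; lia.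
Qed.

Definition defect N u s : C := phi 2 u s - \sum_(j < N.+1) (b j)%:C%C * delta2 j u s.

(** By [em_coef_conv] the Taylor terms of orders up to N + 2 add up to [phi 2]; only the remainders
    are left. *)
Lemma defectE N u s : defect N u s = - \sum_(j < N.+1) (b j)%:C%C *
  (taylor_rem j N.+3 (1 + w) u s - taylor_rem j N.+3 w u s - taylor_rem j N.+3 1 u s
    + taylor_rem j N.+3 0 u s).
Proof.
have key : \sum_(j < N.+1) (b j)%:C%C *
    \sum_(j <= k < N.+3) (ecoef (k - j))%:C%C * phi k u s = phi 2 u s.
  transitivity (\sum_(k < N.+3) (k == 2 :> nat)%:R * phi k u s); last first.
    rewrite (bigD1 (Ordinal (isT : 2 < N.+3)%N)) //= mul1r big1 ?addr0// => k.
    by rewrite -val_eqE /= => /negbTE->; rewrite mul0r.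
  under eq_bigr do rewrite big_geq_mkord big_mkcond /= mulr_sumr.
  rewrite exchange_big; apply: eq_bigr => k _ /=.
  rewrite -(realc_nat R (k == 2 :> nat)) -(@em_coef_conv N)// realc_sum mulr_suml.
  rewrite [RHS]big_mkcond; apply: eq_bigr => j _ /=.
  by case: ifP => _; [rewrite mulrA -realcM|rewrite mulr0].
rewrite /defect -{1}key -sumrB -sumrN; apply: eq_bigr => j _.
by rewrite (delta2E _ N.+3) mulrDr opprD addrA subrr add0r.
Qed.

(** The exponent of u is 3 - j - Re a - (N + 3 - j) = - Re a - N, at most -4 by the choice of N.
    Order 4 more than suffices for convergence over a two-dimensional lattice. *)
Lemma an_defect a N : 4%:R - Re a <= N%:R -> exists2 M, 0 <= M &
  forall u, 1 <= u -> 4%:R * (1 + w) <= u -> an a 1 (M / u ^+ 4) (defect N u).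
Proof.
move=> hN.
have rem h j : 0 <= h -> h <= 1 + w -> exists2 M, 0 <= M & forall u, 1 <= u -> 4%:R * (1 + w) <= u ->
    (j <= N)%N -> an a 1 (M / u ^+ 4) (taylor_rem j N.+3 h u).
  move=> h0 hw; have [M M0 aM] := an_taylor_rem a j N.+3 h0.
  exists M => // u u1 uw jN; have u0 : 0 < u by lra.
  apply: an_le (aM u u1 _); last by apply: le_trans uw; lra.
  rewrite ler_wpM2l// -[X in X ^+ 4]lnK ?posrE// -expRM_natl -expRN ler_expR -mulNr.
  rewrite ler_wpM2r ?ln_ge0// natrB; last by lia.
  rewrite -natr1 -natr1 -natr1; lra.
have term j : exists2 M, 0 <= M & forall u, 1 <= u -> 4%:R * (1 + w) <= u ->
    (j <= N)%N -> an a 1 (M / u ^+ 4) (fun s => (b j)%:C%C *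
  (taylor_rem j N.+3 (1 + w) u s - taylor_rem j N.+3 w u s - taylor_rem j N.+3 1 u s
    + taylor_rem j N.+3 0 u s)).
  have w0' := ltW w0.
  have [||M1 M10 a1] := rem (1 + w) j; [lra|lra|].
  have [||M2 M20 a2] := rem w j; [lra|lra|].
  have [||M3 M30 a3] := rem 1 j; [lra|lra|].
  have [||M4 M40 a4] := rem 0 j; [lra|lra|].
  exists (cn (b j)%:C%C * (M1 + M2 + M3 + M4)).
    by rewrite mulr_ge0 ?cn_ge0// !addr_ge0.
  move=> u u1 uw jN; rewrite -mulrA !mulrDl; apply: anMl.
  apply: anD => //; last exact: a4.
  by do 2 (apply: anB => //; last by [exact: a3|exact: a2]); exact: a1.
have /(_ _)/cid2-/all_sig2 [M M0 aM] := term.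
exists (\sum_(j < N.+1) M j); first by apply: sumr_ge0 => j _.
move=> u u1 uw; apply: (eq_an (f := fun s => - \sum_(j < N.+1) (b j)%:C%C *
  (taylor_rem j N.+3 (1 + w) u s - taylor_rem j N.+3 w u s - taylor_rem j N.+3 1 u s
    + taylor_rem j N.+3 0 u s))) => [s _|]; first by rewrite defectE.
apply: anN; rewrite mulr_suml.
apply: (@an_sum _ a 1 _ _ predT (fun j : 'I_N.+1 => M j / u ^+ 4) (fun j s => (b j)%:C%C *
  (taylor_rem j N.+3 (1 + w) u s - taylor_rem j N.+3 w u s - taylor_rem j N.+3 1 u s
    + taylor_rem j N.+3 0 u s))) => // j _.
by apply: aM => //; rewrite -ltnS.
Qed.

Let pt (p q : nat) : R := z + p%:R * w + q%:R.

(* The double sums of [delta2] telescope to the four corners of the square; the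
   corner at [z] is left out here. *)
Definition zsum N n s : C :=
  (2 - s) * (1 - s) * \sum_(p < n) \sum_(q < n) cpow (pt p q) (- s) +
  \sum_(j < N.+1) (b j)%:C%C * (phi j (z + n%:R * w) s + phi j (z + n%:R) s
     - phi j (z + n%:R * w + n%:R) s).

Lemma phi2 u s : phi 2 u s = (2 - s) * (1 - s) * cpow u (- s).
Proof.
rewrite /phi /ffall !big_ord_recl big_ord0 /= /bump /= addn0 mulr1 subr0 subrr add0r.
by congr (_ * _ * _); ring.
Qed.

Lemma telescope2 (V : zmodType) (g : nat -> nat -> V) n :
  \sum_(p < n) \sum_(q < n) (g p.+1 q.+1 - g p.+1 q - g p q.+1 + g p q) =
  g n n - g n 0%N - g 0%N n + g 0%N 0%N.
Proof.
have tel (f : nat -> V) : \sum_(i < n) (f i.+1 - f i) = f n - f 0%N.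
  by rewrite -(big_mkord predT (fun i => f i.+1 - f i)) telescope_sumr.
transitivity (\sum_(p < n) ((g p.+1 n - g p.+1 0%N) - (g p n - g p 0%N))).
  apply: eq_bigr => p _; rewrite -!tel -sumrB; apply: eq_bigr => q _.
  by rewrite opprD opprK addrA.
by rewrite (tel (fun p => g p n - g p 0%N)) opprD opprK addrA.
Qed.

(** Of the four corners left by telescoping, three cancel the corrections in [zsum]; the one at [z]
    does not depend on n. *)
Lemma zsumE N n s : zsum N n s =
  \sum_(p < n) \sum_(q < n) defect N (pt p q) s + \sum_(j < N.+1) (b j)%:C%C * phi j z s.
Proof.
rewrite /zsum /defect.
have D j : \sum_(p < n) \sum_(q < n) delta2 j (pt p q) s =
   phi j (z + n%:R * w + n%:R) s - phi j (z + n%:R * w) s - phi j (z + n%:R) s + phi j z s.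
  have := telescope2 (fun p q => phi j (pt p q) s) n.
  rewrite /pt !mul0r !addr0 => <-; apply: eq_bigr => p _; apply: eq_bigr => q _.
  rewrite /delta2; congr (phi j _ s - phi j _ s - phi j _ s + phi j _ s);
    rewrite -?natr1; ring.
under [in RHS]eq_bigr do rewrite sumrB.
rewrite sumrB; set S := \sum_(p < n) \sum_(q < n) \sum_(j < N.+1) _.
have -> : S = \sum_(j < N.+1) (b j)%:C%C * (phi j (z + n%:R * w + n%:R) s
    - phi j (z + n%:R * w) s - phi j (z + n%:R) s + phi j z s).
  rewrite /S (eq_bigr _ (fun p _ => exchange_big _ _ _ _ _ _)) exchange_big.
  apply: eq_bigr => j _; rewrite -D mulr_sumr; apply: eq_bigr => p _.
  by rewrite mulr_sumr.
rewrite -[RHS]addrA -sumrN -big_split /=; congr (_ + _).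
  rewrite mulr_sumr; apply: eq_bigr => p _; rewrite mulr_sumr; apply: eq_bigr => q _.
  by rewrite phi2.
by apply: eq_bigr => j _; ring.
Qed.

Let c : R := Num.min 1 w.
Let c0 : 0 < c. Proof. by rewrite lt_min ltr01. Qed.

Lemma pt_ge p q n : ((n <= p) || (n <= q))%N -> c * n%:R <= pt p q.
Proof.
have hc1 : c <= 1 by rewrite ge_min lexx.
have hcw : c <= w by rewrite ge_min lexx orbT.
have z0' := ltW z0; have w0' := ltW w0.
have P : 0 <= p%:R * w :> R by rewrite mulr_ge0.
have Q : 0 <= q%:R :> R by [].
case/orP => h; rewrite /pt.
  apply: le_trans (_ : p%:R * w <= _); last lra.
  by rewrite mulrC; apply: ler_pM; rewrite ?ler_nat ?(ltW c0).
apply: le_trans (_ : q%:R <= _); last lra.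
by rewrite -[leRHS]mul1r; apply: ler_pM; rewrite ?ler_nat ?(ltW c0).
Qed.

Lemma zsumS N n s : zsum N n.+1 s - zsum N n s =
  \sum_(p < n) defect N (pt p n) s + \sum_(q < n.+1) defect N (pt n q) s.
Proof.
rewrite !zsumE opprD addrACA subrr addr0 big_ord_recr /=.
under eq_bigr do rewrite big_ord_recr /=.
by rewrite big_split /=; ring.
Qed.

Lemma an_zsum a N n : exists M, an a 1 M (zsum N n).
Proof.
have S2 : exists M, an a 1 M (fun s => \sum_(p < n) \sum_(q < n) cpow (pt p q) (- s)).
  eexists; apply: (an_sum (I := 'I_n)) => // p _; apply: (an_sum (I := 'I_n)) => // q _.
  apply: (eq_an (f := fun s => cpow (pt p q) (0 - s))) => [s _|]; first by rewrite sub0r.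
  exact: an_cpow.
have B j : exists M, an a 1 M (fun s => (b j)%:C%C * (phi j (z + n%:R * w) s +
   phi j (z + n%:R) s - phi j (z + n%:R * w + n%:R) s)).
  have [M1 a1] := an_phi a j (z + n%:R * w); have [M2 a2] := an_phi a j (z + n%:R).
  have [M3 a3] := an_phi a j (z + n%:R * w + n%:R).
  by eexists; apply: anMl; apply: anB => //; [apply: anD => //; [exact: a1|exact: a2]|exact: a3].
have [M2 a2] := S2; have {B} /(_ _)/cid-/all_sig [M aM] := B.
eexists; apply: anD => //; first apply: anM ltr01 _ a2.
  apply: anM => //; [apply: eq_an (an_lin a 2 (-1) ler01)|apply: eq_an (an_lin a 1 (-1) ler01)] => s _;
    by rewrite mulN1r.
by apply: (@an_sum _ a 1 _ _ predT (fun j : 'I_N.+1 => M j) (fun j s => _)) => // j _; exact: aM.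
Qed.

Lemma zsum_limit a N : 4%:R - Re a <= N%:R ->
  exists M g, an a 1 M g /\ forall s, cn (s - a) <= 1 -> cto (fun n => zsum N n s) (g s).
Proof.
move=> hN; have [M M0 aM] := an_defect hN.
pose U : R := (4%:R * (1 + w) + 1) / c.
have w0' := ltW w0.
have U0 : 0 < U by rewrite divr_gt0//; lra.
pose n0 := (Num.bound U).+1.
have hn0 n : (n0 <= n)%N -> 4%:R * (1 + w) + 1 <= c * n%:R.
  move=> h; rewrite [leRHS]mulrC -ler_pdivrMr//; apply: le_trans (ltW (archi_boundP (ltW U0))) _.
  by rewrite ler_nat ltnW.
have [L aL] := an_zsum a N n0.
(* The shell max(p, q) = n has 2 n + 1 points, each contributing at most M / (c n)^4. Since (2 n +
   1) (n + 1) <= 6 n^3 for n >= 1, this telescoping majorant dominates the shell. *)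
pose m k : R := 6%:R * M / c ^+ 4 * ((n0 + k)%:R^-1 - (n0 + k).+1%:R^-1).
have [||k|g [ag Fg]] := @an_lim _ a 1 L (6%:R * M / c ^+ 4) (fun k => zsum N (n0 + k)) m ltr01.
- by rewrite addn0.
- move=> k; rewrite addnS; pose n := (n0 + k)%N.
  have n1 : 1 <= n%:R :> R by rewrite ler1n.
  have n00 : (n0 <= n)%N by exact: leq_addr.
  have hc := hn0 n n00; have cn0 : 0 < c * n%:R by lra.
  apply: (eq_an (f := fun s => \sum_(p < n) defect N (pt p n) s + \sum_(q < n.+1) defect N (pt n q) s)).
    by move=> s _; rewrite -zsumS.
  have bd p q : ((n <= p) || (n <= q))%N -> an a 1 (M / (c * n%:R) ^+ 4) (defect N (pt p q)).
    move=> /pt_ge h; apply: an_le (aM (pt p q) _ _); [|lra|lra].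
    rewrite ler_wpM2l// lef_pV2 ?posrE ?exprn_gt0//; last by lra.
    rewrite lerXn2r// ?nnegrE; lra.
  apply: an_le (anD ler01
    (@an_sum _ a 1 _ _ predT (fun p : 'I_n => M / (c * n%:R) ^+ 4)
      (fun p s => defect N (pt p n) s) ler01 _)
    (@an_sum _ a 1 _ _ predT (fun q : 'I_n.+1 => M / (c * n%:R) ^+ 4)
      (fun q s => defect N (pt n q) s) ler01 _)).
  + have sumc i (x : R) : \sum_(j < i | predT j) x = x * i%:R.
      by rewrite sumr_const card_ord mulr_natr.
    rewrite !sumc -mulrDr /m -/n -natrD.
    have -> : n%:R^-1 - n.+1%:R^-1 = (n%:R * n.+1%:R)^-1 :> R.
      by rewrite -natr1; field; apply/andP; split; lra.
    have -> : 6%:R * M / c ^+ 4 * (n%:R * n.+1%:R)^-1 =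
        M / (c * n%:R) ^+ 4 * (6%:R * n%:R ^+ 3 / n.+1%:R) :> R.
      rewrite -natr1 exprMn; field.
      by rewrite (gt_eqF c0); do ?[apply/andP; split] => //; lra.
    rewrite ler_wpM2l ?divr_ge0 ?exprn_ge0 ?(ltW cn0)// ler_pdivlMr ?ltr0Sn//.
    rewrite natrD -natr1 !exprS expr0 mulr1; set y : R := n%:R in n1 *.
    nra.
  + by move=> p _; apply: bd; rewrite leqnn orbT.
  + by move=> q _; apply: bd; rewrite leqnn.
- rewrite -mulr_sumr -[leRHS]mulr1 ler_wpM2l ?divr_ge0 ?mulr_ge0 ?exprn_ge0 ?(ltW c0)//.
  have -> : \sum_(i < k) ((n0 + i)%:R^-1 - (n0 + i).+1%:R^-1) = n0%:R^-1 - (n0 + k)%:R^-1 :> R.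
    elim: k => [|k IH]; first by rewrite big_ord0 addn0 subrr.
    by rewrite big_ord_recr /= IH addnS addrA subrK.
  apply: le_trans (_ : n0%:R^-1 <= _); first by rewrite gerBl invr_ge0.
  by rewrite invf_le1 ?ltr0Sn// ler1n.
exists (L + 6%:R * M / c ^+ 4), g; split=> // s sa; apply: (cto_unshift (k := n0)).
by apply: (eq_cto (N := 0%N) _ (Fg s sa)) => n _; rewrite addnC.
Qed.

Lemma phi_cvg0 j s (u : nat -> R) : 2 - j%:R < Re s ->
  (forall n, 0 < u n) -> (forall n, c * n%:R <= u n) -> cto (fun n => phi j (u n) s) 0.
Proof.
move=> js u0 cu; pose d : R := Re s - (2 - j%:R); have d0 : 0 < d by rewrite subr_gt0.
suff : cto (fun n => cpow (u n) (2 - j%:R - s)) 0.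
  by move=> /(ctoMl (ffall j s)); rewrite mulr0.
move=> e e0; pose B := expR (- ln e / d); pose N := (Num.bound (B / c)).+1.
exists N => n Nn; rewrite subr0 cn_cpow.
have -> : Re (2 - j%:R - s) = - d.
  rewrite -(realc_nat R 2) -(realc_nat R j) -realcB /d; case: (s) => p q /=; ring.
rewrite -[ltRHS]lnK ?posrE// ltr_expR -ltrN2 mulNr opprK -ltr_pdivrMl// mulrC.
rewrite -ltr_expR lnK ?posrE//; apply: lt_le_trans (cu n).
rewrite -/B mulrC -ltr_pdivrMr//.
apply: lt_le_trans (archi_boundP _) _; first by rewrite divr_ge0 ?expR_ge0 ?(ltW c0).
by rewrite ler_nat ltnW.
Qed.

Lemma boundary_cvg0 j s : 2 - j%:R < Re s ->
  cto (fun n => (b j)%:C%C * (phi j (z + n%:R * w) s + phi j (z + n%:R) s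
     - phi j (z + n%:R * w + n%:R) s)) 0.
Proof.
move=> js; rewrite -[X in cto _ X](mulr0 (b j)%:C%C); apply: ctoMl.
have P n : z + n%:R * w = pt n 0 by rewrite /pt addr0.
have Q n : z + n%:R = pt 0 n by rewrite /pt mul0r addr0.
have pt0 p q : 0 < pt p q.
  by rewrite /pt -addrA ltr_wpDr// addr_ge0 ?mulr_ge0// ltW.
rewrite -[X in cto _ X](subrr 0) -[X in cto _ (X - _)](addr0 0).
apply: ctoB; first apply: ctoD.
- by apply: phi_cvg0 => // n; rewrite P ?pt0// pt_ge// leqnn.
- by apply: phi_cvg0 => // n; rewrite Q ?pt0// pt_ge// leqnn orbT.
- by apply: phi_cvg0 => // n; [exact: (pt0 n n)|apply: pt_ge; rewrite leqnn].
Qed.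

(** Passing from M to M + 1 adds only a boundary correction, which tends to 0 once 2 - (M + 1) < Re
    s. This allows the limits for different N to be glued. *)
Lemma zsum_indep N N' s l : (N <= N')%N -> 1 - N%:R < Re s ->
  cto (fun n => zsum N n s) l <-> cto (fun n => zsum N' n s) l.
Proof.
move=> /subnKC <-; elim: (N' - N)%N => [|k IH] Ns; first by rewrite addn0.
rewrite (IH Ns) addnS; set M := (N + k)%N.
have B : cto (fun n => (b M.+1)%:C%C * (phi M.+1 (z + n%:R * w) s + phi M.+1 (z + n%:R) s
     - phi M.+1 (z + n%:R * w + n%:R) s)) 0.
  apply: boundary_cvg0; have -> : M.+1%:R = N%:R + k%:R + 1 :> R by rewrite /M -natr1 natrD.
  have := ler0n R k; lra.
have E n : zsum M.+1 n s = zsum M n s + (b M.+1)%:C%C * (phi M.+1 (z + n%:R * w) s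
    + phi M.+1 (z + n%:R) s - phi M.+1 (z + n%:R * w + n%:R) s).
  by rewrite /zsum big_ord_recr /= addrA.
split=> h.
  by rewrite -[l]addr0; apply: (eq_cto (N := 0%N) _ (ctoD h B)) => n _; rewrite E.
by rewrite -[l]subr0; apply: (eq_cto (N := 0%N) _ (ctoB h B)) => n _; rewrite E addrK.
Qed.

Lemma zsum_entire : exists E : C -> C,
  (forall a, exists M, an a 1 M E) /\
  (forall s N, 4%:R - Re s <= N%:R -> cto (fun n => zsum N n s) (E s)).
Proof.
have bnd (t : R) : exists N : nat, t <= N%:R.
  by exists (Num.bound `|t|); apply: le_trans (ler_norm t) (ltW (archi_boundP _)).
have lim s : {l | forall N, 4%:R - Re s <= N%:R -> cto (fun n => zsum N n s) l}.
  apply: cid; have [N0 hN0] := bnd (4%:R - Re s).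
  have [_ [g [_ gP]]] := zsum_limit hN0.
  exists (g s) => N hN; have := gP s; rewrite subrr cn0 => /(_ ler01) h.
  have hM : forall N1, 4%:R - Re s <= N1%:R -> 1 - N1%:R < Re s by move=> N1; lra.
  apply: (proj2 (zsum_indep _ (leq_maxl N N0) (hM _ hN))).
  exact: (proj1 (zsum_indep _ (leq_maxr N N0) (hM _ hN0)) h).
exists (fun s => projT1 (lim s)); split; last by move=> s; exact: projT2 (lim s).
(* One more than the bound at the centre, since the disc of radius 1 reaches real part Re a - 1. *)
move=> a; have [N hN] := bnd (5%:R - Re a).
have [|M [g [ag gP]]] := @zsum_limit a N; first by lra.
exists M; apply: eq_an ag => s sa; apply: cto_unique (gP s sa) _.
apply: (projT2 (lim s)); have := le_trans (cn_Re (s - a)) sa.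
by case: (s) (a) hN => p q [p' q'] /=; rewrite ler_norml => ? /andP[]; lra.
Qed.

(** At s = 0 the functions [phi j] are the derivatives of u^2, and the summation formula is exact on
    quadratic polynomials. All defects vanish and the corner at [z] remains. *)
Lemma zsum_at0 N n : (3 <= N)%N ->
  zsum N n 0 = (b 0%N)%:C%C * z%:C%C ^+ 2 + (b 1%N)%:C%C * (2 * z%:C%C) + (b 2)%:C%C * 2.
Proof.
move=> N3; rewrite zsumE.
have ff3 j : (2 < j)%N -> ffall j 0 = 0 :> C.
  by move=> j3; rewrite /ffall (bigD1 (Ordinal j3)) //= subr0 subrr mul0r.
have ph j u : 0 < u -> phi j u 0 =
    match j with 0%N => u%:C%C ^+ 2 | 1%N => 2 * u%:C%C | 2 => 2 | _ => 0 end.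
  move=> u0; rewrite /phi; case: j => [|[|[|j]]].
  - by rewrite /ffall big_ord0 mul1r !subr0 cpow_nat// realcX.
  - rewrite /ffall big_ord_recr big_ord0 /= mul1r !subr0; congr (_ * _).
    by rewrite (_ : 2 - 1 = 1%:R) ?cpow_nat ?expr1//; ring.
  - rewrite /ffall !big_ord_recr big_ord0 /= mul1r !subr0 subrr cpow0; ring.
  - by rewrite ff3// mul0r.
have sum4 (F : nat -> C) : (forall j, (2 < j)%N -> F j = 0) ->
    \sum_(j < N.+1) F j = F 0%N + F 1%N + F 2.
  move=> F3; rewrite -(subnKC N3) -addn1 -!addnA big_split_ord /= !big_ord_recr big_ord0 /= add0r.
  by rewrite [X in _ + X]big1 ?addr0// => j _; rewrite F3//; lia.
have -> : \sum_(p < n) \sum_(q < n) defect N (pt p q) 0 = 0.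
  rewrite big1// => p _; rewrite big1// => q _.
  have : 0 < pt p q by rewrite /pt -addrA ltr_wpDr// addr_ge0 ?mulr_ge0// ltW.
  move: (pt p q) => u u0; have up h : 0 <= h -> 0 < u + h by move=> h0; rewrite ltr_wpDr.
  rewrite /defect (sum4 (fun j => (b j)%:C%C * delta2 j u 0)).
    have b0w : b 0%N * w = 1 by have := bP 0; rewrite big_ord_recl big_ord0 addr0 ecoef2.
    rewrite /delta2 !ph ?up ?addr_ge0 ?ler01 ?(ltW w0) ?lexx// addr0.
    have -> : (u + (1 + w))%:C%C ^+ 2 - (u + w)%:C%C ^+ 2 - (u + 1)%:C%C ^+ 2
        + u%:C%C ^+ 2 = (2 * w)%:C%C :> C.
      by rewrite -!realcX -!realcB -realcD; congr (_%:C%C); ring.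
    rewrite -realcM mulrCA b0w mulr1 realc_nat !realcD; ring.
  move=> j j3; rewrite /delta2 !ph ?up ?addr_ge0 ?ler01 ?(ltW w0) ?lexx//.
  by case: j j3 => [|[|[|j]]] // _; rewrite !subr0 addr0 mulr0.
rewrite add0r (sum4 (fun j => (b j)%:C%C * phi j z 0)) ?ph//.
by move=> j j3; rewrite ph//; case: j j3 => [|[|[|j]]] // _; rewrite mulr0.
Qed.

End DoubleZeta.

Section Continuation.
Variable R : realType.
Local Notation C := R[i].
Local Notation Re := (@complex.Re R).

(** The continuation is the entire limit of [zsum] divided by (s - 1) (s - 2); for Re s > 2 the
    corrections in [zsum] tend to 0. Its value at 0 is a double Bernoulli polynomial up to the
    constant [k], which depends on w only. *)
Theorem zeta2_exists (w : R) : 0 < w -> exists k : R, forall z, 0 < z ->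
  exists F : C -> C, [/\ forall a, mer F a, zeta2_continuation w z F
    & F 0 = ((z ^+ 2 - (1 + w) * z) / (2 * w) + k)%:C%C].
Proof.
move=> w0; have [b bP] := em_coef_exists w0.
have b0 : b 0%N = w^-1.
  have := bP 0%N; rewrite big_ord_recl big_ord0 addr0 ecoef2//= => h.
  by rewrite -[LHS](mulfK (lt0r_neq0 w0)) h mul1r.
have b1 : b 1%N = - (1 + w) / (2 * w).
  have := bP 1%N; rewrite !big_ord_recr big_ord0 /= add0r ecoef2// subn0 ecoef3 b0 => h.
  have -> : b 1%N = (b 1%N * w) / w by rewrite mulfK ?gt_eqF.
  have -> : b 1%N * w = - (w^-1 * (w * (1 + w) / 2)).
    by apply/eqP; rewrite -subr_eq0 opprK addrC; apply/eqP.
  by field; rewrite gt_eqF.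
exists (b 2) => z z0; have [E [aE Elim]] := zsum_entire w0 z0 bP.
pose F s := E s * (s - 1)^-1 * (s - 2)^-1.
have mF a : mer F a.
  have [M aM] := aE a.
  by apply: merM; [apply: merM|]; [exact: an_mer aM|exact: mer_inv|exact: mer_inv].
exists F; split=> //; last first.
  have E0 : E 0 = (b 0%N)%:C%C * z%:C%C ^+ 2 + (b 1%N)%:C%C * (2 * z%:C%C) + (b 2)%:C%C * 2.
    have h : 4%:R - Re 0 <= 4%:R by rewrite subr0.
    apply: cto_unique (Elim 0 4%N h) _.
    by apply: (eq_cto (N := 0%N) _ (cto_cst _)) => n _; rewrite zsum_at0.
  rewrite /F E0 !sub0r -realcX -(realc_nat R 2) -!realcM -!realcD.
  have -> : (- 1)^-1 = (-1)%:C%C :> C by rewrite invrN1 realcN.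
  rewrite -realcN -realcV -!realcM; congr (_%:C%C).
  by rewrite b0 b1; field; rewrite gt_eqF.
split.
- by move=> a; exact: mer_meromorphic.
- have h2 : 0 < 1 / 2 :> R by rewrite divr_gt0.
  have [M aM] := aE 0.
  have [|M1 a1] := @an_inv R 0 (1 / 2) 1 h2; first by rewrite subr0 cn1; lra.
  have [|M2 a2] := @an_inv R 0 (1 / 2) 2 h2; first by rewrite subr0 cn_nat; lra.
  apply: (an_holomorphic h2 (M := M * M1 * M2)); apply: anM => //; apply: anM => //.
  by apply: an_radius aM; lra.
move=> s s2; apply/cvg_ctoP.
have h : 4%:R - Re s <= 3%:R by lra.
have Es := Elim s 3%N h.
have B : cto (fun n => \sum_(j < 4) (b j)%:C%C * (phi j (z + n%:R * w) s + phi j (z + n%:R) s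
     - phi j (z + n%:R * w + n%:R) s)) 0.
  rewrite -[X in cto _ X](@big1 _ 0 +%R _ (index_enum 'I_4) predT (fun=> 0))//.
  apply: (@cto_sum _ 'I_4 _ (fun j n => (b j)%:C%C * (phi j (z + n%:R * w) s + phi j (z + n%:R) s
     - phi j (z + n%:R * w + n%:R) s)) (fun=> 0)) => j.
  by apply: boundary_cvg0 => //; have := ler0n R j; lra.
have sne (t : R) : t <= 2 -> s - t%:C%C != 0.
  move=> t2; apply/eqP => /eqP; rewrite subr_eq0 => /eqP st.
  by move: s2; rewrite st /= ltNge t2.
have s20 : s - 2 != 0 by rewrite -(realc_nat R 2) sne.
have s10 : s - 1 != 0 by rewrite (sne 1)//; lra.
have -> : F s = ((s - 1) * (s - 2))^-1 * (E s - 0).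
  by rewrite /F subr0; field; rewrite s10 s20.
apply: (eq_cto (N := 0%N) _ (ctoMl ((s - 1) * (s - 2))^-1 (ctoB Es B))) => n _.
rewrite /zsum addrK.
have -> : (2 - s) * (1 - s) = (s - 1) * (s - 2) :> C by ring.
rewrite mulrA mulVf ?mul1r ?mulf_neq0//.
by apply: eq_bigr => p _; apply: eq_bigr => q _; rewrite cpowerE.
Qed.

End Continuation.

(** * Zeta-regularized sums *)

Section RegularizedSums.
Variable R : realType.
Local Notation C := R[i].
Local Notation Re := (@complex.Re R).

(** Unordered sums can be reindexed and split freely. For nonnegative terms they agree with the
    limit over squares, since every finite set of indices lies in a square. *)
Lemma esum_square (a : nat * nat -> R) (v : R) : (forall x, 0 <= a x) ->
  (\sum_(p < n) \sum_(q < n) a (nat_of_ord p, nat_of_ord q)) @[n --> \oo] --> v ->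
  (\esum_(x in [set: nat * nat]) (a x)%:E)%E = v%:E.
Proof.
move=> a0 av; pose sq n := [seq (p, q) | p <- iota 0 n, q <- iota 0 n].
pose S n : R := \sum_(p < n) \sum_(q < n) a (nat_of_ord p, nat_of_ord q).
have SE n : (\sum_(x \in [set` sq n]) (a x)%:E)%E = (S n)%:E.
  rewrite -fsbig_seq; last first.
    by apply: allpairs_uniq; rewrite ?iota_uniq// => -[? ?] [? ?].
  rewrite sumEFin big_allpairs_dep; congr (_%:E).
  by rewrite -[n in iota 0 n]subn0 big_mkord; apply: eq_bigr => p _; rewrite big_mkord.
have nd : nondecreasing_seq S.
  apply/nondecreasing_seqP => n; rewrite /S big_ord_recr /=.
  rewrite -[leLHS]addr0 lerD//; last by apply: sumr_ge0.
  by apply: ler_sum => p _; rewrite big_ord_recr /= lerDl.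
have Sv n : S n <= v.
  by have := nondecreasing_cvgn_le nd (cvgP _ av) n; rewrite (cvg_lim _ av).
apply/eqP; rewrite eq_le; apply/andP; split.
  apply: ge_ereal_sup => _ [X [finX _] <-].
  have [s Xs] := (finite_seqP _).1 finX.
  pose N := (\max_(x <- s) (x.1 + x.2)).+1.
  apply: le_trans (_ : ((S N)%:E <= _)%E); last by rewrite lee_fin.
  rewrite -SE; apply: lee_fsum_nneg_subset => //.
  - by apply/finite_seqP; exists (sq N).
  - case=> p q; rewrite !inE Xs /= => pqs.
    have h : (p + q < N)%N.
      by rewrite ltnS; exact: (@leq_bigmax_seq _ s predT (fun x => x.1 + x.2)%N (p, q) pqs).
    move: (N) h => n h; apply/allpairsP; exists (p, q).
    by rewrite !mem_iota /=; split=> //; lia.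
  - by move=> x _; rewrite lee_fin.
apply/lee_addgt0Pr => e e0.
have /cvgrPdist_lt/(_ _ e0) [N _ /(_ N (leqnn _)) /=] := av.
rewrite -/(S N) ger0_norm ?subr_ge0// => h.
apply: le_trans (_ : ((S N)%:E + e%:E <= _)%E).
  by rewrite -EFinD lee_fin; lra.
rewrite leeD2r//; apply: esum_ge; exists [set` sq N].
  by split=> //; apply/finite_seqP; exists (sq N).
by rewrite SE.
Qed.

Lemma esum_setU (T : choiceType) (P Q : set T) (f : T -> \bar R) : P `&` Q = set0 ->
  (forall i, (0 <= f i)%E) ->
  (\esum_(i in P `|` Q) f i = \esum_(i in P) f i + \esum_(i in Q) f i)%E.
Proof.
move=> PQ f0; rewrite (esumID P) => [|i _]; last exact: f0.
have -> : (P `|` Q) `&` P = P by apply/seteqP; split=> x /=; tauto.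
have -> // : (P `|` Q) `&` ~` P = Q.
apply/seteqP; split=> x /=; first tauto.
by move=> Qx; split; [right|move=> Px; have : (P `&` Q) x by []; rewrite PQ].
Qed.

Lemma esumZ_le (T : choiceType) (P : set T) (k : R) (f : T -> \bar R) : 0 <= k ->
  (forall i, (0 <= f i)%E) ->
  (\esum_(i in P) (k%:E * f i) <= k%:E * \esum_(i in P) f i)%E.
Proof.
move=> k0 f0; apply: ge_ereal_sup => _ [X [finX XP] <-].
rewrite -ge0_mule_fsumr; last by move=> i; exact: f0.
by apply: lee_wpmul2l; [rewrite lee_fin|apply: esum_ge; exists X].
Qed.

Lemma esumZ (T : choiceType) (P : set T) (k : R) (f : T -> \bar R) : 0 < k ->
  (forall i, (0 <= f i)%E) ->
  (\esum_(i in P) (k%:E * f i) = k%:E * \esum_(i in P) f i)%E.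
Proof.
move=> k0 f0; apply/eqP; rewrite eq_le; apply/andP; split.
  by apply: esumZ_le => //; exact: ltW.
have kV : (k%:E * k^-1%:E = 1 :> \bar R)%E by rewrite -EFinM divff ?gt_eqF.
rewrite [leLHS](_ : _ = k%:E * \esum_(i in P) (k^-1%:E * (k%:E * f i)))%E; last first.
  by congr (_ * _)%E; apply: eq_esum => i _; rewrite muleA [(k^-1%:E * _)%E]muleC kV mul1e.
rewrite -[leRHS]mul1e -kV -muleA; apply: lee_wpmul2l; first by rewrite lee_fin ltW.
apply: esumZ_le; first by rewrite invr_ge0 ltW.
by move=> i; apply: mule_ge0 => //; rewrite lee_fin ltW.
Qed.

Definition dterm (x s : R) : R := expR (- s * ln x).

Lemma dterm_ge0 x s : (0 <= (dterm x s)%:E)%E.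
Proof. by rewrite lee_fin expR_ge0. Qed.

(* Value and derivative at 0 of the meromorphic continuation of
   s |-> \sum_(i in P) (g i)^(-s). *)
Definition reg (T : choiceType) (g : T -> R) (P : set T) (a b : R) := exists F x,
  [/\ forall s, mer F s, lin F a%:C%C x, Re x = b
    & forall s : R, 2 < s -> exists2 v : R, F s%:C%C = v%:C%C &
      (\esum_(i in P) (dterm (g i) s)%:E)%E = v%:E].

Section OneIndexType.
Variable T : choiceType.
Implicit Types (g : T -> R) (P Q : set T) (a b : R).

(** Two continuations agree on the half-line s > 2, where both are the sum; [mer_identity] carries
    this to a punctured neighbourhood of 0. *)
Lemma reg_unique g P a b a' b' :
  reg g P a b -> reg g P a' b' -> a = a' /\ b = b'.
Proof.
move=> [F [x1 [mF lF <- FE]]] [G [y1 [mG lG <- GE]]].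
have [||e e0 H] := @mer_identity R (fun s => F s - G s).
- by move=> s; exact: merB.
- move=> t t2; have [v -> Ev] := FE t t2; have [v' -> Ev'] := GE t t2.
  by move: Ev; rewrite Ev' => -[->]; rewrite subrr.
have [|/complexI -> ->//] := lin_unique lF lG e0.
by move=> s /H /eqP; rewrite subr_eq0 => /eqP.
Qed.

Lemma regU g P Q a b a' b' : P `&` Q = set0 ->
  reg g P a b -> reg g Q a' b' -> reg g (P `|` Q) (a + a') (b + b').
Proof.
move=> PQ [F [x1 [mF lF <- FE]]] [G [y1 [mG lG <- GE]]].
exists (fun s => F s + G s), (x1 + y1); split=> //.
- by move=> s; exact: merD.
- by rewrite realcD; exact: linD.
- by case: (x1) (y1) => ? ? [].
move=> s s2; have [v -> Ev] := FE s s2; have [v' -> Ev'] := GE s s2.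
exists (v + v'); first by rewrite realcD.
by rewrite EFinD -Ev -Ev' esum_setU// => i; exact: dterm_ge0.
Qed.

Lemma lin_cst a : lin (fun=> a%:C%C) a%:C%C (0 : C).
Proof.
exists 0, 1; split=> // s _.
by rewrite mul0r subrr sub0r cnN mul0r cn0.
Qed.

Lemma linZ (t : R) F (x y : C) : lin F x y -> lin (fun s => t%:C%C * F s) (t%:C%C * x) (t%:C%C * y).
Proof.
move=> lF; have := linM (lin_cst t) lF.
by rewrite mul0r addr0.
Qed.

Lemma regD g P Q a b a' b' : Q `<=` P ->
  reg g P a b -> reg g Q a' b' -> reg g (P `\` Q) (a - a') (b - b').
Proof.
move=> QP [F [x1 [mF lF <- FE]]] [G [y1 [mG lG <- GE]]].
exists (fun s => F s + (-1)%:C%C * G s), (x1 + (-1)%:C%C * y1); split=> //.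
- by move=> s; apply: merD => //; exact: merMl.
- have -> : (a - a')%:C%C = a%:C%C + (-1)%:C%C * a'%:C%C :> C.
    by rewrite -realcM mulN1r realcD.
  by apply: linD => //; exact: linZ.
- by case: (x1) (y1) => ? ? [? ?] /=; rewrite mul0r subr0 mulN1r.
move=> s s2; have [v -> Ev] := FE s s2; have [v' -> Ev'] := GE s s2.
exists (v - v'); first by rewrite realcN mulN1r realcB.
have E : (\esum_(i in P) (dterm (g i) s)%:E =
   \esum_(i in P `\` Q) (dterm (g i) s)%:E + \esum_(i in Q) (dterm (g i) s)%:E)%E.
  rewrite -esum_setU; [|by rewrite setDE -setIA setICl setI0|by move=> i; exact: dterm_ge0].
  congr esum; apply/seteqP; split=> x /=; have := QP x; have := pselect (Q x); tauto.
by move: E; rewrite Ev Ev' EFinB => ->; rewrite addeK.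
Qed.

Lemma reg0 g : reg g set0 0 0.
Proof.
exists (fun=> 0), 0; split=> //; [by move=> s; exact: mer_cst|exact: lin_cst|].
by move=> s _; exists 0 => //; rewrite esum_set0.
Qed.

End OneIndexType.

(** Scaling the terms by c multiplies the continuation by c^(-s) = 1 - s ln c + ..., so the value
    stays and the derivative changes by -ln c times the value. *)
Lemma reg_reindex (T T' : choiceType) (g : T -> R) (g' : T' -> R) (P : set T)
    (Q : set T') (f : T -> T') (c a b : R) : 0 < c -> set_bij P Q f ->
  (forall i, P i -> 0 < g i) -> (forall i, P i -> g' (f i) = c * g i) ->
  reg g P a b -> reg g' Q a (b - ln c * a).
Proof.
move=> c0 PQ g0 gE [F [x1 [mF lF <- FE]]].
exists (fun s => F s * cpow c (- s)), (a%:C%C * - (ln c)%:C%C + x1 * 1); split=> //.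
- by move=> s; apply: merM => //; exact: mer_cpow.
- by have := linM lF (lin_cpow c); rewrite mulr1.
- rewrite -realcN -realcM mulr1; case: (x1) => p q /=; ring.
move=> s s2; have [v -> Ev] := FE s s2.
exists (v * expR (- s * ln c)); first by rewrite realcM -realcN cpow_real.
rewrite (@reindex_esum R T T' P Q f _ PQ).
rewrite (eq_esum (b := fun i => ((expR (- s * ln c))%:E * (dterm (g i) s)%:E)%E)); last first.
  move=> i Pi; rewrite gE// /dterm lnM ?posrE ?g0// mulrDr expRD.
  by rewrite EFinM.
rewrite (esumZ _ (expR_gt0 _) (f := fun i => (dterm (g i) s)%:E)).
  by rewrite Ev EFinM muleC.
by move=> i; exact: dterm_ge0.
Qed.

(* The constant [k] is irrelevant: only differences of values occur. *)
Lemma reg_lattice (w : R) : 0 < w -> exists k, forall z, 0 < z ->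
  reg (fun pq : nat * nat => z + pq.1%:R * w + pq.2%:R) setT
    ((z ^+ 2 - (1 + w) * z) / (2 * w) + k) (dzeta2_at0 w z).
Proof.
move=> w0; have [k H] := zeta2_exists w0; exists k => z z0.
have [F [mF zF F0]] := H z z0.
(* Existence makes the selected [zeta2] a continuation. Its value at 0 is known only for [F] and is
   transferred by uniqueness. *)
have zZ : zeta2_continuation w z (zeta2 w z).
  by apply: (@xgetPex _ (fun=> 0) [set F | zeta2_continuation w z F]); exists F.
have [mZ hZ sZ] := zZ; have [_ hF sF] := zF.
have [u [r [M [r0 uZ]]]] := holomorphic_an hZ.
have [u' [r' [M' [r'0 uF]]]] := holomorphic_an hF.
have lZ := lin_expansion r0 uZ; have lF := lin_expansion r'0 uF.
have mZ' s : mer (zeta2 w z) s by exact: meromorphic_mer.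
have [||e e0 HZ] := @mer_identity R (fun s => zeta2 w z s - F s).
- by move=> s; exact: merB.
- move=> t t2; have h2 : 2 < Re t%:C%C by [].
  have /cvg_ctoP c1 := sZ _ h2; have /cvg_ctoP c2 := sF _ h2.
  by rewrite (cto_unique c1 c2) subrr.
have [|E0 E1] := lin_unique lZ lF e0.
  by move=> s /HZ /eqP; rewrite subr_eq0 => /eqP.
have uE : u 0%N = ((z ^+ 2 - (1 + w) * z) / (2 * w) + k)%:C%C.
  by rewrite E0 -(lin_at0 lF).
exists (zeta2 w z), (u 1%N); split=> //.
- by rewrite -uE.
- by rewrite /dzeta2_at0 (lin_derive1 lZ).
move=> s s2; have h2 : 2 < Re s%:C%C by [].
have pt0 p q : 0 < z + p%:R * w + q%:R.
  by rewrite -addrA ltr_wpDr// addr_ge0 ?mulr_ge0// ltW.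
have /cvg_ctoP := sZ _ h2; set x := zeta2 w z _.
pose S n : R := \sum_(p < n) \sum_(q < n) dterm (z + p%:R * w + q%:R) s.
move=> Sx; have {}Sx : cto (fun n => (S n)%:C%C) x.
  apply: (eq_cto (N := 0%N) _ Sx) => n _; rewrite /S realc_sum.
  apply: eq_bigr => p _; rewrite realc_sum; apply: eq_bigr => q _.
  by rewrite cpowerE -realcN cpow_real.
have xE : x = (Re x)%:C%C.
  apply: (cto_unique Sx) => e1 e10; have [N HN] := Sx _ e10; exists N => n /HN h.
  rewrite -realcB cn_real; apply: le_lt_trans h; apply: le_trans (cn_Re _).
  by case: (x).
exists (Re x) => //; rewrite (_ : (fun i => _) = (fun i => (dterm (z + i.1%:R * w + i.2%:R) s)%:E))//.
apply: (@esum_square (fun i => dterm (z + i.1%:R * w + i.2%:R) s)) => [i|].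
  exact: expR_ge0.
apply/cvgrPdist_lt => e1 e10; have [N HN] := Sx _ e10; exists N => // n /HN.
by rewrite xE -realcB cn_real distrC.
Qed.

End RegularizedSums.

(** * Lattice cosets in plane sectors *)

Section Sectors.
Variables (R : realType) (K : realQuadratic R).
Implicit Types (x y z u v : K) (L : set K).

Lemma emb1_inj : injective (@emb1 R K).
Proof. exact: fmorph_inj. Qed.

Lemma emb1_neq0 x : 0 < emb1 x -> x != 0.
Proof. by move=> h; apply/eqP => E; rewrite E /emb1 rmorph0 ltxx in h. Qed.

Lemma emb1_1 : emb1 (1 : K) = 1.
Proof. exact: rmorph1. Qed.
Lemma emb2_1 : emb2 (1 : K) = 1.
Proof. exact: (rmorph1 (qemb K \o qconj K)). Qed.
Lemma emb1M x y : emb1 (x * y) = emb1 x * emb1 y.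
Proof. exact: rmorphM. Qed.
Lemma emb2M x y : emb2 (x * y) = emb2 x * emb2 y.
Proof. by rewrite /emb2 !rmorphM. Qed.
Lemma emb1V x : emb1 x^-1 = (emb1 x)^-1.
Proof. exact: fmorphV. Qed.
Lemma emb2V x : emb2 x^-1 = (emb2 x)^-1.
Proof. by rewrite /emb2 !fmorphV. Qed.
Lemma emb1X x n : emb1 (x ^+ n) = emb1 x ^+ n.
Proof. exact: rmorphXn. Qed.
Lemma emb2X x n : emb2 (x ^+ n) = emb2 x ^+ n.
Proof. by rewrite /emb2 !rmorphXn. Qed.

Lemma totally_positiveM x y : totally_positive x -> totally_positive y -> totally_positive (x * y).
Proof. by move=> [a b] [c d]; rewrite /totally_positive emb1M emb2M !mulr_gt0. Qed.
Lemma totally_positiveV x : totally_positive x -> totally_positive x^-1.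
Proof. by move=> [a b]; rewrite /totally_positive emb1V emb2V !invr_gt0. Qed.

(** Signed area in the plane with coordinates [emb1] and [emb2]; its sign orders the rays. *)
Definition det u v : R := emb1 u * emb2 v - emb2 u * emb1 v.

Lemma emb1Z (p : rat) x : emb1 (p *: x) = ratr p * emb1 x.
Proof. by rewrite -mulr_algl /emb1 rmorphM /= alg_num_field fmorph_rat. Qed.

Lemma emb2Z (p : rat) x : emb2 (p *: x) = ratr p * emb2 x.
Proof. by rewrite -mulr_algl /emb2 !rmorphM /= alg_num_field !fmorph_rat. Qed.

Lemma rmorphZ_rat (sg : {rmorphism K -> R}) (p : rat) x : sg (p *: x) = ratr p * sg x.
Proof. by rewrite -mulr_algl rmorphM /= alg_num_field fmorph_rat. Qed.

Lemma det_combl (p q : rat) u v x : det (p *: u + q *: v) x = ratr p * det u x + ratr q * det v x.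
Proof.
have E1 : emb1 (p *: u + q *: v) = emb1 (p *: u) + emb1 (q *: v) by exact: rmorphD.
have E2 : emb2 (p *: u + q *: v) = emb2 (p *: u) + emb2 (q *: v) by rewrite /emb2 !rmorphD.
rewrite /det E1 E2 !emb1Z !emb2Z; ring.
Qed.

Lemma detC u v : det u v = - det v u.
Proof. rewrite /det; ring. Qed.

Lemma detxx u : det u u = 0.
Proof. rewrite /det; ring. Qed.

Lemma detM e u v : det (e * u) (e * v) = emb1 e * emb2 e * det u v.
Proof. rewrite /det !emb1M !emb2M; ring. Qed.

Lemma det_mul e u : det u (e * u) = emb1 u * emb2 u * (emb2 e - emb1 e).
Proof. rewrite /det !emb1M !emb2M; ring. Qed.

Lemma coord_uniq u v (p q p' q' : rat) : det u v != 0 ->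
  p *: u + q *: v = p' *: u + q' *: v -> p = p' /\ q = q'.
Proof.
move=> uv E.
have h1 : ratr p * det u v = ratr p' * det u v :> R.
  by have := congr1 (det^~ v) E; rewrite !det_combl detxx !mulr0 !addr0.
have h2 : ratr q * det v u = ratr q' * det v u :> R.
  by have := congr1 (det^~ u) E; rewrite !det_combl detxx !mulr0 !add0r.
have vu : det v u != 0 by rewrite detC oppr_eq0.
by split; apply: (fmorph_inj (@ratr R)); [exact: mulIf uv _ _ h1|exact: mulIf vu _ _ h2].
Qed.

Lemma coordP u v x : det u v != 0 -> exists p q : rat, x = p *: u + q *: v.
Proof.
move=> uv; have fr : free [:: u; v].
  apply/freeP => c; rewrite !big_ord_recr big_ord0 /= add0r => E.
  have := @coord_uniq u v (c ord0) (c ord_max) 0 0 uv.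
  rewrite !scale0r addr0 => /(_ _)[|c0 c1].
    by rewrite -E; congr (c _ *: _ + c _ *: _); exact: val_inj.
  by case=> -[|[|]] // i; [rewrite -c0|rewrite -c1]; congr c; exact: val_inj.
have : basis_of {:K} [:: u; v].
  by rewrite basisEfree fr subvf/= qfield_dim.
move=> /span_basis/(congr1 (fun V : {vspace K} => x \in V)); rewrite memvf.
rewrite span_cons span_seq1 => /memv_addP[_ /vlineP[p ->] [_ /vlineP[q ->] ->]].
by exists p, q.
Qed.

(** The products of determinants make the criterion independent of the orientation of (u, v). *)
Lemma between u v x : 0 < det x v * det u v -> 0 < det u x * det u v ->
  exists p q : rat, [/\ 0 < p, 0 < q & x = p *: u + q *: v].
Proof.
move=> xv ux; have uv : det u v != 0.
  by apply/eqP => E; rewrite E mulr0 ltxx in xv.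
have uv2 : 0 < det u v * det u v by rewrite -expr2 exprn_even_gt0.
have [p [q E]] := coordP x uv; exists p, q.
have vx : det x v = ratr p * det u v by rewrite E det_combl detxx mulr0 addr0.
have xu : det u x = ratr q * det u v.
  by rewrite detC E det_combl detxx mulr0 add0r detC mulrN opprK.
by rewrite vx -mulrA pmulr_lgt0// ltr0q in xv; rewrite xu -mulrA pmulr_lgt0// ltr0q in ux.
Qed.

(** Only points of [K] matter, so rational coordinates suffice. This cone keeps the ray of [u];
    [secR] keeps that of [v]. *)
Definition secL u v : set K :=
  [set x | exists p q : rat, [/\ 0 < p, 0 <= q & x = p *: u + q *: v]].
Definition secR u v : set K :=
  [set x | exists p q : rat, [/\ 0 <= p, 0 < q & x = p *: u + q *: v]].
Definition ray u : set K := [set x | exists2 p : rat, 0 < p & x = p *: u].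

Lemma secLR u v : secL u v = secR v u.
Proof.
by apply/seteqP; split=> x [p [q [p0 q0 ->]]]; exists q, p; split; rewrite // addrC.
Qed.

Definition coset L z : set K := [set x | L (x - z)].

Lemma zspanB u v x y : zspan u v x -> zspan u v y -> zspan u v (x - y).
Proof.
move=> [m [n ->]] [m' [n' ->]]; exists (m - m'), (n - n').
by rewrite !rmorphB /=; ring.
Qed.

Lemma zspan0 u v : zspan u v 0.
Proof. by exists 0, 0; rewrite !mul0r addr0. Qed.

Lemma zspanN u v x : zspan u v x -> zspan u v (- x).
Proof. by move=> h; rewrite -sub0r; apply: zspanB => //; exact: zspan0. Qed.

Lemma zspanD u v x y : zspan u v x -> zspan u v y -> zspan u v (x + y).
Proof. by move=> hx hy; rewrite -[y]opprK; apply: zspanB => //; exact: zspanN. Qed.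

Lemma zspanZ u v x (m : int) : zspan u v x -> zspan u v (m%:~R * x).
Proof. by move=> [k [l ->]]; exists (m * k), (m * l); rewrite !intrM; ring. Qed.

Lemma zspanl u v : zspan u v u.
Proof. by exists 1, 0; rewrite mul1r mul0r addr0. Qed.

Lemma zspanr u v : zspan u v v.
Proof. by exists 0, 1; rewrite mul1r mul0r add0r. Qed.

Lemma zspan_sub u v u' v' : zspan u v u' -> zspan u v v' -> zspan u' v' `<=` zspan u v.
Proof. by move=> hu hv x [m [n ->]]; apply: zspanD; exact: zspanZ. Qed.

Lemma zspanC u v : zspan u v = zspan v u.
Proof. by apply/seteqP; split=> x [p [q ->]]; exists q, p; rewrite addrC. Qed.

Lemma zspanM u v c x : zspan u v x -> zspan (c * u) (c * v) (c * x).
Proof. by move=> [p [q ->]]; exists p, q; ring. Qed.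

Lemma intr_scale (m : int) x : m%:~R * x = (m%:~R : rat) *: x.
Proof. by rewrite -mulr_algl scaler_int. Qed.

Lemma natr_scale (m : nat) x : m%:R * x = (m%:R : rat) *: x.
Proof. by rewrite scaler_nat mulr_natl. Qed.

Variable sg : {rmorphism K -> R}.

Definition bval (w z : R) := (z ^+ 2 - (1 + w) * z) / (2 * w).
Definition log_sine (w z : R) := dzeta2_at0 w (1 + w - z) - dzeta2_at0 w z.

Definition cone (a u v : K) : set K := [set x | exists m n : nat, x = a + m%:R * u + n%:R * v].

Lemma reg_cone u v : det u v != 0 -> 0 < sg u -> 0 < sg v -> exists k, forall a, 0 < sg a ->
  let B := bval (sg u / sg v) (sg a / sg v) + k in
  reg sg (cone a u v) B (dzeta2_at0 (sg u / sg v) (sg a / sg v) - ln (sg v) * B).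
Proof.
move=> uv u0 v0; have w0 : 0 < sg u / sg v by rewrite divr_gt0.
have [k H] := reg_lattice w0; exists k => a a0 B.
have z0 : 0 < sg a / sg v by rewrite divr_gt0.
apply: (reg_reindex (f := fun pq : nat * nat => a + pq.1%:R * u + pq.2%:R * v) v0 _ _ _ (H _ z0)).
- split.
  + by move=> [m n] _; exists m, n.
  + move=> [m n] [m' n'] _ _ /=; rewrite -!addrA => /addrI.
    rewrite !natr_scale => /(coord_uniq uv)[/eqP E1 /eqP E2].
    by rewrite !eqr_nat in E1 E2; rewrite (eqP E1) (eqP E2).
  + by move=> x [m [n ->]]; exists (m, n).
- by move=> [m n] _ /=; rewrite -addrA ltr_wpDr// addr_ge0// mulr_ge0// ltW.
- move=> [m n] _ /=; rewrite !rmorphD !rmorphM /= !rmorph_nat; field.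
  by rewrite gt_eqF.
Qed.

(* The two sums have the same value at 0, so that the difference of their
   derivatives is unchanged by a positive scaling of [sg]. *)
Definition reg2 (P Q : set K) (c : R) :=
  exists a b b' : R, [/\ reg sg P a b, reg sg Q a b' & c = b' - b].

Lemma reg2_unique P Q (c c' : R) : reg2 P Q c -> reg2 P Q c' -> c = c'.
Proof.
move=> [a1 [b1 [d1 [h1 h2 ->]]]] [a2 [b2 [d2 [h3 h4 ->]]]].
by have [_ ->] := reg_unique h1 h3; have [_ ->] := reg_unique h2 h4.
Qed.

Lemma reg2U P Q P' Q' (c c' : R) : P `&` P' = set0 -> Q `&` Q' = set0 ->
  reg2 P Q c -> reg2 P' Q' c' -> reg2 (P `|` P') (Q `|` Q') (c + c').
Proof.
move=> PP QQ [a1 [b1 [d1 [h1 h2 ->]]]] [a2 [b2 [d2 [h3 h4 ->]]]].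
exists (a1 + a2), (b1 + b2), (d1 + d2); split; [exact: regU|exact: regU|ring].
Qed.

Lemma reg2_sym P Q (c : R) : reg2 P Q c -> reg2 Q P (- c).
Proof. by move=> [a [b [b' [h1 h2 ->]]]]; exists a, b', b; split=> //; rewrite opprB. Qed.

Definition scale_set (e : K) (P : set K) : set K := [set e * x | x in P].

Lemma reg_scale e P a b : 0 < sg e -> (forall x, P x -> 0 < sg x) ->
  reg sg P a b -> reg sg (scale_set e P) a (b - ln (sg e) * a).
Proof.
move=> e0 P0; apply: (reg_reindex (f := fun x => e * x) e0) => //.
  split.
  - by move=> x Px; exists x.
  - move=> x y _ _; apply: mulfI; apply/eqP => E; by rewrite E rmorph0 ltxx in e0.
  - by move=> _ [x Px <-]; exists x.
by move=> x _; rewrite rmorphM.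
Qed.

Lemma reg2_scale e P Q (c : R) : 0 < sg e -> (forall x, P x -> 0 < sg x) ->
  (forall x, Q x -> 0 < sg x) -> reg2 P Q c -> reg2 (scale_set e P) (scale_set e Q) c.
Proof.
move=> e0 P0 Q0 [a [b [b' [h1 h2 ->]]]].
exists a, (b - ln (sg e) * a), (b' - ln (sg e) * a).
by split; [exact: reg_scale|exact: reg_scale|ring].
Qed.

Lemma int_ge0 (m : int) : (-1 < m%:~R :> rat) -> exists n : nat, m = n.
Proof.
rewrite -[-1]/((-1)%:~R) ltr_int => h; exists `|m|%N; lia.
Qed.

Lemma zspan_coord u v x : zspan u v x <-> exists m n : int, x = m%:~R *: u + n%:~R *: v.
Proof.
by split=> -[m [n ->]]; exists m, n; rewrite !intr_scale.
Qed.

(** The half-open ranges fit the half-open cone: p <= 1 and p + m > 0 force the integer m to be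
    nonnegative, as do q < 1 and q + n >= 0 for n. *)
Lemma cell_secL u v (p q : rat) : det u v != 0 -> 0 < p <= 1 -> 0 <= q < 1 ->
  coset (zspan u v) (p *: u + q *: v) `&` secL u v = cone (p *: u + q *: v) u v.
Proof.
move=> uv /andP[p0 p1] /andP[q0 q1]; apply/seteqP; split=> x /=.
  move=> [/zspan_coord[m [n E]] [p' [q' [p'0 q'0 xE]]]].
  have : x = (p + m%:~R) *: u + (q + n%:~R) *: v.
    by rewrite !scalerDl addrACA -E addrC subrK.
  rewrite {1}xE => /(coord_uniq uv)[pE qE]; rewrite pE in p'0; rewrite qE in q'0.
  have [|m' mE] := @int_ge0 m; first lra.
  have [|n' nE] := @int_ge0 n; first lra.
  exists m', n'; rewrite !natr_scale -addrA; move/eqP: E; rewrite subr_eq => /eqP ->.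
  by rewrite mE nE addrC.
move=> [m [n ->]]; split.
  apply/zspan_coord; exists m, n; set a := p *: u + q *: v.
  have -> : a + m%:R * u + n%:R * v - a = m%:R * u + n%:R * v by ring.
  by rewrite !natr_scale.
exists (p + m%:R), (q + n%:R); split; [exact: ltr_wpDr|exact: addr_ge0|].
by rewrite !scalerDl !natr_scale addrACA addrA.
Qed.

(** Reflection replaces (p, q) by (1 - p, 1 - q), which exchanges the two kinds of range and hence
    the two cones. It corresponds to the argument 1 + w - z of the double sine. *)
Lemma cell_secR u v (p q : rat) : det u v != 0 -> 0 < p <= 1 -> 0 <= q < 1 ->
  coset (zspan u v) (- (p *: u + q *: v)) `&` secR u v =
    cone (u + v - (p *: u + q *: v)) u v.
Proof.
move=> uv p01 q01; rewrite -secLR.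
have vu : det v u != 0 by rewrite detC oppr_eq0.
have zE : u + v - (p *: u + q *: v) = (1 - q) *: v + (1 - p) *: u.
  by rewrite !scalerBl !scale1r opprD addrACA addrC.
have -> : coset (zspan u v) (- (p *: u + q *: v)) =
          coset (zspan v u) ((1 - q) *: v + (1 - p) *: u).
  rewrite -zE; apply/seteqP; split=> x /zspan_coord[m [n E]]; apply/zspan_coord.
    exists (n - 1), (m - 1); rewrite !rmorphB /= !scalerBl !scale1r.
    have -> : x - (u + v - (p *: u + q *: v)) = x - - (p *: u + q *: v) - u - v by ring.
    by rewrite E; ring.
  exists (n + 1), (m + 1); rewrite !rmorphD /= !scalerDl !scale1r.
  have -> : x - - (p *: u + q *: v) = x - (u + v - (p *: u + q *: v)) + u + v by ring.
  by rewrite E; ring.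
rewrite cell_secL// -?zE.
- by apply/seteqP; split=> x [m [n ->]]; exists n, m; ring.
- by move/andP: q01 => [q0 q1]; apply/andP; split; lra.
- by move/andP: p01 => [p0 p1]; apply/andP; split; lra.
Qed.

Lemma reg2_cell u v (p q : rat) : det u v != 0 -> 0 < sg u -> 0 < sg v ->
  0 < p <= 1 -> 0 <= q < 1 ->
  reg2 (coset (zspan u v) (p *: u + q *: v) `&` secL u v)
    (coset (zspan u v) (- (p *: u + q *: v)) `&` secR u v)
    (log_sine (sg u / sg v) (ratr p * (sg u / sg v) + ratr q)).
Proof.
move=> uv u0 v0 p01 q01; rewrite cell_secL// cell_secR//.
have /andP[p0 p1] := p01; have /andP[q0 q1] := q01.
have [k H] := reg_cone uv u0 v0.
have pp : 0 < ratr p :> R by rewrite ltr0q.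
have qq : 0 <= ratr q :> R by rewrite ler0q.
have p1' : ratr p <= 1 :> R by rewrite -(rmorph1 (@ratr R)) ler_rat.
have q1' : ratr q < 1 :> R by rewrite -(rmorph1 (@ratr R)) ltr_rat.
have sgE : sg (p *: u + q *: v) = ratr p * sg u + ratr q * sg v.
  by rewrite rmorphD /= !rmorphZ_rat.
have w0 : 0 < sg u / sg v by rewrite divr_gt0.
have E : sg (p *: u + q *: v) / sg v = ratr p * (sg u / sg v) + ratr q.
  by rewrite sgE; field; rewrite gt_eqF.
have E' : sg (u + v - (p *: u + q *: v)) / sg v =
    1 + sg u / sg v - (ratr p * (sg u / sg v) + ratr q).
  by rewrite rmorphB rmorphD /= sgE; field; rewrite gt_eqF.
set w := sg u / sg v in w0 E E' H *; set z := ratr p * w + ratr q in E E' *.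
have Ha := H (p *: u + q *: v); have Hb := H (u + v - (p *: u + q *: v)).
rewrite E in Ha; rewrite E' in Hb.
have z0 : 0 < z by rewrite /z; have := mulr_gt0 pp w0; lra.
have z1 : 0 < 1 + w - z by rewrite /z; nra.
have sgv (z' : R) : 0 < z' -> z' * sg v > 0 by move=> h; rewrite mulr_gt0.
have E1 : sg (p *: u + q *: v) = z * sg v by rewrite -E divfK ?gt_eqF.
have E2 : sg (u + v - (p *: u + q *: v)) = (1 + w - z) * sg v by rewrite -E' divfK ?gt_eqF.
rewrite E1 in Ha; rewrite E2 in Hb.
(* Both sums have the same value at 0, so the terms with [ln (sg v)] cancel in the difference. *)
have bE : bval w (1 + w - z) = bval w z by rewrite /bval; congr (_ / _); ring.
rewrite bE in Hb.
exists (bval w z + k), (dzeta2_at0 w z - ln (sg v) * (bval w z + k)),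
  (dzeta2_at0 w (1 + w - z) - ln (sg v) * (bval w z + k)).
have gen (x y t : R) : x - y = x - t - (y - t) by ring.
by split; [exact: (Ha (sgv _ z0))|exact: (Hb (sgv _ z1))|exact: gen].
Qed.

(* [c] is the logarithm of the double sine of [z + L] on the cone of [u] and [v];
   for a cell ([L] spanned by [u] and [v]) it is the classical one, see [reg2_cell]. *)
Definition sector_log L z u v (c : R) :=
  reg2 (coset L z `&` secL u v) (coset L (- z) `&` secR u v) c.

(** * Cones that are not cells of the lattice *)

Definition full_lattice L := exists u v, det u v != 0 /\ L = zspan u v.

Lemma latticeB L x y : full_lattice L -> L x -> L y -> L (x - y).
Proof. by move=> [u [v [_ ->]]]; exact: zspanB. Qed.

Lemma latticeN L x : full_lattice L -> L x -> L (- x).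
Proof. by move=> [u [v [_ ->]]]; exact: zspanN. Qed.

Lemma latticeD L x y : full_lattice L -> L x -> L y -> L (x + y).
Proof. by move=> [u [v [_ ->]]]; exact: zspanD. Qed.

Lemma lattice_sub L u v : full_lattice L -> L u -> L v -> zspan u v `<=` L.
Proof. by move=> [u1 [v1 [_ ->]]]; exact: zspan_sub. Qed.

Lemma coset_sub L z x : full_lattice L -> L (x - z) -> coset L x = coset L z.
Proof.
move=> fL h; apply/seteqP; split=> y; rewrite /coset /= => hy.
  by have := latticeD fL hy h; rewrite addrA subrK.
by have := latticeB fL hy h; rewrite opprB addrA subrK.
Qed.

Lemma common_denominator (s : seq rat) :
  exists2 N : nat, (0 < N)%N & forall p, p \in s -> exists m : int, p * N%:R = m%:~R.
Proof.
elim: s => [|p s [N N0 H]]; first by exists 1%N.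
have dE : (`|denq p|%N)%:R = (denq p)%:~R :> rat.
  by rewrite -[in RHS](gez0_abs (denq_ge0 p)).
exists (N * `|denq p|)%N; first by rewrite muln_gt0 N0 absz_gt0 denq_neq0.
move=> q; rewrite inE => /orP[/eqP->|/H [m mE]].
  exists (numq p * N); rewrite natrM dE mulrCA -{1}(divq_num_den p) divfK ?intr_eq0 ?denq_neq0//.
  by rewrite intrM mulrC.
by exists (m * denq p); rewrite natrM mulrA mE dE intrM.
Qed.

Lemma lattice_grid L z u v : full_lattice L -> det u v != 0 ->
  exists2 N : nat, (0 < N)%N & forall x, coset L z x ->
    exists m n : int, x = (m%:~R / N%:R) *: u + (n%:~R / N%:R) *: v.
Proof.
move=> [u1 [v1 [_ ->]]] uv.
have [p1 [q1 E1]] := coordP u1 uv; have [p2 [q2 E2]] := coordP v1 uv.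
have [p3 [q3 E3]] := coordP z uv.
have [N N0 H] := common_denominator [:: p1; q1; p2; q2; p3; q3].
exists N => // x [m [n xE]].
have N0' : N%:R != 0 :> rat by rewrite pnatr_eq0 -lt0n.
have [a1 A1] := H p1 (mem_head _ _).
have [b1 B1] : exists m : int, q1 * N%:R = m%:~R by apply: H; rewrite !inE eqxx ?orbT.
have [a2 A2] : exists m : int, p2 * N%:R = m%:~R by apply: H; rewrite !inE eqxx ?orbT.
have [b2 B2] : exists m : int, q2 * N%:R = m%:~R by apply: H; rewrite !inE eqxx ?orbT.
have [a3 A3] : exists m : int, p3 * N%:R = m%:~R by apply: H; rewrite !inE eqxx ?orbT.
have [b3 B3] : exists m : int, q3 * N%:R = m%:~R by apply: H; rewrite !inE eqxx ?orbT.
exists (m * a1 + n * a2 + a3), (m * b1 + n * b2 + b3).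
have -> : x = m%:~R * u1 + n%:~R * v1 + z by rewrite -xE subrK.
rewrite !intrD !intrM -A1 -A2 -A3 -B1 -B2 -B3 !intr_scale E1 E2 E3.
have -> : (m%:~R * (p1 * N%:R) + n%:~R * (p2 * N%:R) + p3 * N%:R) / N%:R = m%:~R * p1 + n%:~R * p2 + p3.
  by field.
have -> : (m%:~R * (q1 * N%:R) + n%:~R * (q2 * N%:R) + q3 * N%:R) / N%:R = m%:~R * q1 + n%:~R * q2 + q3.
  by field.
by rewrite !scalerDr !scalerDl !scalerA; ring.
Qed.

(** The lattice spanned by u and v has finite index in L, so the coset splits into finitely many
    cosets, each represented in the half-open cell at a point with denominator N. *)
Lemma grid_reps L z u v : full_lattice L -> L u -> L v -> det u v != 0 ->
  exists N : nat, forall y, coset L z y -> exists i j : 'I_N,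
    let p := (i.+1%:R / N%:R) *: u + (j%:R / N%:R) *: v in
    coset L z p /\ zspan u v (y - p).
Proof.
move=> fL Lu Lv uv; have [N N0 grid] := lattice_grid z fL uv.
have N0' : N%:R != 0 :> rat by rewrite pnatr_eq0 -lt0n.
have Nz : N%:Z != 0 by case: (N) N0.
exists N => y cy; have [m [n yE]] := grid y cy.
have modP (k : int) : exists2 l : nat, (l < N)%N & k = (k %/ N)%Z * N + l.
  exists `|(k %% N)%Z|%N; last by rewrite gez0_abs ?modz_ge0// -divz_eq.
  by rewrite -ltz_nat gez0_abs ?modz_ge0// ltz_mod.
(* Dividing m - 1 rather than m puts the first coordinate (i + 1) / N into the range from 0 excluded
   to 1 included. *)
have [i iN mE] := modP (m - 1); have [j jN nE] := modP n.
have sub : zspan u v (y - ((i.+1%:R / N%:R) *: u + (j%:R / N%:R) *: v)).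
  apply/zspan_coord; exists ((m - 1) %/ N)%Z, (n %/ N)%Z; rewrite yE opprD addrACA -!scalerBl.
  congr (_ *: _ + _ *: _).
    have -> : m%:~R = ((m - 1) %/ N)%Z%:~R * N%:R + i.+1%:R :> rat.
      have h : m%:~R - 1 = ((m - 1) %/ N)%Z%:~R * N%:R + i%:R :> rat.
        by rewrite -[1 in LHS]/(1%:~R) -intrB {1}mE intrD intrM.
      by rewrite -natr1 addrA -h subrK.
    by field.
  have -> : n%:~R = (n %/ N)%Z%:~R * N%:R + j%:R :> rat by rewrite [in LHS]nE intrD intrM.
  by field.
exists (Ordinal iN), (Ordinal jN) => /=; split=> //.
rewrite /coset /=; set p := (i.+1%:R / N%:R) *: u + (j%:R / N%:R) *: v in sub *.
have -> : p - z = (y - z) - (y - p) by ring.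
by apply: latticeB => //; exact: lattice_sub sub.
Qed.

Lemma reg2_bigU (I : eqType) (s : seq I) (P Q : I -> set K) :
  (forall i j, i != j -> P i `&` P j = set0) ->
  (forall i j, i != j -> Q i `&` Q j = set0) ->
  (forall i, exists c, reg2 (P i) (Q i) c) -> uniq s ->
  exists c, reg2 [set x | exists2 i, i \in s & P i x] [set x | exists2 i, i \in s & Q i x] c.
Proof.
move=> Pd Qd H; elim: s => [_|i s IH /= /andP[is_ us]].
  exists 0; have E (P' : I -> set K) : [set x | exists2 i, i \in [::] & P' i x] = set0.
    by apply/seteqP; split=> x // -[].
  rewrite !E; exists 0, 0, 0; split; [exact: reg0|exact: reg0|by rewrite subrr].
have [c hc] := IH us; have [c' hc'] := H i; exists (c' + c).
have E (P' : I -> set K) : [set x | exists2 j, j \in i :: s & P' j x] =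
    P' i `|` [set x | exists2 j, j \in s & P' j x].
  apply/seteqP; split=> x /=.
    by move=> [j]; rewrite inE => /orP[/eqP->|js] Px; [left|right; exists j].
  case=> [Px|[j js Px]]; first by exists i; rewrite ?inE ?eqxx.
  by exists j; rewrite ?inE ?js ?orbT.
have D (P' : I -> set K) : (forall i j, i != j -> P' i `&` P' j = set0) ->
    P' i `&` [set x | exists2 j, j \in s & P' j x] = set0.
  move=> P'd; apply/seteqP; split=> x // -[Pix [j js Pjx]].
  have ij : i != j by apply: contraNneq is_ => ->.
  by have : (P' i `&` P' j) x by []; rewrite P'd.
by rewrite !E; apply: reg2U => //; exact: D.
Qed.

Lemma sector_log_exists L z u v : full_lattice L -> L u -> L v -> det u v != 0 ->
  0 < sg u -> 0 < sg v -> exists c, sector_log L z u v c.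
Proof.
move=> fL Lu Lv uv u0 v0; have [N H] := grid_reps z fL Lu Lv uv.
pose p (ij : 'I_N * 'I_N) := (ij.1.+1%:R / N%:R) *: u + (ij.2%:R / N%:R) *: v.
(* The piece is empty unless the grid point lies in the coset, so that all grid points can serve as
   indices. *)
pose P ij : set K := [set x | coset L z (p ij) /\ (coset (zspan u v) (p ij) `&` secL u v) x].
pose Q ij : set K := [set x | coset L z (p ij) /\ (coset (zspan u v) (- p ij) `&` secR u v) x].
have Lsub := lattice_sub fL Lu Lv.
have dis ij kl : zspan u v (p ij - p kl) -> ij = kl.
  move: ij kl => [i j] [k l]; have N0 : (0 < N)%N by apply: leq_ltn_trans (ltn_ord i).
  have N0' : 0 < N%:R :> rat by rewrite ltr0n.
  move=> /zspan_coord[m [n]]; rewrite /p /= opprD addrACA -!scalerBl.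
  move=> /(coord_uniq uv)[E1 E2].
  have aux (a b : nat) (d : int) : (a < N)%N -> (b < N)%N ->
      (a%:R / N%:R - b%:R / N%:R = d%:~R :> rat) -> a = b.
    move=> aN bN E; have : (a%:Z - b%:Z)%:~R = (d * N%:Z)%:~R :> rat.
      rewrite intrB intrM -E; field; exact: lt0r_neq0.
    move=> /intr_inj dE; have [d0|[d1|d1]] : d = 0 \/ (1 <= d \/ d <= -1) by lia.
    - by move: dE; rewrite d0 mul0r; lia.
    - have : N%:Z <= d * N%:Z by nia.
      by rewrite -dE; lia.
    - have : d * N%:Z <= - N%:Z by nia.
      by rewrite -dE; lia.
  have E1' : i%:R / N%:R - k%:R / N%:R = m%:~R :> rat.
    by rewrite -E1 -!natr1; ring.
  congr (_, _); apply: val_inj => /=; first exact: aux E1'.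
  exact: aux E2.
have [c Hc] : exists c, reg2 [set x | exists2 i, i \in enum {: 'I_N * 'I_N} & P i x]
    [set x | exists2 i, i \in enum {: 'I_N * 'I_N} & Q i x] c.
  apply: reg2_bigU; last exact: enum_uniq.
  - move=> ij kl ijkl; apply/seteqP; split=> x // -[[_ [h1 _]] [_ [h2 _]]].
    move/eqP: ijkl; apply; apply/esym/dis.
    by have := zspanB h1 h2; rewrite (_ : x - p ij - _ = p kl - p ij)//; ring.
  - move=> ij kl ijkl; apply/seteqP; split=> x // -[[_ [h1 _]] [_ [h2 _]]].
    move/eqP: ijkl; apply; apply/dis.
    by have := zspanB h1 h2; rewrite (_ : x - - p ij - _ = p ij - p kl)//; ring.
  move=> [i j]; have N0 : 0 < N%:R :> rat by rewrite ltr0n; apply: leq_ltn_trans (ltn_ord i).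
  have [cz|ncz] := pselect (coset L z (p (i, j))); last first.
    exists 0; rewrite (_ : P _ = set0); last by apply/seteqP; split=> x // -[].
    rewrite (_ : Q _ = set0); last by apply/seteqP; split=> x // -[].
    by exists 0, 0, 0; split; [exact: reg0|exact: reg0|rewrite subrr].
  rewrite (_ : P _ = coset (zspan u v) (p (i, j)) `&` secL u v); last first.
    by apply/seteqP; split=> x => [[]|].
  rewrite (_ : Q _ = coset (zspan u v) (- p (i, j)) `&` secR u v); last first.
    by apply/seteqP; split=> x => [[]|].
  eexists; apply: reg2_cell => //=.
    by rewrite divr_gt0 ?ltr0Sn//= ler_pdivrMr// mul1r ler_nat.
  by rewrite divr_ge0//= ltr_pdivrMr// mul1r ltr_nat.
exists c; rewrite /sector_log.
have -> : coset L z `&` secL u v = [set x | exists2 i, i \in enum {: 'I_N * 'I_N} & P i x].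
  apply/seteqP; split=> x /=.
    move=> [cx sx]; have [i [j [h1 h2]]] := H x cx.
    by exists (i, j); rewrite ?mem_enum.
  move=> [ij _ [h1 [h2 h3]]]; split=> //; rewrite /coset /=.
  by have := latticeD fL (Lsub _ h2) h1; rewrite addrA subrK.
have -> // : coset L (- z) `&` secR u v = [set x | exists2 i, i \in enum {: 'I_N * 'I_N} & Q i x].
apply/seteqP; split=> x /=.
  move=> [cx sx]; have cx' : coset L z (- x).
    by rewrite /coset /= -opprD; apply: latticeN => //; move: cx; rewrite /coset /= opprK.
  have [i [j [h1 h2]]] := H _ cx'.
  exists (i, j); rewrite ?mem_enum//; split=> //; split=> //.
  rewrite /coset /= (_ : x - - p (i, j) = - (- x - p (i, j))); last by ring.
  exact: zspanN.
move=> [ij _ [h1 [h2 h3]]]; split=> //; rewrite /coset /=.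
have -> : x - - z = (x - - p ij) - (p ij - z) by ring.
exact: latticeB (Lsub _ h2) h1.
Qed.

Lemma secL_split u v x (p q : rat) : det u v != 0 -> 0 < p -> 0 < q ->
  x = p *: u + q *: v ->
  secL u v = secL u x `|` secL x v /\ secL u x `&` secL x v = set0.
Proof.
move=> uv p0 q0 ->; split; apply/seteqP; split=> // y /=.
- move=> [a [b [a0 b0 ->]]]; have [h|h] := ltrP (p * b) (q * a).
    left; exists (a - p * b / q), (b / q); split.
    + by rewrite subr_gt0 ltr_pdivrMr// [a * q]mulrC.
    + by rewrite divr_ge0// ltW.
    + rewrite scalerDr !scalerA addrA -scalerDl; congr (_ *: _ + _ *: _); field;
        exact: lt0r_neq0.
  right; exists (a / p), (b - q * a / p); split.
  + by rewrite divr_gt0.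
  + by rewrite subr_ge0 ler_pdivrMr// [b * p]mulrC.
  + rewrite scalerDr !scalerA -addrA -scalerDl; congr (_ *: _ + _ *: _); field;
      exact: lt0r_neq0.
- case=> -[a [b [a0 b0 ->]]].
    exists (a + b * p), (b * q); split; [by rewrite ltr_wpDr// mulr_ge0// ltW|by rewrite mulr_ge0// ltW|].
    by rewrite scalerDr !scalerA addrA -scalerDl.
  exists (a * p), (a * q + b); split; [by rewrite mulr_gt0|by rewrite addr_ge0// mulr_ge0// ltW|].
  by rewrite scalerDr !scalerA -addrA -scalerDl.
- move=> [[a [b [a0 b0 ->]]] [a' [b' [a'0 b'0]]]].
  rewrite !scalerDr !scalerA addrA -scalerDl -addrA -scalerDl.
  move=> /(coord_uniq uv)[E1 E2].
  have : q * a + p * b' = q * (a + b * p) - p * (b * q) + p * b' by ring.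
  rewrite E1 E2 => E; have : 0 < q * a + p * b' by rewrite ltr_wpDr ?mulr_gt0 ?mulr_ge0// ltW.
  by rewrite E; lra.
Qed.

Lemma secR_split u v x (p q : rat) : det u v != 0 -> 0 < p -> 0 < q ->
  x = p *: u + q *: v ->
  secR u v = secR u x `|` secR x v /\ secR u x `&` secR x v = set0.
Proof.
move=> uv p0 q0 xE; rewrite -!secLR.
have vu : det v u != 0 by rewrite detC oppr_eq0.
have [-> h] := secL_split vu q0 p0 (etrans xE (addrC _ _)).
by rewrite setUC setIC.
Qed.

Lemma sector_logD L z u v x (p q : rat) (c c' : R) : det u v != 0 -> 0 < p -> 0 < q ->
  x = p *: u + q *: v -> sector_log L z u x c -> sector_log L z x v c' ->
  sector_log L z u v (c + c').
Proof.
move=> uv p0 q0 xE h1 h2; rewrite /sector_log.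
have [-> d1] := secL_split uv p0 q0 xE; have [-> d2] := secR_split uv p0 q0 xE.
rewrite !setIUr; apply: reg2U h1 h2; by rewrite setIACA ?d1 ?d2 setI0.
Qed.

(** Negating z and reversing the cone exchanges the two sums. This is the source of the opposite
    signs in the two final identities. *)
Lemma sector_logN L z u v (c : R) : sector_log L z u v c -> sector_log L (- z) v u (- c).
Proof. by move=> /reg2_sym; rewrite /sector_log opprK -!secLR. Qed.

(** * Invariance under units and change of the boundary ray *)

Definition stable L z (e : K) := L (e * z - z) /\ (forall x, L (e * x) <-> L x).

Lemma stableN L z (e : K) : full_lattice L -> stable L z e -> stable L (- z) e.
Proof.
by move=> fL [h1 h2]; split=> //; have := latticeN fL h1; rewrite mulrN -opprD.
Qed.

Lemma scale_coset L z (e : K) : full_lattice L -> e != 0 -> stable L z e ->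
  scale_set e (coset L z) = coset L z.
Proof.
move=> fL e0 [h1 h2]; apply/seteqP; split=> [_ [x xz <-]|x xz].
  rewrite /coset /= in xz *; have -> : e * x - z = (e * x - e * z) - - (e * z - z) by ring.
  apply: latticeB => //; first by rewrite -mulrBr; apply/h2.
  exact: latticeN.
exists (x / e); last by rewrite mulrC divfK.
rewrite /coset /=; apply/h2; rewrite mulrBr mulrCA divff// mulr1.
have -> : x - e * z = (x - z) - (e * z - z) by ring.
exact: latticeB.
Qed.

Lemma scale_secL (e : K) u v : scale_set e (secL u v) = secL (e * u) (e * v).
Proof.
apply/seteqP; split=> [_ [_ [p [q [p0 q0 ->]]] <-]|_ [p [q [p0 q0 ->]]]].
  by exists p, q; split=> //; rewrite mulrDr !scalerAr.
by exists (p *: u + q *: v); [exists p, q|rewrite mulrDr !scalerAr].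
Qed.

Lemma scale_ray (e : K) u : scale_set e (ray u) = ray (e * u).
Proof.
apply/seteqP; split=> [_ [_ [p p0 ->] <-]|_ [p p0 ->]].
  by exists p => //; rewrite scalerAr.
by exists (p *: u); [exists p|rewrite scalerAr].
Qed.

Lemma scale_setI (e : K) P Q : e != 0 ->
  scale_set e (P `&` Q) = scale_set e P `&` scale_set e Q.
Proof.
move=> e0; apply/seteqP; split=> [_ [x [Px Qx] <-]|_ [[x Px <-] [y Qy]]].
  by split; exists x.
by move=> /(mulfI e0) yx; exists x => //; split=> //; rewrite -yx.
Qed.

Lemma secL_gt0 u v x : 0 < sg u -> 0 < sg v -> secL u v x -> 0 < sg x.
Proof.
move=> u0 v0 [p [q [p0 q0 ->]]]; rewrite rmorphD /= !rmorphZ_rat ltr_wpDr//.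
  by rewrite mulr_ge0 ?ler0q// ltW.
by rewrite mulr_gt0 ?ltr0q.
Qed.

Lemma sg_neq0 (e : K) : 0 < sg e -> e != 0.
Proof. by move=> e0; apply/eqP => E; rewrite E rmorph0 ltxx in e0. Qed.

Lemma sector_logZ L z u v (e : K) (c : R) : full_lattice L -> 0 < sg e -> stable L z e ->
  0 < sg u -> 0 < sg v -> sector_log L z u v c -> sector_log L z (e * u) (e * v) c.
Proof.
move=> fL e0 ez u0 v0 h; have e0' := sg_neq0 e0.
rewrite /sector_log -[secR (e * u) _]secLR -!scale_secL.
rewrite -{1}(scale_coset fL e0' ez) -(scale_coset fL e0' (stableN fL ez)) -!scale_setI//.
apply: reg2_scale => //; last by move: h; rewrite /sector_log -secLR.
  by move=> x [_]; exact: secL_gt0.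
by move=> x [_]; exact: secL_gt0.
Qed.

(** Writing a ray as a difference of two translated cones derives its Hurwitz zeta value from the
    double zeta values. *)
Lemma coset_ray u v (t : rat) : det u v != 0 -> 0 < t < 1 ->
  coset (zspan u v) (t *: u) `&` ray u = cone (t *: u) u v `\` cone (t *: u + v) u v.
Proof.
move=> uv /andP[t0 t1]; apply/seteqP; split=> x /=.
  move=> [/zspan_coord[m [n E]] [p p0 xE]].
  have : p *: u + 0 *: v = (t + m%:~R) *: u + n%:~R *: v.
    by rewrite scale0r addr0 -xE scalerDl -addrA -E addrC subrK.
  move=> /(coord_uniq uv)[pE nE]; rewrite pE in p0.
  have [|m' mE] := @int_ge0 m; first lra.
  split; first by exists m', 0%N; rewrite mul0r addr0 xE pE natr_scale scalerDl mE.
  move=> [k [l]]; rewrite xE !natr_scale => E'.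
  have : p *: u + 0 *: v = (t + k%:R) *: u + (1 + l%:R) *: v.
    by rewrite scale0r addr0 E' !scalerDl scale1r; ring.
  move=> /(coord_uniq uv)[_ /eqP]; rewrite eq_sym => /eqP.
  by have := ler0n rat l; lra.
move=> [[m [n ->]] H]; have n0 : n = 0%N.
  case: n H => // n H; exfalso; apply: H; exists m, n.
  by rewrite -natr1; ring.
rewrite n0 mul0r addr0; split.
  apply/zspan_coord; exists m, 0; rewrite scale0r addr0 addrAC subrr add0r natr_scale.
  by [].
by exists (t + m%:R); [rewrite ltr_wpDr|rewrite scalerDl natr_scale].
Qed.

(* Hurwitz zeta values at 0: zeta(0, t) = 1/2 - t is odd under t -> 1 - t. *)
Lemma ray_value u v (t : rat) : det u v != 0 -> 0 < sg u -> 0 < sg v -> 0 < t < 1 ->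
  exists b, reg sg (coset (zspan u v) (t *: u) `&` ray u) (1 / 2 - ratr t) b.
Proof.
move=> uv u0 v0 t01; rewrite coset_ray//; have /andP[t0 t1] := t01.
have [k H] := reg_cone uv u0 v0.
have T0 : 0 < ratr t :> R by rewrite ltr0q.
have h1 : 0 < sg (t *: u) by rewrite rmorphZ_rat mulr_gt0.
have h2 : 0 < sg (t *: u + v) by rewrite rmorphD addr_gt0.
have := regD _ (H _ h1) (H _ h2) => /(_ _) R1.
have sub : cone (t *: u + v) u v `<=` cone (t *: u) u v.
  by move=> _ [m [n ->]]; exists m, n.+1; rewrite -natr1; ring.
have {R1} := R1 sub; set a := (X in reg _ _ X _); set b := (X in reg _ _ _ X).
have -> : a = 1 / 2 - ratr t.
  rewrite /a /bval rmorphD /= rmorphZ_rat; field.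
  by rewrite !gt_eqF.
by exists b.
Qed.

(** If z + L meets the ray, it does so at some t u with 0 < t < 1, where t is nonzero because z is
    not in L; then -z + L meets it at (1 - t) u, with the opposite value. If one coset misses the
    ray, so does the other. For z in L both values would be -1/2. *)
Lemma ray_pair u v z : det u v != 0 -> 0 < sg u -> 0 < sg v -> ~ zspan u v z ->
  exists a b b', reg sg (coset (zspan u v) z `&` ray u) a b /\
    reg sg (coset (zspan u v) (- z) `&` ray u) (- a) b'.
Proof.
move=> uv u0 v0 nz.
have fL : full_lattice (zspan u v) by exists u, v.
have [[x [xz [p p0 xE]]]|ne] := pselect (exists x, (coset (zspan u v) z `&` ray u) x).
  rewrite xE in xz.
  pose t : rat := p - (Num.floor p)%:~R.
  have tz : zspan u v (t *: u - z).
    have -> : t *: u - z = (p *: u - z) - (Num.floor p)%:~R * u.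
      by rewrite /t scalerBl -intr_scale addrAC.
    apply: zspanB => //; apply: zspanZ; exact: zspanl.
  have t1 : t < 1 by rewrite /t ltrBlDl; have := floorD1_gt p; rewrite intrD.
  have t0 : 0 < t.
    rewrite lt_def /t subr_ge0 floor_le ?andbT//.
    apply/eqP => E; apply: nz; move: tz; rewrite /t E scale0r sub0r => /zspanN.
    by rewrite opprK.
  have [|b hb] := @ray_value u v t uv u0 v0; first by rewrite t0.
  have [|b' hb'] := @ray_value u v (1 - t) uv u0 v0.
    by rewrite subr_gt0 t1 /= ltrBlDr ltrDl.
  exists (1 / 2 - ratr t), b, b'; rewrite -(coset_sub fL tz); split=> //.
  have tz' : zspan u v ((1 - t) *: u - - z).
    have -> : (1 - t) *: u - - z = u - (t *: u - z) by rewrite scalerBl scale1r; ring.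
    by apply: zspanB => //; exact: zspanl.
  rewrite -(coset_sub fL tz').
  have E : - (1 / 2 - ratr t) = 1 / 2 - ratr (1 - t) :> R.
    have -> : ratr (1 - t) = 1 - ratr t :> R by rewrite rmorphB rmorph1.
    by field.
  by rewrite E.
exists 0, 0, 0; rewrite oppr0.
have -> : coset (zspan u v) z `&` ray u = set0.
  by apply/seteqP; split=> x // hx; apply: ne; exists x.
have -> : coset (zspan u v) (- z) `&` ray u = set0.
  apply/seteqP; split=> x // [+ [p p0 xE]]; rewrite xE => xz; apply: ne.
  exists (((Num.floor p + 1)%:~R - p) *: u); split; last first.
    by exists ((Num.floor p + 1)%:~R - p) => //; rewrite subr_gt0 floorD1_gt.
  rewrite /coset /=.
  have -> : ((Num.floor p + 1)%:~R - p) *: u - z = (Num.floor p + 1)%:~R * u - (p *: u - - z).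
    by rewrite scalerBl -intr_scale; ring.
  by apply: zspanB => //; apply: zspanZ; exact: zspanl.
by split; exact: reg0.
Qed.

Lemma secR_secL u v (P : set K) : det u v != 0 ->
  P `&` secR u v = ((P `&` secL u v) `\` (P `&` ray u)) `|` (P `&` ray v).
Proof.
move=> uv; apply/seteqP; split=> x /=.
  move=> [Px [p [q [p0 q0 xE]]]]; have [p00|p00] := eqVneq p 0.
    by right; split=> //; exists q => //; rewrite xE p00 scale0r add0r.
  left; split; first by split=> //; exists p, q; split; rewrite ?lt_def ?p00// ltW.
  move=> [_ [p' p'0 xE']]; have : p *: u + q *: v = p' *: u + 0 *: v.
    by rewrite scale0r addr0 -xE.
  by move=> /(coord_uniq uv)[_ q00]; rewrite q00 ltxx in q0.
move=> [[[Px [p [q [p0 q0 xE]]]] nr]|[Px [q q0 xE]]]; split=> //.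
  exists p, q; split; rewrite ?ltW// lt_def q0 andbT; apply/eqP => q00.
  by apply: nr; split=> //; exists p => //; rewrite xE q00 scale0r addr0.
by exists 0, q; split; rewrite // xE scale0r add0r.
Qed.

(** Trading the ray of u for that of e u changes the first derivative by -r ln e, where r is the
    value on the ray. In the second sum the trade goes the other way and the value is -r, so the
    change is the same and the difference is preserved. *)
Lemma sector_log_swap v z u (e : K) (c : R) : det u v != 0 -> det u (e * u) != 0 ->
  0 < sg u -> 0 < sg v -> 0 < sg e -> ~ zspan u v z -> stable (zspan u v) z e ->
  sector_log (zspan u v) z u (e * u) c -> sector_log (zspan u v) z (e * u) u c.
Proof.
move=> uv ueu u0 v0 e0 nz ez [a [b [b' [h1 h2 cE]]]].
have [r [rb [rb' [r1 r2]]]] := ray_pair uv u0 v0 nz.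
have fL : full_lattice (zspan u v) by exists u, v.
have e0' := sg_neq0 e0; set L := zspan u v in fL ez h1 h2 r1 r2 *.
have eu0 : 0 < sg (e * u) by rewrite rmorphM mulr_gt0.
have ray0 w x : 0 < sg w -> ray w x -> 0 < sg x.
  by move=> w0 [p p0 ->]; rewrite rmorphZ_rat mulr_gt0 ?ltr0q.
have ray_e z' : stable L z' e ->
    coset L z' `&` ray (e * u) = scale_set e (coset L z' `&` ray u).
  by move=> ez'; rewrite scale_setI// scale_coset// scale_ray.
have r1e : reg sg (coset L z `&` ray (e * u)) r (rb - ln (sg e) * r).
  rewrite ray_e//; apply: reg_scale => // x [_]; exact: ray0.
have r2e : reg sg (coset L (- z) `&` ray (e * u)) (- r) (rb' - ln (sg e) * - r).
  rewrite ray_e; last exact: stableN; apply: reg_scale => // x [_]; exact: ray0.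
have eue : det (e * u) u != 0 by rewrite detC oppr_eq0.
rewrite /sector_log secLR -[secR (e * u) u]secLR.
rewrite (secR_secL _ ueu).
have -> : coset L (- z) `&` secL u (e * u) =
  ((coset L (- z) `&` secR u (e * u)) `\` (coset L (- z) `&` ray (e * u))) `|` (coset L (- z) `&` ray u).
  by rewrite -(secLR (e * u) u) [in LHS]secLR (secR_secL _ eue).
exists (a - r + r), (b - rb + (rb - ln (sg e) * r)), (b' - (rb' - ln (sg e) * - r) + rb').
split; last by rewrite cE; ring.
  apply: regU; last exact: r1e.
    apply/seteqP; split=> x // -[[[_ [p [q [p0 q0 ->]]]] nr] [_ [p' p'0]]].
    rewrite -[p' *: _]add0r -(scale0r u) => /(coord_uniq ueu)[pE _].
    by rewrite pE ltxx in p0.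
  apply: regD => // x [xz [p p0 xE]]; split=> //.
  by exists p, 0; split=> //; rewrite xE scale0r addr0.
rewrite (_ : a - r + r = a - - r - r); last by ring.
apply: regU; last exact: r2.
  apply/seteqP; split=> x // -[[[_ [p [q [p0 q0 ->]]]] nr] [_ [p' p'0]]].
  rewrite -[p' *: _]addr0 -(scale0r (e * u)) => /(coord_uniq ueu)[_ qE].
  by rewrite qE ltxx in q0.
apply: regD => // x [xz [p p0 xE]]; split=> //.
by exists 0, p; split=> //; rewrite xE scale0r add0r.
Qed.

End Sectors.

(** * Minus continued fractions and units *)

Lemma minus_cf_trunc_ge1 (R : realType) (b : nat -> int) n :
  (forall j, 2 <= b j) -> 1 <= minus_cf_trunc R b n.
Proof.
elim: n b => [|n IH] b b2 /=.
  by rewrite -(mulr1z 1) ler_int; apply: le_trans (b2 0%N).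
have h := IH _ (fun j => b2 j.+1); have := b2 0%N; rewrite -(ler_int R) => b0.
have : (minus_cf_trunc R (fun j => b j.+1) n)^-1 <= 1 by rewrite invf_le1// (lt_le_trans ltr01).
by move: b0; rewrite (_ : 2%:~R = 2 :> R)//; lra.
Qed.

Lemma minus_cf_ge1 (R : realType) (b : nat -> int) (x : R) :
  (forall j, 2 <= b j) -> minus_cf b x -> 1 <= x.
Proof.
move=> b2 bx; have <- : lim (minus_cf_trunc R b n @[n --> \oo]) = x by apply: cvg_lim.
apply: limr_ge; first by apply/cvg_ex; exists x.
by near=> n; exact: minus_cf_trunc_ge1.
Unshelve. all: by end_near. Qed.

Lemma minus_cf_unique (R : realType) (b : nat -> int) (x y : R) :
  minus_cf b x -> minus_cf b y -> x = y.
Proof. by move=> bx /cvg_lim <-//; apply/esym/cvg_lim. Qed.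

Lemma minus_cfS (R : realType) (b : nat -> int) (x y : R) : (forall j, 2 <= b j) ->
  minus_cf b x -> minus_cf (fun j => b j.+1) y -> x = (b 0%N)%:~R - y^-1.
Proof.
move=> b2 bx bY; have y1 := minus_cf_ge1 (fun j => b2 j.+1) bY.
have y0 : y != 0 by rewrite gt_eqF// (lt_le_trans ltr01).
apply: (@cvg_unique _ (@norm_hausdorff R R) (minus_cf_trunc R b n.+1 @[n --> \oo])).
  by move: bx; rewrite /minus_cf -(cvg_shiftS (minus_cf_trunc R b)).
by apply: cvgB; [exact: cvg_cst|exact: cvgV].
Qed.

Lemma int_shift_ind (P : int -> Prop) : P 0 -> (forall k, P k <-> P (k + 1)) -> forall k, P k.
Proof.
move=> P0 PS [n|n].
  by elim: n => // n IH; rewrite -addn1 PoszD; apply: (PS _).1.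
elim: n => [|n IH]; first by apply: (PS _).2; rewrite NegzE addNr.
by apply: (PS _).2; rewrite (_ : Negz n.+1 + 1 = Negz n)//; lia.
Qed.

Section Integers.
Variables (R : realType) (K : realQuadratic R).
Local Notation OK := (@OK R K).

Lemma OKB x y : OK x -> OK y -> OK (x - y).
Proof. exact: integral_sub. Qed.
Lemma OKD x y : OK x -> OK y -> OK (x + y).
Proof. exact: integral_add. Qed.
Lemma OKM x y : OK x -> OK y -> OK (x * y).
Proof. exact: integral_mul. Qed.
Lemma OKN x : OK x -> OK (- x).
Proof. exact: integral_opp. Qed.
Lemma OK0 : OK 0.
Proof. exact: integral0. Qed.
Lemma OK1 : OK 1.
Proof. exact: integral1. Qed.
(* [x] is a root of the characteristic polynomial of its action on the lattice. *)
Lemma OK_lattice (u v x : K) : u != 0 -> v != 0 ->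
  zspan u v (x * u) -> zspan u v (x * v) -> OK x.
Proof.
move=> u0 v0 [a [b E1]] [c [d E2]].
have m1 : ('X - a%:P) * ('X - d%:P) \is @monic int.
  by rewrite monicMl ?monicXsubC.
exists (('X - a%:P) * ('X - d%:P) - (b * c)%:P).
  rewrite monicE lead_coefDl ?(monicP m1)//.
  rewrite size_polyN size_polyC size_Mmonic ?monicXsubC ?polyXsubC_eq0// !size_XsubC.
  by case: (_ != 0).
rewrite /root rmorphB rmorphM !rmorphB /= !map_polyX !map_polyC !hornerE /=.
have h1 : (x - a%:~R) * u = b%:~R * v by rewrite mulrBl E1 addrC addKr.
have h2 : (x - d%:~R) * v = c%:~R * u by rewrite mulrBl E2 addrK.
apply/eqP/(mulIf (mulf_neq0 u0 v0)); rewrite mul0r mulrBl rmorphM /= mulrACA h1 h2; ring.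
Qed.
End Integers.

Section Expansion.
Variables (R : realType) (K : realQuadratic R) (f : set K) (cl : set (set K)).
Variable D : decomposition f cl.
Local Notation w := (dec_w D).
Local Notation A := (dec_A D).
Local Notation cf := (dec_cf D).
Local Notation m := (dec_period D).
Local Notation s1 := (@emb1 R K).
Local Notation s2 := (@emb2 R K).

Lemma dec_cf_shift (k : int) (N : nat) : cf (k + N%:Z * m%:Z) = cf k.
Proof.
elim: N => [|N IH]; first by rewrite mul0r addr0.
rewrite -[RHS]IH -[RHS](dec_cf_periodic D); congr (cf _).
by move: (dec_period D) => p; rewrite -[N.+1]addn1 PoszD; ring.
Qed.

Lemma emb1_w_rec k : s1 (w k) = (cf k)%:~R - (s1 (w (k + 1)))^-1.
Proof.
have := @minus_cfS _ _ _ (s1 (w (k + 1))) (fun j => dec_cf_ge2 D _) (@dec_wE _ _ _ _ D k).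
rewrite addr0; apply.
have := @dec_wE _ _ _ _ D (k + 1); rewrite /minus_cf.
by rewrite (_ : (fun j : nat => cf (k + 1 + j%:Z)) = (fun j : nat => cf (k + j.+1%:Z)))//;
  apply/funext => j; congr (cf _); lia.
Qed.

Lemma w_ge1 k : 1 <= s1 (w k).
Proof. by apply: minus_cf_ge1 (@dec_wE _ _ _ _ D k) => j; exact: dec_cf_ge2. Qed.

Lemma w_neq0 k : w k != 0.
Proof.
apply/eqP => E; have := w_ge1 k; rewrite E /emb1 rmorph0; lra.
Qed.

Lemma w_rec k : w k = (cf k)%:~R - (w (k + 1))^-1.
Proof. by apply: emb1_inj; rewrite emb1_w_rec /emb1 rmorphB fmorphV rmorph_int. Qed.

Lemma w_shift (k : int) (N : nat) : w (k + N%:Z * m%:Z) = w k.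
Proof.
apply: emb1_inj; apply: minus_cf_unique (@dec_wE _ _ _ _ D (k + N%:Z * m%:Z)) _.
rewrite (_ : (fun j : nat => cf (k + N%:Z * m%:Z + j%:Z)) = (fun j : nat => cf (k + j%:Z))).
  exact: dec_wE.
apply/funext => j; rewrite -(dec_cf_shift (k + j%:Z) N); congr (cf _); ring.
Qed.

Lemma w_nonneg_index (P : K -> Prop) : (forall n : nat, P (w n)) -> forall k, P (w k).
Proof.
move=> H k; rewrite -(w_shift k `|k|%N).
have := dec_period_gt0 D; move: (dec_period D) => m' m0.
have -> : k + `|k|%N%:Z * m'%:Z = `|(k + `|k|%N%:Z * m'%:Z : int)|%N by nia.
exact: H.
Qed.

(** If w_k = 1, then b_k >= 2 and w_(k+1) >= 1 force w_(k+1) = 1, and so on; by periodicity omega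
    would be 1. *)
Lemma w_gt1 k : 1 < s1 (w k).
Proof.
rewrite lt_def w_ge1 andbT; apply/eqP => wk.
have H (n : nat) : s1 (w (k + n%:Z)) = 1.
  elim: n => [|n IH]; first by rewrite addr0.
  have := emb1_w_rec (k + n%:Z); rewrite IH.
  have := dec_cf_ge2 D (k + n%:Z); rewrite -(ler_int R).
  have := w_ge1 (k + n%:Z + 1); rewrite (_ : k + n%:Z + 1 = k + n.+1%:Z); last by lia.
  set x := s1 _ => x1; rewrite (_ : 2%:~R = 2 :> R)// => h E.
  have : x^-1 >= 1 by lra.
  by rewrite invf_ge1 ?(lt_le_trans ltr01)// => ?; apply/eqP; rewrite eq_le x1 andbT.
have [_ _ ] := dec_omega_reduced D; rewrite -(dec_w0 D) -(w_shift 0 `|k|%N).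
have := dec_period_gt0 D; move: (dec_period D) H => m' H m0.
have -> : 0 + `|k|%N%:Z * m'%:Z = k + `|(- k + `|k|%N%:Z * m'%:Z : int)|%N by nia.
by rewrite H ltxx.
Qed.

(** Conjugates are propagated upwards, 1 / w'_(k+1) = b_k - w'_k > 1; periodicity covers the
    negative indices. *)
Lemma emb2_w k : 0 < s2 (w k) < 1.
Proof.
apply: (w_nonneg_index (P := fun x => 0 < s2 x < 1)) k.
elim=> [|n /andP[h0 h1]].
  by rewrite dec_w0; have [-> -> _] := dec_omega_reduced D.
have := congr1 s2 (w_rec n); rewrite {2}/emb2 !rmorphB !fmorphV !rmorph_int -/(s2 _) /=.
rewrite -addn1 PoszD; set x := s2 (w (_ + 1)) => E.
have := dec_cf_ge2 D n; rewrite -(ler_int R) (_ : 2%:~R = 2 :> R)// => h.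
have x1 : 1 < x^-1 by lra.
have x0 : 0 < x by rewrite -invr_gt0 (lt_trans ltr01).
by rewrite x0 /=; rewrite invf_gt1 in x1.
Qed.

Lemma A_pred k : A (k - 1) = w k * A k.
Proof.
have := dec_AS D (k - 1); rewrite subrK => ->.
by rewrite mulrC divfK ?w_neq0.
Qed.

Lemma A_rec k : A (k + 1) = (cf k)%:~R * A k - A (k - 1).
Proof. by rewrite dec_AS A_pred mulrC -mulrBl [w k]w_rec subKr. Qed.

Lemma emb1_A_gt0 k : 0 < s1 (A k).
Proof.
elim/int_shift_ind: k => [|k]; first by rewrite dec_A0 /emb1 rmorph1.
rewrite dec_AS {2}/emb1 rmorphM fmorphV pmulr_lgt0// invr_gt0.
exact: lt_trans (w_gt1 _).
Qed.

Lemma emb2_A_gt0 k : 0 < s2 (A k).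
Proof.
elim/int_shift_ind: k => [|k]; first by rewrite dec_A0 /emb2 !rmorph1.
have /andP[h _] := emb2_w (k + 1).
by rewrite dec_AS {2}/emb2 !rmorphM !fmorphV pmulr_lgt0// invr_gt0.
Qed.

Lemma det_AS k : 0 < det (A k) (A (k + 1)).
Proof.
have := A_pred (k + 1); rewrite addrK => ->; have /andP[h0 h1] := emb2_w (k + 1).
rewrite /det.
have -> : s1 (w (k + 1) * A (k + 1)) = s1 (w (k + 1)) * s1 (A (k + 1)) by exact: rmorphM.
have -> : s2 (w (k + 1) * A (k + 1)) = s2 (w (k + 1)) * s2 (A (k + 1)).
  by rewrite /emb2 !rmorphM.
have := w_gt1 (k + 1); have := emb1_A_gt0 (k + 1); have := emb2_A_gt0 (k + 1).
move: (s1 (w _)) (s2 (w _)) (s1 (A _)) (s2 (A _)) h0 h1 => a b c d h0 h1 h2 h3 h4.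
have -> : a * c * d - b * d * c = (a - b) * (c * d) by ring.
by rewrite !mulr_gt0// subr_gt0; lra.
Qed.

Lemma emb1_A_decr k (n : nat) : s1 (A (k + n.+1%:Z)) < s1 (A k).
Proof.
have H j : s1 (A (j + 1)) < s1 (A j).
  rewrite dec_AS {1}/emb1 rmorphM fmorphV -/(s1 _) -/(s1 _).
  by rewrite gtr_pMr ?emb1_A_gt0// invf_lt1 ?w_gt1// (lt_trans ltr01) ?w_gt1.
elim: n => [|n IH]; first exact: H.
by apply: lt_trans IH; rewrite -[n.+2]addn1 PoszD addrA.
Qed.

Lemma emb2_A_incr k (n : nat) : s2 (A k) < s2 (A (k + n.+1%:Z)).
Proof.
have H j : s2 (A j) < s2 (A (j + 1)).
  rewrite dec_AS {2}/emb2 !rmorphM !fmorphV -/(s2 _) -/(s2 _) -!/(s2 _).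
  have /andP[h0 h1] := emb2_w (j + 1).
  by rewrite ltr_pMr ?emb2_A_gt0// invf_gt1.
elim: n => [|n IH]; first exact: H.
by apply: lt_trans IH _; rewrite -[n.+2]addn1 PoszD addrA.
Qed.

Lemma det_A_gt0 k (n : nat) : 0 < det (A k) (A (k + n.+1%:Z)).
Proof.
have := emb1_A_decr k n; have := emb2_A_incr k n; rewrite /det.
have := emb1_A_gt0 (k + n.+1); have := emb2_A_gt0 k.
by move: (s1 _) (s2 _) (s2 _) (s1 _) => a b c d; nra.
Qed.

Lemma zspan_AS k : zspan (A (k - 1)) (A k) = zspan (A k) (A (k + 1)).
Proof.
have := A_rec k; move: (A (k + 1)) (A k) (A (k - 1)) => a b c E.
have E' : c = (cf k)%:~R * b - a by rewrite E; ring.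
apply/seteqP; split; apply: zspan_sub.
- by rewrite E'; apply: zspanB; [apply: zspanZ; exact: zspanl|exact: zspanr].
- exact: zspanl.
- exact: zspanr.
- by rewrite E; apply: zspanB; [apply: zspanZ; exact: zspanr|exact: zspanl].
Qed.

Lemma dec_b_zspan k : dec_b D = zspan (A (k - 1)) (A k).
Proof.
elim/int_shift_ind: k => [|k].
  by rewrite A_pred dec_A0 dec_w0 mulr1 zspanC.
by rewrite addrK -zspan_AS.
Qed.

Lemma dec_b_full : full_lattice (dec_b D).
Proof.
exists (A 0), (A 1); split; first by rewrite gt_eqF// (det_AS 0).
by rewrite (dec_b_zspan 1) subrr.
Qed.

Lemma dec_b_A k : dec_b D (A k).
Proof. rewrite (dec_b_zspan k); exact: zspanr. Qed.

(** Cells spanned by consecutive A_k are glued along their common rays, as A_(n+1) lies strictly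
    between A_0 and A_(n+2). The product of double sines thus depends on the outer rays only. *)
Lemma decomposition_sector (sg : {rmorphism K -> R}) n : (forall k, 0 < sg (A k)) ->
  sector_log sg (dec_b D) (dec_z D) (A 0) (A n.+1)
    (\sum_(1 <= k < n.+2) log_sine (sg (w k)) (ratr (dec_x D k) * sg (w k) + ratr (dec_y D k))).
Proof.
move=> A0; have cell (k : nat) : sector_log sg (dec_b D) (dec_z D) (A (k.+1%:Z - 1)) (A k.+1)
    (log_sine (sg (w k.+1)) (ratr (dec_x D k.+1) * sg (w k.+1) + ratr (dec_y D k.+1))).
  have dk : det (A (k.+1%:Z - 1)) (A k.+1) != 0.
    by have := det_AS (k.+1%:Z - 1); rewrite subrK => /gt_eqF ->.
  have xyP := dec_xyP D k.+1.
  have := reg2_cell dk (A0 _) (A0 _) (dec_x_range D k.+1) (dec_y_range D k.+1).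
  have -> : sg (A (k.+1%:Z - 1)) / sg (A k.+1) = sg (w k.+1).
    by rewrite A_pred rmorphM /= mulfK// gt_eqF.
  rewrite -(dec_b_zspan k.+1) (coset_sub dec_b_full xyP).
  have xyN : dec_b D (- (dec_x D k.+1 *: A (k.+1%:Z - 1) + dec_y D k.+1 *: A k.+1) - - dec_z D).
    by rewrite -opprD; exact: latticeN dec_b_full _.
  by rewrite (coset_sub dec_b_full xyN).
elim: n => [|n IH]; first by rewrite big_nat1; have := cell 0%N; rewrite subrr.
rewrite big_nat_recr//=.
have d1 := det_A_gt0 0 n.+1; rewrite add0r in d1.
have d2 := det_A_gt0 0 n; rewrite add0r in d2.
have d3 := det_AS n.+1.
have [||p [q [p0 q0 E]]] := @between R K (A 0) (A n.+2) (A n.+1).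
- by move: d3; rewrite -PoszD addn1 => d3; exact: mulr_gt0.
- by rewrite mulr_gt0.
apply: (sector_logD _ p0 q0 E IH); first by rewrite gt_eqF.
by have := cell n.+1; rewrite (_ : n.+2%:Z - 1 = n.+1)//; lia.
Qed.

Lemma invariant_atE (sg : {rmorphism K -> R}) r : invariant_at sg r D =
  expR (\sum_(1 <= k < (r * m).+1)
    log_sine (sg (w k)) (ratr (dec_x D k) * sg (w k) + ratr (dec_y D k))).
Proof. by rewrite /invariant_at expR_sum; apply: eq_bigr. Qed.

(** * The period and the fundamental unit *)

Lemma A_mul_period k : A (k + m%:Z) = A k * A m.
Proof.
elim/int_shift_ind: k => [|k]; first by rewrite add0r dec_A0 mul1r.
have E : A (k + 1 + m%:Z) = A (k + m%:Z) / w (k + 1).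
  rewrite -[w (k + 1)](w_shift _ 1) mul1r addrAC; exact: dec_AS.
rewrite E dec_AS mulrAC; split=> [->//|].
by move=> /(mulIf (invr_neq0 (w_neq0 _))).
Qed.

Lemma A_neq0 k : A k != 0.
Proof. by apply/eqP => E; have := emb1_A_gt0 k; rewrite E /emb1 rmorph0 ltxx. Qed.

Lemma A_muln_period (n : nat) : A (n * m)%N = A m ^+ n.
Proof.
elim: n => [|n IH]; first by rewrite mul0n dec_A0 expr0.
by rewrite exprSr -IH -A_mul_period -PoszD mulSnr.
Qed.

Lemma A_opp_period : A (- m%:Z) = (A m)^-1.
Proof.
have := A_mul_period (- m%:Z); rewrite addNr dec_A0 => E.
by rewrite -[LHS](mulfK (A_neq0 m)) -E mul1r.
Qed.

(** Multiplication by A_m shifts the index by m, and every pair of neighbours spans the same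
    lattice. Hence A_m is a unit. *)
Lemma dec_b_period x : dec_b D x -> dec_b D (A m * x) /\ dec_b D ((A m)^-1 * x).
Proof.
move=> bx; rewrite -A_opp_period; split.
  have := bx; rewrite (dec_b_zspan 0) => /(zspanM (A m)).
  rewrite -(dec_b_zspan 0) (dec_b_zspan m) ![A m * A _]mulrC -!A_mul_period.
  by rewrite (_ : 0 - 1 + m%:Z = m%:Z - 1) ?add0r// sub0r addrC.
have := bx; rewrite (dec_b_zspan m) => /(zspanM (A (- m%:Z))).
have E k : A (- m%:Z) * A k = A (k - m%:Z).
  by rewrite A_opp_period mulrC -[in LHS](subrK m%:Z k) A_mul_period mulfK ?A_neq0.
by rewrite -(dec_b_zspan m) !E subrr addrAC subrr -(dec_b_zspan 0).
Qed.

Lemma dec_b_omega : dec_b D (dec_omega D).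
Proof. exact: zspanr. Qed.

Lemma dec_b1 : dec_b D 1.
Proof. exact: zspanl. Qed.

Lemma omega_neq0 : dec_omega D != 0.
Proof. by rewrite -(dec_w0 D) w_neq0. Qed.

Lemma OK_period : OK (A m) /\ OK (A m)^-1.
Proof.
by split; apply: (OK_lattice (oner_neq0 _) omega_neq0);
  have [h1 h2] := dec_b_period dec_b1; have [h3 h4] := dec_b_period dec_b_omega.
Qed.

Lemma A_totally_positive k : totally_positive (A k).
Proof. by split; [exact: emb1_A_gt0|exact: emb2_A_gt0]. Qed.

(** Let x = s + t omega. For t = 0 no integer lies strictly between 0 and 1. Otherwise omega > 1
    bounds the integer s + t on one side, and omega' < 1 then pushes x' out of the interval from 0
    to 1. *)
Lemma one_indecomposable x y : dec_b D x -> dec_b D y -> totally_positive x ->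
  totally_positive y -> x + y <> 1.
Proof.
move=> [s [t xE]] _ [x1 x2] [y1 y2] xy.
have yE : y = 1 - x by rewrite -xy addrC addKr.
have [o1 o2 o3] := dec_omega_reduced D.
have e1 : s1 x = s%:~R + t%:~R * s1 (dec_omega D).
  by rewrite xE /emb1 rmorphD !rmorphM !rmorph_int rmorph1 mulr1.
have e2 : s2 x = s%:~R + t%:~R * s2 (dec_omega D).
  by rewrite xE /emb2 !rmorphD !rmorphM !rmorph_int !rmorph1 mulr1.
have x3 : s1 x < 1.
  by move: y1; rewrite yE {1}/emb1 rmorphB rmorph1 subr_gt0.
have x4 : s2 x < 1.
  by move: y2; rewrite yE {1}/emb2 !rmorphB !rmorph1 subr_gt0.
move: x1 x2 x3 x4; rewrite e1 e2; move: (s1 _) (s2 _) o1 o2 o3 => a b h1 h2 h3.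
have [t0|[t0|t0]] : t = 0 \/ (1 <= t \/ t <= -1) by lia.
- rewrite t0 !mul0r !addr0 ltr0z => i1 _ i2 _.
  by move: i2; rewrite -(mulr1z 1) ltr_int; lia.
- have t1 : 1 <= t%:~R :> R by rewrite -(mulr1z 1) ler_int.
  move=> i1 i2 i3 i4; have : (s + t)%:~R < 1%:~R :> R by rewrite intrD; nra.
  rewrite ltr_int => st; have : s <= - t by clear -st; lia.
  by rewrite -(ler_int R) intrN; nra.
- have t1 : t%:~R <= -1 :> R by rewrite -(mulrN1z 1) ler_int.
  move=> i1 i2 i3 i4; have : 0 < (s + t)%:~R :> R by rewrite intrD; nra.
  rewrite ltr0z => st; have : - t + 1 <= s by clear -st; lia.
  by rewrite -(ler_int R) intrD intrN; nra.
Qed.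

(** As 0 < 1 / w_(i+1) < 1, the digit b_i is determined by w_i, and so is w_(i+1). *)
Lemma w_eq_cf (j k : int) : w j = w k -> forall n : nat, cf (j + n%:Z) = cf (k + n%:Z).
Proof.
have H (i l : int) : w i = w l -> cf i = cf l /\ w (i + 1) = w (l + 1).
  move=> E; have := emb1_w_rec i; have := emb1_w_rec l; rewrite E.
  have inv01 (a : R) : 1 < a -> 0 < a^-1 < 1.
    by move=> a1; rewrite invr_gt0 (lt_trans ltr01)//= invf_lt1// (lt_trans ltr01).
  have := inv01 _ (w_gt1 (i + 1)); have := inv01 _ (w_gt1 (l + 1)) => h1 h2 E1 E2.
  have il : cf i = cf l.
    have : (cf i - cf l)%:~R < 1%:~R :> R by rewrite intrB; lra.
    have : (- 1)%:~R < (cf i - cf l)%:~R :> R by rewrite intrB rmorphN; lra.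
    by rewrite !ltr_int; lia.
  split=> //; apply: emb1_inj; apply: invr_inj.
  by rewrite -il in E1; lra.
move=> E n; have : w (j + n%:Z) = w (k + n%:Z).
  elim: n => [|n IH]; first by rewrite !addr0.
  by have [_] := H _ _ IH; rewrite -!addrA -[n%:Z + 1]/(n%:Z + 1%:Z) -PoszD addn1.
by move=> /H[].
Qed.

Lemma A_period_unit : ray_units (@OK R K) (A m)^-1.
Proof.
have [h1 h2] := OK_period; split; [exact: h2|by rewrite invrK|
  exact/totally_positiveV/A_totally_positive|].
by apply: OKB => //; exact: OK1.
Qed.

Lemma dec_b_ideal x y : OK x -> dec_b D y -> dec_b D (x * y).
Proof. by have [_ H _ _] := dec_b_fractional D; exact: H. Qed.

(* As 1 is indecomposable, so is the unit [e]; being a nonnegative combination of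
   neighbours A_(j-1), A_j, it is one of them. *)
Lemma unit_index e (n : nat) : OK e -> OK e^-1 -> totally_positive e -> A m = e ^+ n.+1 ->
  exists2 j : nat, (j <= m)%N & A j = e.
Proof.
move=> Oe Oe' [e1 e2] An.
have be : dec_b D e by rewrite -[e]mulr1; apply: dec_b_ideal dec_b1.
have m0 := dec_period_gt0 D.
have [p mE] : exists p, m = p.+1 by case: (dec_period D) m0 => // p _; exists p.
have d1 := emb1_A_decr 0 p; have d2 := emb2_A_incr 0 p.
rewrite add0r -mE An dec_A0 emb1X [ltRHS]rmorph1 in d1.
rewrite add0r -mE An dec_A0 emb2X [ltLHS](rmorph1 (qemb K \o qconj K)) in d2.
have lt1 : s1 e < 1.
  by rewrite ltNge; apply/negP => h; have := exprn_ege1 n.+1 h; rewrite leNgt d1.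
have gt1 : 1 < s2 e.
  by rewrite ltNge; apply/negP => h; have := exprn_ile1 n.+1 (ltW e2) h; rewrite leNgt d2.
have Pm : det (A m) e <= 0.
  rewrite /det An emb1X emb2X !exprSr.
  have h1 := exprn_ile1 n (ltW e1) (ltW lt1); have h2 := exprn_ege1 n (ltW gt1).
  move: (_ ^+ n) (_ ^+ n) h1 h2 => a b h1 h2; have := mulr_gt0 e1 e2.
  by move: (s1 e) (s2 e) => c d cd; nra.
(* The first index at which A_j reaches or passes the ray of [e]; then [e] lies in the cone of that
   A_j and its predecessor, which span the lattice. *)
have ex : exists j : nat, det (A j) e <= 0 by exists m.
pose j := ex_minn ex; have : det (A j) e <= 0 /\ (forall i : nat, det (A i) e <= 0 -> (j <= i)%N).
  by rewrite /j; case: ex_minnP.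
move: j => [|j] [hj minj].
  move: hj; rewrite /det dec_A0 /emb1 /emb2 !rmorph1 !mul1r -/(s1 e) -/(s2 e); lra.
exists j.+1; first exact: minj.
have hj' : 0 < det (A j) e.
  by rewrite ltNge; apply/negP => /minj; rewrite ltnn.
have bjj := dec_b_zspan j.+1; rewrite (_ : j.+1%:Z - 1 = j) in bjj; last by lia.
have [p' [q eE]] : zspan (A j) (A j.+1) e by rewrite -bjj.
have dj := det_AS j; rewrite -PoszD addn1 in dj.
have p0 : 0 <= p'.
  have : det (A j.+1) e = - (ratr p'%:~R * det (A j) (A j.+1)).
    by rewrite detC eE !intr_scale det_combl detxx mulr0 addr0.
  by move=> E; move: hj; rewrite E oppr_le0 pmulr_lge0// ler0q ler0z.
have q0 : 0 < q.
  have : det (A j) e = ratr q%:~R * det (A j) (A j.+1).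
    by rewrite detC eE !intr_scale det_combl detxx mulr0 add0r -mulrN -detC.
  by move=> E; move: hj'; rewrite E pmulr_lgt0// ltr0q ltr0z.
have [pq|pq] : (p' = 0 /\ q = 1) \/ (0 < p' \/ 0 < q - 1) by clear -p0 q0; lia.
  by rewrite eE pq.1 pq.2 mul0r add0r mul1r.
pose y := p'%:~R * A j + (q - 1)%:~R * A j.+1.
have ey : A j.+1 + y = e by rewrite eE /y rmorphB /=; ring.
have by_ : dec_b D y.
  by rewrite bjj; apply: zspanD; apply: zspanZ; [exact: zspanl|exact: zspanr].
have yp : totally_positive y.
  have [a1 a2] := A_totally_positive j; have [a3 a4] := A_totally_positive j.+1.
  have q1 : 0 <= q - 1 by clear -q0; lia.
  have pos (s : {rmorphism K -> R}) : 0 < s (A j) -> 0 < s (A j.+1) -> 0 < s y.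
    move=> b1 b2; rewrite rmorphD !rmorphM !rmorph_int.
    case: pq => h; [rewrite ltr_wpDr//|rewrite ltr_wpDl//].
    - by rewrite mulr_ge0 ?ler0z// ltW.
    - by rewrite mulr_gt0 ?ltr0z.
    - by rewrite mulr_ge0 ?ler0z// ltW.
    - by rewrite mulr_gt0 ?ltr0z.
  by split; [exact: (pos (qemb K))|exact: (pos (qemb K \o qconj K))].
(* Otherwise [e] is A_(j+1) plus a totally positive lattice element; dividing by the unit [e]
   decomposes 1. *)
exfalso; apply: (@one_indecomposable (e^-1 * A j.+1) (e^-1 * y)).
- exact: dec_b_ideal (dec_b_A _).
- exact: dec_b_ideal.
- by apply: totally_positiveM (A_totally_positive _); exact: totally_positiveV.
- by apply: totally_positiveM yp; exact: totally_positiveV.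
rewrite -mulrDr ey mulVf//; apply/eqP => E; by rewrite E /emb1 rmorph0 ltxx in e1.
Qed.

(** Since e b = b, the numbers w_j and omega span the same lattice together with 1, so w_j = p omega
    + q with p p' = 1. Reducedness gives p > 0, hence p = 1, and then q = 0. The digits therefore
    have period j. *)
Lemma unit_index_period e (j : nat) : OK e -> OK e^-1 -> totally_positive e -> (0 < j)%N ->
  A j = e -> (m <= j)%N.
Proof.
move=> Oe Oe' [e1 e2] j0 Aj; apply: dec_period_min => // k.
have e0 : e != 0 by rewrite -Aj A_neq0.
have : zspan (A (j%:Z - 1)) (A j) = zspan (e * dec_omega D) e.
  rewrite -dec_b_zspan; apply/seteqP; split=> x.
    move=> bx; have := dec_b_ideal Oe' bx; rewrite /dec_b zspanC => /(zspanM e).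
    by rewrite mulr1 mulrA divff// mul1r.
  apply: zspan_sub; first exact: dec_b_ideal dec_b_omega.
  by have := dec_b_ideal Oe dec_b1; rewrite mulr1.
rewrite A_pred Aj => E.
have [p [q h1]] : zspan (e * dec_omega D) e (w j * e) by rewrite -E; exact: zspanl.
have [p' [q' h2]] : zspan (w j * e) e (e * dec_omega D) by rewrite E; exact: zspanl.
have wE : w j = p%:~R * dec_omega D + q%:~R by apply: (mulIf e0); rewrite h1; ring.
have oE : dec_omega D = p'%:~R * w j + q'%:~R by apply: (mulIf e0); rewrite mulrC h2; ring.
have [o1 o2 o3] := dec_omega_reduced D; have /andP[w1 w2] := emb2_w j; have w3 := w_gt1 j.
have lin (s : {rmorphism K -> R}) : s (w j) = p%:~R * s (dec_omega D) + q%:~R.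
  by rewrite wE rmorphD rmorphM !rmorph_int.
have E1 : s1 (w j) = p%:~R * s1 (dec_omega D) + q%:~R := lin (qemb K).
have E2 : s2 (w j) = p%:~R * s2 (dec_omega D) + q%:~R := lin (qemb K \o qconj K).
have F1 : s1 (dec_omega D) = p'%:~R * s1 (w j) + q'%:~R.
  by rewrite {1}oE /emb1 rmorphD rmorphM !rmorph_int.
have F2 : s2 (dec_omega D) = p'%:~R * s2 (w j) + q'%:~R.
  by rewrite {1}oE /emb2 !rmorphD !rmorphM !rmorph_int.
have wj : w j = dec_omega D.
  move: E1 E2 F1 F2 w1 w2 w3 o1 o2 o3.
  move: (s1 (w j)) (s2 (w j)) (s1 (dec_omega D)) (s2 (dec_omega D)).
  move=> a b c d E1 E2 F1 F2 w1 w2 w3 o1 o2 o3.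
  have ab : 0 < a - b by lra.
  have cd : 0 < c - d by lra.
  have G1 : a - b = p%:~R * (c - d) by rewrite E1 E2; ring.
  have G2 : c - d = p'%:~R * (a - b) by rewrite F1 F2; ring.
  have p0 : 0 < p by move: ab; rewrite G1 pmulr_lgt0// ltr0z.
  have p'0 : 0 < p' by move: cd; rewrite G2 pmulr_lgt0// ltr0z.
  have /eqP : (p * p')%:~R * (a - b) = 1%:~R * (a - b) by rewrite intrM -mulrA -G2 -G1 mul1r.
  rewrite -subr_eq0 -mulrBl mulf_eq0 (gt_eqF ab) orbF subr_eq0 => /eqP/intr_inj pp.
  have p1 : p = 1 by clear -p0 p'0 pp; nia.
  rewrite wE p1 mul1r; rewrite p1 mul1r in E2.
  have : q%:~R < 1%:~R :> R by rewrite mulr1z; lra.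
  have : (-1)%:~R < q%:~R :> R by rewrite mulrN1z; lra.
  rewrite !ltr_int => q1 q2; have -> : q = 0 by clear -q1 q2; lia.
  by rewrite addr0.
have cfE := @w_eq_cf j 0; rewrite dec_w0 in cfE; have {}cfE := cfE wj.
(* [w_eq_cf] concerns nonnegative offsets only; |k| periods are added first. *)
rewrite -(dec_cf_shift k `|k|%N) -(dec_cf_shift (k + j) `|k|%N).
have [n nE] : exists n : nat, k + `|k|%N%:Z * m%:Z = n%:Z.
  have := dec_period_gt0 D; move: (dec_period D) => m' m0.
  by exists `|(k + `|k|%N%:Z * m'%:Z : int)|%N; clear -m0; nia.
have := cfE n; rewrite add0r => cn_; rewrite addrAC !nE -cn_; congr (cf _); exact: addrC.
Qed.

(** A_m is a negative power of the fundamental unit, as its first embedding is below 1. [unit_index]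
    finds the inverse fundamental unit among the A_j with j <= m, and minimality of the period
    forces j = m. *)
Lemma A_period_inv e : ray_unit_generator (@OK R K) e -> A m = e^-1.
Proof.
move=> [[Oe Oe' ep _] e1 gen]; have [n nE] := gen _ A_period_unit.
have [ip1 ip2] := ep.
have Am : s1 (A m) < 1.
  have m0 := dec_period_gt0 D; have := emb1_A_decr 0 m.-1.
  by rewrite add0r prednK// dec_A0 [ltRHS]rmorph1.
case: n nE => [[|n]|n] nE.
- by move: Am; rewrite -[A m]invrK nE expr0z invr1 [ltLHS]rmorph1 ltxx.
- have An : A m = e^-1 ^+ n.+1 by rewrite -[A m]invrK nE exprVn.
  have Oe'' : OK e^-1^-1 by rewrite invrK.
  have [j jm Aj] := unit_index Oe' Oe'' (totally_positiveV ep) An.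
  have [j0|j0] := posnP j.
    by move: e1; rewrite -[e]invrK -Aj j0 dec_A0 invr1 [ltRHS]rmorph1 ltxx.
  have := unit_index_period Oe' Oe'' (totally_positiveV ep) j0 Aj => mj.
  by rewrite -Aj; congr (A _); congr Posz; apply/eqP; rewrite eqn_leq jm mj.
- have : s1 (A m) = s1 e ^+ n.+1 by rewrite -[A m]invrK nE NegzE -exprnN invrK emb1X.
  by move=> E; move: Am; rewrite E ltNge exprn_ege1// ltW.
Qed.

End Expansion.

(** * Ray classes *)

Section Ideals.
Variables (R : realType) (K : realQuadratic R).
Implicit Types (x y z c : K) (I J M f : set K).
Local Notation OK := (@OK R K).

(** Weaker than [fractional_ideal], so that inverses and products satisfy it without any bound on
    denominators. *)
Definition OK_submodule M :=
  [/\ M 0, forall x y, M x -> M y -> M (x + y) & forall c x, OK c -> M x -> M (c * x)].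

Lemma submodule_sum M (n : nat) (g : 'I_n -> K) : OK_submodule M ->
  (forall i, M (g i)) -> M (\sum_(i < n) g i).
Proof. by move=> [M0 MD _] H; elim/big_ind: _. Qed.

Lemma submodule_ideal_mul I J : OK_submodule I -> OK_submodule (ideal_mul I J).
Proof.
move=> [I0 ID IM]; split.
- exists 0%N, (fun=> 0), (fun=> 0); split=> [[]//|[]//|].
  by rewrite big_ord0.
- move=> _ _ [n [u [v [hu hv ->]]]] [n' [u' [v' [hu' hv' ->]]]].
  exists (n + n')%N,
    (fun i : 'I_(n + n') => match fintype.split i with inl j => u j | inr j => u' j end),
    (fun i : 'I_(n + n') => match fintype.split i with inl j => v j | inr j => v' j end); split.
  + by move=> i; case: fintype.split.
  + by move=> i; case: fintype.split.
  rewrite big_split_ord /=; congr (_ + _); apply: eq_bigr => i _.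
    by rewrite (unsplitK (inl i)).
  by rewrite (unsplitK (inr i)).
- move=> c _ Oc [n [u [v [hu hv ->]]]].
  exists n, (fun i => c * u i), v; split=> //; first by move=> i; exact: IM.
  by rewrite mulr_sumr; apply: eq_bigr => i _; rewrite mulrA.
Qed.

Lemma ideal_mul_mem I J x y : I x -> J y -> ideal_mul I J (x * y).
Proof.
by move=> Ix Jy; exists 1%N, (fun=> x), (fun=> y); split=> //; rewrite big_ord1.
Qed.

Lemma submodule_fractional I : fractional_ideal I -> OK_submodule I.
Proof.
move=> [IB IM [x Ix _] _]; have I0 : I 0 by have := IB _ _ Ix Ix; rewrite subrr.
split=> // u v Iu Iv; rewrite -[v]opprK; apply: (IB _ _ Iu).
by rewrite -sub0r; exact: IB.
Qed.

Lemma submodule_inv I : OK_submodule (ideal_inv I).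
Proof.
split; first by move=> y _; rewrite mul0r; exact: OK0.
- by move=> x y hx hy z Iz; rewrite mulrDl; apply: OKD; [exact: hx|exact: hy].
- by move=> c x Oc hx z Iz; rewrite -mulrA; apply: OKM => //; exact: hx.
Qed.

Lemma principalM c M x : c != 0 -> OK_submodule M ->
  ideal_mul (principal c) M x <-> M (x / c).
Proof.
move=> c0 sM; split.
  move=> [n [u [v [hu hv ->]]]]; rewrite mulr_suml; apply: submodule_sum => // i.
  have [y Oy <-] := hu i; rewrite [c * y]mulrC -mulrA mulrAC mulrA mulrAC mulfK//.
  by have [_ _] := sM; apply.
move=> Mx; rewrite -[x](divfK c0) mulrC; apply: ideal_mul_mem => //.
by exists 1; [exact: OK1|rewrite mulr1].
Qed.

Lemma ideal_inv_scale I J c x : c != 0 -> (forall y, J y <-> I (y / c)) ->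
  ideal_inv J x <-> ideal_inv I (x * c).
Proof.
move=> c0 H; split=> h y hy.
  rewrite -mulrA; apply: h; apply/H; by rewrite mulrAC divff// mul1r.
by rewrite -[y](divfK c0) [_ * c]mulrC mulrA; apply: h; apply/H.
Qed.

Lemma mult_cong1M f a b : OK_submodule f -> mult_cong1 f a -> mult_cong1 f b ->
  mult_cong1 f (a * b).
Proof.
move=> [f0 fD fM] [x [y [[Ox x0 cx] [Oy y0 cy] fxy ->]]] [x' [y' [[Ox' x0' cx'] [Oy' y0' cy'] fxy' ->]]].
have cop u v : OK u -> OK v -> coprime_ideal (principal u) f -> coprime_ideal (principal v) f ->
    coprime_ideal (principal (u * v)) f.
  move=> Ou Ov [_ [t [[s Os <-] ft E]]] [_ [t' [[s' Os' <-] ft' E']]].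
  exists (u * v * (s * s')), (t + (u * s) * t'); split.
  - by exists (s * s') => //; exact: OKM.
  - by apply: fD => //; apply: fM => //; exact: OKM.
  - have -> : u * v * (s * s') + (t + u * s * t') = u * s * (v * s' + t') + t by ring.
    by rewrite E' mulr1.
exists (x * x'), (y * y'); split.
- by split; [exact: OKM|exact: mulf_neq0|exact: cop].
- by split; [exact: OKM|exact: mulf_neq0|exact: cop].
- have -> : x * x' - y * y' = x' * (x - y) + y * (x' - y') by ring.
  by apply: fD; exact: fM.
- by rewrite invfM; ring.
Qed.

Lemma mult_cong1V f a : OK_submodule f -> mult_cong1 f a -> mult_cong1 f a^-1.
Proof.
move=> [f0 fD fM] [x [y [hx hy fxy ->]]]; exists y, x; split=> //; last by rewrite invf_div.
by rewrite -opprB -mulN1r; apply: fM => //; apply: OKN; exact: OK1.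
Qed.

Lemma mult_cong1_integral f a : OK_submodule f -> OK a -> a != 0 -> f (a - 1) -> mult_cong1 f a.
Proof.
move=> [f0 fD fM] Oa a0 fa; exists a, 1; split=> //; last by rewrite divr1.
  split=> //; exists a, (1 - a); split; last by rewrite addrC subrK.
    by exists 1; [exact: OK1|rewrite mulr1].
  by rewrite -opprB -mulN1r; apply: fM => //; apply: OKN; exact: OK1.
split; [exact: OK1|exact: oner_neq0|].
by exists 1, 0; split=> //; [exists 1; [exact: OK1|rewrite mulr1]|rewrite addr0].
Qed.

Lemma coprime_fractional_submodule f I : coprime_fractional f I -> OK_submodule I.
Proof.
move=> [J1 [J2 [[[h1 _] _] _ ->]]]; apply: submodule_ideal_mul; exact: submodule_fractional.
Qed.

Lemma coprime_fractional_unit f I : coprime_fractional f I ->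
  exists t u, [/\ I t, f u & t + u = 1].
Proof.
move=> [J1 [J2 [[_ [t [u [Jt fu tu]]]] [[_ J2O] _] ->]]].
exists t, u; split=> //; rewrite -[t]mulr1; apply: ideal_mul_mem => // y /J2O.
by rewrite mul1r.
Qed.

(* For b = z a^-1 f this says that multiplication by [c] maps z into z + b. *)
Lemma mult_cong1_inv f I c : OK_submodule f -> f `<=` OK -> I `<=` OK -> coprime_fractional f I ->
  mult_cong1 f c -> (forall y, I y -> OK (c * y)) ->
  ideal_mul (ideal_inv I) f (c - 1).
Proof.
move=> sf fO IO cI [x [y [[Ox x0 cx] [Oy y0 cy] fxy cE]]] Ic.
have [f0 fD fM] := sf.
have [t [u [It fu tu]]] := coprime_fractional_unit cI.
have [_ [w [[s Os <-] fw sw]]] := cy.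
have h (v : K) : I v -> OK ((c - 1) * v).
  by move=> Iv; rewrite mulrBl mul1r; apply: OKB; [exact: Ic|exact: IO].
(* Insert 1 = y s + w with w in f, where c = x / y: then c y - y = x - y lies in f. *)
have ft : f ((c - 1) * t).
  have -> : (c - 1) * t = (c - 1) * t * (y * s) + (c - 1) * t * w by rewrite -mulrDr sw mulr1.
  apply: fD; last by apply: fM => //; exact: h.
  have -> : (c - 1) * t * (y * s) = t * s * (c * y - y) by ring.
  rewrite {1}cE divfK//.
  by apply: fM => //; apply: OKM => //; exact: IO.
have [m0 mD mM] := submodule_ideal_mul f (submodule_inv I).
have -> : c - 1 = (c - 1) * t + (c - 1) * u by rewrite -mulrDr tu mulr1.
apply: mD.
  rewrite -[X in ideal_mul _ _ X]mul1r; apply: ideal_mul_mem => // v Iv.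
  by rewrite mul1r; exact: IO.
by apply: ideal_mul_mem.
Qed.

End Ideals.

Section Twist.
Variables (R : realType) (K : realQuadratic R) (f : set K).
Hypothesis hf : integral_ideal f.
Local Notation OK := (@OK R K).

Let sf : OK_submodule f. Proof. by apply: submodule_fractional; case: hf. Qed.
Let fO : f `<=` OK. Proof. by case: hf. Qed.

Lemma ray_class_scale I J : coprime_fractional f I -> ray_class f I J ->
  exists2 c, totally_positive c /\ mult_cong1 f c & forall x, J x <-> I (x / c).
Proof.
move=> cI [_ [c [cp c1 ->]]]; exists c => // x; apply: principalM.
  by apply: emb1_neq0; case: cp.
exact: coprime_fractional_submodule cI.
Qed.

Lemma submodule_principal (x : K) : OK_submodule (principal x).
Proof.
split.
- by exists 0; [exact: OK0|rewrite mulr0].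
- move=> _ _ [y Oy <-] [z Oz <-]; exists (y + z); [exact: OKD|by rewrite mulrDr].
- by move=> c _ Oc [y Oy <-]; exists (c * y); [exact: OKM|rewrite mulrCA].
Qed.

Variables (cl : set (set K)) (D : decomposition f cl).
Variables (mu2 : K) (D' : decomposition f (ray_class_mul cl (ray_class f (principal mu2)))).
Hypotheses (hcl : ray_class_group f cl) (hmu2 : f (mu2 - 1)).
Hypotheses (mu2_pos : 0 < emb1 mu2) (mu2_neg : emb2 mu2 < 0).

Lemma dec_a_coprime : coprime_fractional f (dec_a D).
Proof.
by have := dec_a_class D; move: (dec_a D) => a; have [I _ <-] := hcl; case.
Qed.

(** Everything is compared with one representative I of the class: a is be I, and a' is the product
    of de I and the principal ideal of al mu2. The negative conjugate comes from mu2 alone. *)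
Lemma twist_exists : exists c, [/\ 0 < emb1 c, emb2 c < 0, mult_cong1 f c &
  forall x, dec_a D' x <-> dec_a D (x / c)].
Proof.
have mu0 := emb1_neq0 mu2_pos.
have Omu : OK mu2 by have := OKD (fO hmu2) (@OK1 R K); rewrite subrK.
have mu1 := mult_cong1_integral sf Omu mu0 hmu2.
have := dec_a_class D'; have := dec_a_class D; move: (dec_a D') (dec_a D) => a' a.
have [I cI <-] := hcl => aI.
move=> [I1 I1I [J1 [cJ1 [al [alp al1 J1E]]] aE]].
have [be [bep be1] aH] := ray_class_scale cI aI.
have [de [dep de1] I1H] := ray_class_scale cI I1I.
have al0 := emb1_neq0 alp.1; have be0 := emb1_neq0 bep.1; have de0 := emb1_neq0 dep.1.
have sI := coprime_fractional_submodule cI.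
have sJ : OK_submodule (principal mu2) by exact: submodule_principal.
have J1H x : J1 x <-> OK (x / (al * mu2)).
  rewrite J1E principalM// invfM mulrA; split=> [[y Oy E]|h].
    by rewrite -E mulrC mulKf.
  by exists (x / al / mu2) => //; rewrite mulrC divfK.
exists (de * (al * mu2) / be); split.
- rewrite !emb1M emb1V; case: alp bep dep => [? _] [? _] [? _].
  by rewrite divr_gt0// !mulr_gt0.
- rewrite !emb2M emb2V; case: alp bep dep => [_ ?] [_ ?] [_ ?].
  by rewrite pmulr_llt0 ?invr_gt0// !pmulr_rlt0.
- by apply: mult_cong1M => //; [apply: mult_cong1M => //; exact: mult_cong1M|exact: mult_cong1V].
move=> x; rewrite aH -aE.
have -> : x / (de * (al * mu2) / be) / be = x / (al * mu2) / de.
  by apply: (mulIf be0); rewrite divfK// invf_div invfM; ring.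
split.
  move=> [n [u [v [hu hv ->]]]]; rewrite !mulr_suml; apply: submodule_sum => // i.
  have /J1H h := hv i; have /I1H h' := hu i; have [_ _] := sI => /(_ _ _ h h').
  by rewrite (_ : _ * _ = u i * v i / (al * mu2) / de)//; ring.
move=> h; rewrite -[x](@divfK _ (al * mu2)) ?mulf_neq0//; apply: ideal_mul_mem.
  exact/I1H.
by apply/J1H; rewrite divff ?mulf_neq0//; exact: OK1.
Qed.

Lemma ideal_mul_scale (I I' J : set K) c x : c != 0 -> (forall y, I' y <-> I (y * c)) ->
  ideal_mul I' J x <-> ideal_mul I J (x * c).
Proof.
move=> c0 H; split=> -[n [u [v [hu hv E]]]].
  exists n, (fun i => u i * c), v; split=> //; first by move=> i; apply/H.
  by rewrite E mulr_suml; apply: eq_bigr => i _; rewrite mulrAC.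
exists n, (fun i => u i / c), v; split=> //; first by move=> i; apply/H; rewrite divfK.
by apply: (mulIf c0); rewrite E mulr_suml; apply: eq_bigr => i _; rewrite mulrAC divfK.
Qed.

Lemma dec_bP cl0 (D0 : decomposition f cl0) x :
  dec_b D0 x <-> ideal_mul (ideal_inv (dec_a D0)) f (x / dec_z D0).
Proof.
rewrite dec_bE; apply: principalM; first by apply: emb1_neq0; case: (dec_z_pos D0).
exact/submodule_ideal_mul/submodule_inv.
Qed.

(* With a' = c a one may take l = z' / (c z). *)
Lemma twist_lattice : exists l, [/\ 0 < emb1 l, emb2 l < 0,
  forall x, dec_b D' x <-> dec_b D (x / l) & dec_b D (dec_z D' / l - dec_z D)].
Proof.
have [c [c1 c2 cc H]] := twist_exists; have c0 := emb1_neq0 c1.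
have [z1 z2] := dec_z_pos D; have [z'1 z'2] := dec_z_pos D'.
have z0 := emb1_neq0 z1; have z'0 := emb1_neq0 z'1.
exists (dec_z D' / (c * dec_z D)); split.
- by rewrite emb1M emb1V emb1M divr_gt0// mulr_gt0.
- by rewrite emb2M emb2V emb2M pmulr_rlt0// invr_lt0 pmulr_llt0.
- move=> x; rewrite !dec_bP.
  rewrite (ideal_mul_scale (I := ideal_inv (dec_a D)) f (x / dec_z D') c0); last first.
    by move=> y; exact: ideal_inv_scale.
  rewrite (_ : x / _ / _ = x / dec_z D' * c)//.
  by apply: (mulIf z0); rewrite divfK// invf_div; ring.
rewrite dec_bP.
have -> : (dec_z D' / (dec_z D' / (c * dec_z D)) - dec_z D) / dec_z D = c - 1.
  by rewrite invf_div mulrCA divff// mulr1 mulrBl mulfK// divff.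
have [_ aO] := dec_a_integral D; have [_ a'O] := dec_a_integral D'.
apply: mult_cong1_inv => //; first exact: dec_a_coprime.
by move=> y ay; apply/a'O/H; rewrite mulrC mulKf.
Qed.

Lemma dec_z_mul x : f x -> dec_b D (dec_z D * x).
Proof.
move=> fx; have [z1 _] := dec_z_pos D; have [_ aO] := dec_a_integral D.
apply/dec_bP; rewrite mulrC mulKf ?emb1_neq0// -[x]mul1r; apply: ideal_mul_mem => // y.
by move=> /aO; rewrite mul1r.
Qed.

Lemma dec_stable e : OK e -> OK e^-1 -> e != 0 -> f (e - 1) -> stable (dec_b D) (dec_z D) e.
Proof.
move=> Oe Oe' e0 fe; split.
  by have := dec_z_mul fe; rewrite mulrBr mulr1 mulrC.
move=> x; split; last exact: dec_b_ideal.
by move=> /(dec_b_ideal Oe'); rewrite mulKf.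
Qed.

(** If z were in b = z a^-1 f, then 1 would be in a^-1 f. Multiplying by t in a, where t + w = 1 and
    w is in f, puts t and hence 1 into f. *)
Lemma dec_z_notin : f <> OK -> ~ dec_b D (dec_z D).
Proof.
move=> fOK /dec_bP; have [z1 _] := dec_z_pos D; rewrite divff ?emb1_neq0// => -[n [u [v [hu hv E]]]].
have [t [w [at_ fw tw]]] := coprime_fractional_unit dec_a_coprime.
have [f0 fD fM] := sf.
have ft : f t.
  rewrite -[t]mul1r E mulr_suml; apply: submodule_sum => // i.
  by rewrite mulrAC; apply: fM => //; exact: hu.
have f1 : f 1 by rewrite -tw; exact: fD.
apply: fOK; apply/seteqP; split=> // x Ox; rewrite -[x]mulr1; exact: fM.
Qed.

End Twist.

(** * The two identities *)

Section Assembly.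
Variables (R : realType) (K : realQuadratic R).
Local Notation OK := (@OK R K).
Local Notation s2 := (qemb K \o qconj K).
Implicit Types (f L : set K) (z u v e : K).

Lemma sector_log_scale (sg : {rmorphism K -> R}) L L' z u v e c : 0 < sg e -> 0 < sg u ->
  0 < sg v -> (forall x, L' x <-> L (x / e)) ->
  sector_log sg L z u v c -> sector_log sg L' (e * z) (e * u) (e * v) c.
Proof.
move=> e0 u0 v0 H h; have e0' := sg_neq0 e0.
have E z0 : coset L' (e * z0) = scale_set e (coset L z0).
  apply/seteqP; split=> [x /H|_ [x xz <-]].
    by rewrite mulrBl [e * z0]mulrC mulfK// => h'; exists (x / e) => //; rewrite mulrC divfK.
  by apply/H; rewrite -mulrBr mulrC mulKf.
rewrite /sector_log -mulrN !E -[secR (e * u) _]secLR -!scale_secL -!scale_setI//.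
apply: reg2_scale => //; last by move: h; rewrite /sector_log -secLR.
  by move=> x [_]; exact: secL_gt0.
by move=> x [_]; exact: secL_gt0.
Qed.

Lemma sector_log_coset (sg : {rmorphism K -> R}) L z z' u v c : full_lattice L -> L (z - z') ->
  sector_log sg L z u v c -> sector_log sg L z' u v c.
Proof.
move=> fL Lz; rewrite /sector_log (coset_sub fL Lz).
suff -> : coset L (- z) = coset L (- z') by [].
by apply: coset_sub => //; rewrite -opprD; exact: latticeN.
Qed.

Lemma ray_unit_power f (eps epsf : K) (r : nat) : f `<=` OK ->
  ray_unit_generator OK eps -> ray_unit_generator f epsf ->
  r%:R = ln (emb1 epsf) / ln (emb1 eps) -> (0 < r)%N /\ epsf = eps ^+ r.
Proof.
move=> fO [_ e1 gen] [[Of Of' fp ff] ef1 _] rE.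
have l1 : 0 < ln (emb1 eps) by rewrite ln_gt0.
have lf : 0 < ln (emb1 epsf) by rewrite ln_gt0.
have r0 : (0 < r)%N by rewrite -(ltr0n R) rE divr_gt0.
split=> //; have [|n nE] := gen epsf.
  by split=> //; exact: fO.
have ep0 : 0 < emb1 eps by exact: lt_trans ltr01 e1.
case: n nE => [n|n] nE.
  have : ln (emb1 epsf) = n%:R * ln (emb1 eps).
    by rewrite nE emb1X lnXn// mulr_natl.
  move=> E; move: rE; rewrite E mulfK ?gt_eqF// => /eqP.
  by rewrite eqr_nat => /eqP ->.
exfalso; move: ef1; rewrite nE NegzE -exprnN emb1V emb1X ltNge invf_le1 ?exprn_gt0//.
by rewrite exprn_ege1// ltW.
Qed.

Lemma A_ray_unit f cl (D : decomposition f cl) (eps epsf : K) (r : nat) : f `<=` OK ->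
  ray_unit_generator OK eps -> ray_unit_generator f epsf ->
  r%:R = ln (emb1 epsf) / ln (emb1 eps) ->
  exists2 n : nat, n.+1 = (r * dec_period D)%N & dec_A D n.+1 = epsf^-1.
Proof.
move=> fO heps hepsf hr; have [r0 eE] := ray_unit_power fO heps hepsf hr.
have rm : (0 < r * dec_period D)%N by rewrite muln_gt0 r0 dec_period_gt0.
exists (r * dec_period D).-1; rewrite prednK//.
by rewrite A_muln_period (A_period_inv D heps) exprVn -eE.
Qed.

Lemma sector_log_period f cl (D : decomposition f cl) (sg : {rmorphism K -> R})
    (eps epsf : K) (r : nat) : f `<=` OK -> (forall k, 0 < sg (dec_A D k)) ->
  ray_unit_generator OK eps -> ray_unit_generator f epsf ->
  r%:R = ln (emb1 epsf) / ln (emb1 eps) ->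
  exists2 c, sector_log sg (dec_b D) (dec_z D) 1 epsf^-1 c & invariant_at sg r D = expR c.
Proof.
move=> fO A0 heps hepsf hr; have [n nE AE] := A_ray_unit D fO heps hepsf hr.
eexists; last exact: invariant_atE.
by have := decomposition_sector n A0; rewrite dec_A0 AE nE.
Qed.

(* Clockwise, the rays are e, 1, m, e m: the cone of (e, e m) is cut at 1
   and m, and is also e times the cone of (1, m). The swap from (1, e) to (e, 1) is
   what needs [~ L z]. *)
Lemma sector_identity1 (v z e m : K) (c c' : R) (L := zspan 1 v) :
  det 1 v != 0 -> 0 < emb1 v -> stable L z e -> ~ L z ->
  0 < emb1 e < 1 -> 1 < emb2 e -> L m -> 0 < emb1 m -> emb2 m < 0 ->
  sector_log (qemb K) L z 1 e c -> sector_log (qemb K) L z m (e * m) c' -> c + c' = 0.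
Proof.
move=> dv v0 ez nz /andP[e0 e1] e2 Lm m1 m2 h h'.
have fL : full_lattice L by exists 1, v.
have o0 : 0 < qemb K 1 by rewrite rmorph1.
have e2' : 0 < emb2 e by exact: lt_trans e2.
have d1e : 0 < det 1 e by rewrite /det emb1_1 emb2_1; lra.
have d1m : det 1 m < 0 by rewrite /det emb1_1 emb2_1; lra.
have dem : det e m < 0 by rewrite /det; nra.
have d1em : det m (e * m) < 0.
  by rewrite det_mul pmulr_llt0 ?pmulr_rlt0// subr_gt0; exact: lt_trans e2.
have deem : det e (e * m) < 0 by rewrite -{1}[e]mulr1 detM pmulr_rlt0 ?mulr_gt0.
have [u hu] : exists u : R, sector_log (qemb K) L z 1 m u.
  by apply: sector_log_exists => //; [exact: zspanl|rewrite lt_eqF].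
have hs : sector_log (qemb K) L z e 1 c.
  have := @sector_log_swap _ _ (qemb K) v z 1 e c; rewrite mulr1; apply=> //.
  by rewrite gt_eqF.
have hem : sector_log (qemb K) L z e m (c + u).
  have [||p [q [p0 q0 E]]] := @between R K e m 1.
  - by rewrite nmulr_rgt0.
  - by rewrite nmulr_lgt0// detC oppr_lt0.
  by apply: (sector_logD _ p0 q0 E hs hu); rewrite lt_eqF.
have heem : sector_log (qemb K) L z e (e * m) (c + u + c').
  have [||p [q [p0 q0 E]]] := @between R K e (e * m) m.
  - by rewrite nmulr_rgt0.
  - by rewrite nmulr_lgt0.
  by apply: (sector_logD _ p0 q0 E hem h'); rewrite lt_eqF.
have := sector_logZ fL e0 ez o0 m1 hu; rewrite mulr1 => hu'.
by have := reg2_unique heem hu'; lra.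
Qed.

(* Clockwise, the rays are m, e m, e, 1. *)
Lemma sector_identity2 L (z e m : K) (c c' : R) :
  full_lattice L -> L 1 -> stable L z e ->
  0 < emb1 e < 1 -> 1 < emb2 e -> L m -> emb1 m < 0 -> 0 < emb2 m ->
  sector_log s2 L z 1 e c ->
  sector_log s2 L z (e * m) m c' -> c + c' = 0.
Proof.
move=> fL L1 ez /andP[e0 e1] e2 Lm m1 m2 h h'.
have o0 : 0 < s2 1 by rewrite rmorph1.
have e2' : 0 < emb2 e by exact: lt_trans e2.
have d1e : 0 < det 1 e by rewrite /det emb1_1 emb2_1; lra.
have d1m : 0 < det 1 m by rewrite /det emb1_1 emb2_1; lra.
have dem : 0 < det e m by rewrite /det; nra.
have demm : 0 < det (e * m) m.
  rewrite detC det_mul oppr_gt0 pmulr_llt0 ?nmulr_rlt0// subr_gt0; exact: lt_trans e2.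
have deem : 0 < det e (e * m) by rewrite -{1}[e]mulr1 detM !mulr_gt0.
have [u hu] : exists u : R, sector_log s2 L z 1 m u.
  by apply: sector_log_exists => //; rewrite gt_eqF.
have := sector_logZ fL (e2' : 0 < s2 e) ez o0 m2 hu; rewrite mulr1 => hu'.
have hem : sector_log s2 L z e m (u + c').
  have [||p [q [p0 q0 E]]] := @between R K e m (e * m).
  - by rewrite mulr_gt0.
  - by rewrite mulr_gt0.
  by apply: (sector_logD _ p0 q0 E hu' h'); rewrite gt_eqF.
have h1m : sector_log s2 L z 1 m (c + (u + c')).
  have [||p [q [p0 q0 E]]] := @between R K 1 m e.
  - by rewrite mulr_gt0.
  - by rewrite mulr_gt0.
  by apply: (sector_logD _ p0 q0 E h hem); rewrite gt_eqF.
by have := reg2_unique h1m hu; lra.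
Qed.

End Assembly.

(* For f = OK one has x_k = 1, y_k = 0 and double_sine w w = w^(-1/2), so that
   invariant1 equals eps^(-1/2) on every class: the first identity requires
   f <> OK. *)
Theorem theorem5p2p3 (R : realType) (K : realQuadratic R)
    (f : set K) (hf : integral_ideal f)
    (eps epsf : K)
    (heps : ray_unit_generator (@OK R K) eps)
    (hepsf : ray_unit_generator f epsf)
    (r : nat) (hr : r%:R = ln (emb1 epsf) / ln (emb1 eps))
    (mu2 : K) (hmu2 : f (mu2 - 1))
    (hmu2_pos : 0 < emb1 mu2) (hmu2_neg : emb2 mu2 < 0)
    (cl : set (set K)) (hcl : ray_class_group f cl)
    (D : decomposition f cl)
    (D' : decomposition f
            (ray_class_mul cl (ray_class f (principal mu2)))) :
  (f <> @OK R K -> invariant1 r D = (invariant1 r D')^-1) /\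
  invariant2 r D = invariant2 r D'.
Proof.
have fO : f `<=` @OK R K by case: hf.
have sf : OK_submodule f by apply: submodule_fractional; case: hf.
have [l [l1 l2 H zl]] := twist_lattice hf D D' hcl hmu2 hmu2_pos hmu2_neg.
have [[Of Of' fp ff] ef1 _] := hepsf.
have epsf0 : epsf != 0 by apply: emb1_neq0; case: fp.
have [n nE AE] := A_ray_unit D fO heps hepsf hr.
have fL := dec_b_full D.
have e0 : 0 < emb1 epsf^-1 < 1.
  rewrite -AE emb1_A_gt0 -(@emb1_1 R K) -(dec_A0 D); have := emb1_A_decr D 0 n.
  by rewrite add0r.
have e1 : 1 < emb2 epsf^-1.
  by rewrite -AE -(@emb2_1 R K) -(dec_A0 D); have := emb2_A_incr D 0 n; rewrite add0r.
have est : stable (dec_b D) (dec_z D) epsf^-1.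
  apply: dec_stable => //; [by rewrite invrK|by rewrite invr_eq0|].
  have -> : epsf^-1 - 1 = - epsf^-1 * (epsf - 1) by rewrite mulrBr mulr1 mulNr mulVf// opprK addrC.
  by have [_ _] := sf; apply => //; exact: OKN.
have l0 := emb1_neq0 l1.
(* The inverse of [l] carries the lattice of [D'] back to that of [D], and serves as the vector m of
   the cones. *)
have bl : dec_b D l^-1 by have := dec_b1 D'; rewrite H mul1r.
have HD' x : dec_b D x <-> dec_b D' (x / l^-1) by rewrite H invrK mulfK.
have bN x : dec_b D x -> dec_b D (- x) by exact: latticeN.
(* The second embedding of [l^-1] is negative, so the positive multiplier [- l^-1] is used there. *)
have HD'N x : dec_b D x <-> dec_b D' (x / - l^-1).
  rewrite H invrN invrK mulrN mulNr mulfK//; split; first exact: bN.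
  by move=> /bN; rewrite opprK.
split=> [fOK|].
  have [c h E] := @sector_log_period R K f cl D (qemb K) _ _ _ fO (emb1_A_gt0 D) heps hepsf hr.
  have [c' h' E'] := @sector_log_period R K f _ D' (qemb K) _ _ _ fO (emb1_A_gt0 D') heps hepsf hr.
  rewrite /invariant1 E E' -expRN; congr expR; apply/eqP; rewrite -addr_eq0; apply/eqP.
  have m1 : 0 < emb1 l^-1 by rewrite emb1V invr_gt0.
  have m2 : emb2 l^-1 < 0 by rewrite emb2V invr_lt0.
  have [w1 w2 w3] := dec_omega_reduced D.
  apply: (@sector_identity1 _ _ (dec_omega D) (dec_z D) epsf^-1 l^-1) => //.
  - by rewrite /det emb1_1 emb2_1 !mul1r lt_eqF// subr_lt0; exact: lt_trans w3.
  - exact: lt_trans w3.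
  - exact: dec_z_notin.
  (* Scaling by [l^-1] moves the cone of (1, e) to that of (m, e m) and the coset of [D'] to z +
     b. *)
  have := sector_log_scale (m1 : 0 < qemb K l^-1) _ _ HD' h'; rewrite mulr1 mulrC.
  rewrite [l^-1 * epsf^-1]mulrC => hs; apply: (sector_log_coset fL zl); apply: hs.
    by rewrite rmorph1.
  by have /andP[] := e0.
pose sg : {rmorphism K -> R} := qemb K \o qconj K.
have [c h E] := @sector_log_period R K f cl D sg _ _ _ fO (emb2_A_gt0 D) heps hepsf hr.
have [c' h' E'] := @sector_log_period R K f _ D' sg _ _ _ fO (emb2_A_gt0 D') heps hepsf hr.
rewrite /invariant2 [LHS]E [RHS]E'; congr expR; apply/eqP; rewrite -subr_eq0; apply/eqP.
have m1 : emb1 (- l^-1) < 0 by rewrite /emb1 rmorphN fmorphV oppr_lt0 invr_gt0.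
have m2 : 0 < emb2 (- l^-1) by rewrite /emb2 !rmorphN !fmorphV oppr_gt0 invr_lt0.
apply: (@sector_identity2 _ _ (dec_b D) (dec_z D) epsf^-1 (- l^-1)) => //.
- exact: dec_b1.
- exact: bN.
have := sector_log_scale (m2 : 0 < sg (- l^-1)) _ _ HD'N h'; rewrite mulr1 [- l^-1 * epsf^-1]mulrC.
(* The multiplier [- l^-1] leads to the coset -z + b; returning to z + b reverses the cone and turns
   c' into -c'. *)
move=> hs; rewrite -[dec_z D]opprK; apply: sector_logN.
apply: (sector_log_coset fL _ (hs _ _)).
- by rewrite mulNr -opprD; apply: bN; rewrite mulrC.
- by rewrite rmorph1.
- exact: lt_trans e1.
Qed.
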